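(* For every integer $m\ge 3$ there exists $\delta=\delta(m)>0$ with the following property: if $f(z)=z^{m}+\sum_{k=0}^{m-1}a_{k}z^{k}$ (with $a_k\in\mathbb{C}$) satisfies $|a_{k}|<\delta$ for all $1\le k\le m-1$ (no condition on $a_0$) and $\Omega(f)$ is simply connected, then the Brennan conjecture holds for $\Omega(f)$.
   Context: For a polynomial $f$ of degree $\ge 2$, $\Omega(f)=\{z\in\hat{\mathbb{C}}: f^{n}(z)\to\infty \text{ as } n\to+\infty\}$, where $f^n$ is the $n$-th iterate. We say the Brennan conjecture holds for a simply connected domain $\Omega\subsetneq\hat{\mathbb{C}}$ if for a (equivalently any) biholomorphic map $F:\Omega\to\mathbb{D}$ onto the unit disk and every $p\in(\tfrac43,4)$, one has $\int_{\Omega\cap\mathbb{C}}|F'(z)|^{p}\,dA(z)<+\infty$, where $dA$ is Lebesgue area measure. *)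

(* Defs.v *)
From HB Require Import structures.
From mathcomp Require Import all_boot all_order all_algebra.
From mathcomp Require Import all_classical all_reals all_analysis.
From mathcomp Require Import complex.
Set Implicit Arguments. Unset Strict Implicit. Unset Printing Implicit Defensive.
Import Order.TTheory GRing.Theory Num.Theory.
Import numFieldNormedType.Exports.
Local Open Scope classical_set_scope.
Local Open Scope ring_scope.

(* The complex plane C = R[i], seen as a numClosedFieldType, hence as a
   normed module over itself (topology, complex derivative). *)
Definition Cplx (R : realType) : numClosedFieldType := R[i].

(* The Riemann sphere: one-point compactification of C; [None] is infinity,
   [Some z] is the finite point z. *)
Definition Chat (R : realType) : topologicalType :=
  one_point_compactification (Cplx R).

Definition cabs (R : realType) (z : Cplx R) : R :=
  Num.sqrt (complex.Re z ^+ 2 + complex.Im z ^+ 2).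

Definition monic_poly_fun (R : realType) (m : nat) (a : nat -> Cplx R)
  (z : Cplx R) : Cplx R :=
  z ^+ m + \sum_(k < m) a k * z ^+ k.

(* Omega(f) = { z in Chat : f^n(z) -> infinity }.  Infinity is a fixed point
   of the polynomial f (deg >= 2), so it belongs to Omega(f); a finite z
   belongs to Omega(f) iff |f^n(z)| -> +oo. *)
Definition basin_infinity (R : realType) (f : Cplx R -> Cplx R) : set (Chat R) :=
  fun w => match w with
           | None => True
           | Some z => forall M : R, exists N : nat,
                         forall n : nat, (N <= n)%N -> M < cabs (iter n f z)
           end.

Definition I01 (R : realType) : set R := [set` `[(0:R), 1]%R].
Arguments I01 R : clear implicits.

Definition path_in (R : realType) (T : topologicalType) (A : set T)
  (g : R -> T) : Prop :=
  {within I01 R, continuous g} /\ g @` I01 R `<=` A.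

Definition simply_connected (R : realType) (T : topologicalType) (A : set T)
  : Prop :=
  A !=set0 /\
  (forall x y, A x -> A y ->
     exists g : R -> T, path_in A g /\ g 0 = x /\ g 1 = y) /\
  (forall g : R -> T, path_in A g -> g 0 = g 1 ->
     exists H : R * R -> T,
       {within I01 R `*` I01 R, continuous H} /\
       H @` (I01 R `*` I01 R) `<=` A /\
       (forall s, I01 R s -> H (s, 0) = g s) /\
       (forall s, I01 R s -> H (s, 1) = g 0) /\
       (forall t, I01 R t -> H (0, t) = H (1, t))).

(* F : Om -> D is biholomorphic, for Om a subset of the Riemann sphere:
   F is a bijection from Om onto the unit disk, complex-differentiable at
   every finite point of Om, and holomorphic at infinity when infinity is in
   Om (i.e. u |-> F(1/u), u |-> F(infinity) at u = 0, is complex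
   differentiable at 0).  (The inverse of a holomorphic bijection is
   automatically holomorphic.) *)
Definition biholomorphic_onto_disk (R : realType) (Om : set (Chat R))
  (F : Chat R -> Cplx R) : Prop :=
  (forall w, Om w -> cabs (F w) < 1) /\
  (forall w1 w2, Om w1 -> Om w2 -> F w1 = F w2 -> w1 = w2) /\
  (forall u : Cplx R, cabs u < 1 -> exists w, Om w /\ F w = u) /\
  (forall z : Cplx R, Om (Some z) -> derivable (fun u => F (Some u)) z 1) /\
  (Om None ->
     derivable (fun u : Cplx R => if u == 0 then F None else F (Some u^-1))
               0 1).

(* Lebesgue area measure on C, identifying x + iy with (x, y) in R^2. *)
Definition area_measure (R : realType) :=
  ((@lebesgue_measure R) \x (@lebesgue_measure R))%E.

Definition brennan_holds (R : realType) (Om : set (Chat R)) : Prop :=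
  exists F : Chat R -> Cplx R,
    biholomorphic_onto_disk Om F /\
    forall p : R, 4 / 3 < p < 4 ->
      (\int[@area_measure R]_(xy in [set xy : R * R | Om (Some (xy.1 +i* xy.2)%C)])
          ((cabs (derive1 (fun u => F (Some u)) (xy.1 +i* xy.2)%C)) `^ p)%:E
        < +oo)%E.

(* Main.v *)
(* Put [c = a 0].  Lifting logarithms along paths of the simply connected basin
   turns the formal Boettcher product at infinity into a holomorphic map [Psi]
   with [Psi (f z) = Psi z ^ m], which is the Riemann map: it is onto by
   connectedness of rays and injective by counting m-th roots.  In particular
   [f] has no critical point in the basin, which forces [|c|^2 <= 2.1].

   Near infinity [|Psi'|] is [O(|z|^-2)], so [|Psi'|^p] is integrable there.  If
   [f^n z] is the first iterate to leave a large disk, then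
   [|Psi' z| <= K m^-n |(f^n)' z|], so, bounding [|Psi'|^p] by
   [1 + |Psi'|^4], it suffices to sum over [n] the integrals of
   [m^-4n |(f^n)'|^4] over the sets of such [z].  A change of variables reduces
   this to a bound on the sum of [|(f^n)' w|^2] over the preimages [w] of a
   point under [f^n], i.e. on the powers of the transfer operator
   [g |-> (z |-> \sum_(f w = z) |f' w|^2 g w)].  The function
   [|w - c|^2 + 1] is an explicit supersolution with factor [19/20 m^4]
   because [f] is close to [z^m + c], so the sum over [n] is geometric. *)

Require Import Defs.
From HB Require Import structures.
From mathcomp Require Import all_boot all_order all_algebra.
From mathcomp Require Import all_classical all_reals all_analysis.
From mathcomp Require Import measurable_realfun simple_functions complex ring lra zify.
From mathcomp Require separable.
Set Implicit Arguments.
Unset Strict Implicit.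
Unset Printing Implicit Defensive.
Import Order.TTheory GRing.Theory Num.Theory.
Import numFieldNormedType.Exports.
Local Open Scope classical_set_scope.
Local Open Scope ring_scope.

(** The construction is carried out in the coordinate u = 1 / (z - kappa), with kappa a fixed point
    of f. As kappa is not in the basin, u is finite there, and f becomes u^m / Q(u) for a polynomial
    Q with Q(0) = 1. A zero of Q corresponds to a preimage of kappa, so Q does not vanish on the
    basin, and a logarithm of 1 / Q is all that must be lifted. Cauchy theory is avoided. Lipschitz
    bounds on one small disk around infinity give convergence, derivatives and local inversion
    there, and the functional equation carries them to the whole basin, since each orbit enters that
    disk after finitely many steps. The integral is dominated by countably many squares with
    heights, so the change of variables becomes a comparison of areas: a small square of the image
    plane against the squares that cover the components of its preimage. The constant 2.1 comes from
    z^3 + c, whose critical orbit escapes as soon as |c|^2 > 2; for larger m the threshold is lower,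
    and the excess 0.1 absorbs the perturbation. *)

Section Modulus.
Context {R : realType}.
Local Notation C := (Cplx R).
Implicit Types (x y z w : C).
Import ComplexField.Normc.

Lemma cabs_normc z : cabs z = normc z.
Proof. by case: z. Qed.

Lemma normC_cabs z : `|z| = real_complex R (cabs z) :> C.
Proof. by case: z. Qed.

Lemma cabs_ge0 z : 0 <= cabs z.
Proof. exact: sqrtr_ge0. Qed.

Lemma cabs0 : cabs (0 : C) = 0.
Proof. by rewrite cabs_normc normc0. Qed.

Lemma cabs1 : cabs (1 : C) = 1.
Proof. by rewrite cabs_normc normc1. Qed.

Lemma cabsM x y : cabs (x * y) = cabs x * cabs y.
Proof. by rewrite !cabs_normc normcM. Qed.

Lemma cabsV x : cabs (x^-1) = (cabs x)^-1.
Proof. by rewrite !cabs_normc normcV. Qed.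

Lemma cabsN x : cabs (- x) = cabs x.
Proof. by rewrite !cabs_normc normcN. Qed.

Lemma cabsX x n : cabs (x ^+ n) = cabs x ^+ n.
Proof. by elim: n => [|n IH]; rewrite ?cabs1 // !exprS cabsM IH. Qed.

Lemma cabsD x y : cabs (x + y) <= cabs x + cabs y.
Proof. by rewrite !cabs_normc le_normcD. Qed.

Lemma cabsBC x y : cabs (x - y) = cabs (y - x).
Proof. by rewrite -cabsN opprB. Qed.

Lemma cabsB x y : cabs (x - y) <= cabs x + cabs y.
Proof. by rewrite -(cabsN y) cabsD. Qed.

Lemma cabsB3 y x z : cabs (x - z) <= cabs (x - y) + cabs (y - z).
Proof. by have := cabsD (x - y) (y - z); rewrite addrA subrK. Qed.

Lemma cabs_le_sub x y : cabs x - cabs y <= cabs (x - y).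
Proof. by have := cabsD (x - y) y; rewrite subrK; lra. Qed.

Lemma cabs_eq0 x : (cabs x == 0) = (x == 0).
Proof.
apply/eqP/eqP => [|->]; last exact: cabs0.
by rewrite cabs_normc => /eq0_normc.
Qed.

Lemma cabs_gt0 x : (0 < cabs x) = (x != 0).
Proof. by rewrite lt_neqAle cabs_ge0 andbT eq_sym cabs_eq0. Qed.

Lemma cabs_le0 x : cabs x <= 0 -> x = 0.
Proof. by move=> h; apply/eqP; rewrite -cabs_eq0 eq_le h cabs_ge0. Qed.

Lemma cabs_real (t : R) : cabs (real_complex R t : C) = `|t|.
Proof. by rewrite /cabs /= expr0n addr0 sqrtr_sqr. Qed.

Lemma cabs_nat n : cabs (n%:R : C) = n%:R.
Proof. by rewrite -(rmorph_nat (real_complex R)) cabs_real normr_nat. Qed.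

Lemma cabs_sum I (r : seq I) (P : pred I) (F : I -> C) :
  cabs (\sum_(i <- r | P i) F i) <= \sum_(i <- r | P i) cabs (F i).
Proof.
elim/big_ind2: _ => [|x1 x2 y1 y2 h1 h2|//]; first by rewrite cabs0.
by apply: (le_trans (cabsD _ _)); lra.
Qed.

Lemma cabs_Re z : `|complex.Re z| <= cabs z.
Proof.
rewrite -sqrtr_sqr /cabs ler_wsqrtr // lerDl; exact: sqr_ge0.
Qed.

Lemma cabs_Im z : `|complex.Im z| <= cabs z.
Proof.
rewrite -sqrtr_sqr /cabs ler_wsqrtr // lerDr; exact: sqr_ge0.
Qed.

Lemma cabs_ReIm z : cabs z <= `|complex.Re z| + `|complex.Im z|.
Proof.
case: z => a b; rewrite /cabs /=.
rewrite -[leRHS]ger0_norm ?addr_ge0// -sqrtr_sqr ler_wsqrtr // sqrrD !real_normK ?num_real//.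
by rewrite -addrA lerD2l lerDr mulrn_wge0 // mulr_ge0.
Qed.

Lemma cabs_sqr z : cabs z ^+ 2 = complex.Re z ^+ 2 + complex.Im z ^+ 2.
Proof. by rewrite /cabs sqr_sqrtr // addr_ge0 ?sqr_ge0. Qed.

Lemma ReB x y : complex.Re (x - y) = complex.Re x - complex.Re y.
Proof. by case: x y => a b [c d]. Qed.

Lemma ImB x y : complex.Im (x - y) = complex.Im x - complex.Im y.
Proof. by case: x y => a b [c d]. Qed.

End Modulus.

(** * Limits of sequences with geometrically decreasing increments *)

Section GeometricLimits.
Context {R : realType}.
Local Notation C := (Cplx R).

Lemma geo_small (q e : R) : 0 <= q < 1 -> 0 < e -> exists n, q ^+ n < e.
Proof.
move=> /andP[q0 q1] e0.
have : (GRing.exp q : R^nat) @ \oo --> (0 : R) by apply: cvg_expr; rewrite ger0_norm.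
move=> /cvgrPdist_lt/(_ _ e0)[n _ /(_ n (leqnn _))].
by rewrite /= sub0r normrN ger0_norm ?exprn_ge0 // => h; exists n.
Qed.

Lemma le_geo0 (a K q : R) : 0 <= q < 1 -> (forall n, a <= K * q ^+ n) -> a <= 0.
Proof.
move=> q01 h; rewrite leNgt; apply/negP => a0.
have K0 : 0 < K by have := h 0%N; rewrite expr0; lra.
have [n hn] := geo_small q01 (divr_gt0 a0 K0).
have := h n; move: hn; rewrite ltr_pdivlMr // mulrC; lra.
Qed.

(** The intervals of centre [s n] and radius the geometric tail K q^n / (1 - q) meet pairwise, so
    the supremum of their left ends lies in all of them. The explicit rate, rather than mere
    convergence, is what later estimates use. *)
Lemma geo_lim_real (q K : R) (s : nat -> R) : 0 <= q < 1 ->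
  (forall n, `|s n.+1 - s n| <= K * q ^+ n) ->
  exists l, forall n, `|s n - l| <= K * q ^+ n / (1 - q).
Proof.
move=> q01 h; have /andP[q0 q1] := q01.
have p0 : 0 < 1 - q by lra.
have K0 : 0 <= K by have := h 0%N; rewrite expr0 mulr1; apply: le_trans.
pose e n := K * q ^+ n / (1 - q).
have e0 n : 0 <= e n by rewrite /e divr_ge0 ?mulr_ge0 ?exprn_ge0 // ltW.
have eS n : e n = K * q ^+ n + e n.+1.
  by rewrite /e exprS; field; rewrite lt0r_neq0.
have hk n k : `|s (n + k)%N - s n| <= e n - e (n + k)%N.
  elim: k => [|k IH]; first by rewrite addn0 !subrr normr0.
  rewrite addnS; have := h (n + k)%N; have := eS (n + k)%N.
  have := ler_distD (s (n + k)%N) (s (n + k).+1) (s n); lra.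
have hab n k : s n - e n <= s k + e k.
  have [/subnK|/ltnW /subnK] := leqP n k; rewrite addnC => <-.
    by have := hk n (k - n)%N; have := e0 (n + (k - n))%N; rewrite ler_norml => ? /andP[]; lra.
  by have := hk k (n - k)%N; have := e0 (k + (n - k))%N; rewrite ler_norml => ? /andP[]; lra.
pose A := [set s n - e n | n in [set: nat]].
exists (sup A) => n.
have hu : s n - e n <= sup A.
  by apply: ub_le_sup; [exists (s 0%N + e 0%N) => _ [k _ <-]|exists n].
have hl : sup A <= s n + e n.
  by apply: ge_sup; [exists (s 0%N - e 0%N), 0%N|move=> _ [k _ <-]].
by rewrite ler_norml -/(e n); lra.
Qed.

Lemma geo_lim (q K : R) (s : nat -> C) : 0 <= q < 1 ->
  (forall n, cabs (s n.+1 - s n) <= K * q ^+ n) ->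
  exists l, forall n, cabs (s n - l) <= 2 * (K * q ^+ n / (1 - q)).
Proof.
move=> q01 h.
have [|a ha] := @geo_lim_real q K (fun n => complex.Re (s n)) q01.
  by move=> n; rewrite -ReB (le_trans (cabs_Re _)).
have [|b hb] := @geo_lim_real q K (fun n => complex.Im (s n)) q01.
  by move=> n; rewrite -ImB (le_trans (cabs_Im _)).
exists (Complex a b) => n; rewrite (le_trans (cabs_ReIm _)) // ReB ImB /=.
by have := ha n; have := hb n; lra.
Qed.

End GeometricLimits.

(** * Quantitative local inversion of maps close to the identity *)

Section LocalInversion.
Context {R : realType}.
Local Notation C := (Cplx R).

(** On a disk, [g] differs from the identity by a 1/2-Lipschitz map. This one condition yields
    two-sided Lipschitz bounds, injectivity and an inverse with explicit constants; it is applied to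
    the exponential minus 1 and to the Boettcher map at infinity. *)
Definition near_id (r : R) (g : C -> C) :=
  forall x y, cabs x <= r -> cabs y <= r -> cabs (g x - g y - (x - y)) <= cabs (x - y) / 2.

Lemma near_id_expand (r : R) (g : C -> C) x y : near_id r g ->
  cabs x <= r -> cabs y <= r -> cabs (x - y) <= 2 * cabs (g x - g y).
Proof.
move=> h /h{}h /h{}h.
by have := cabsD (g x - g y - (x - y)) (- (g x - g y)); rewrite addrAC subrr add0r !cabsN; lra.
Qed.

Lemma near_id_lip (r : R) (g : C -> C) x y : near_id r g ->
  cabs x <= r -> cabs y <= r -> cabs (g x - g y) <= 2 * cabs (x - y).
Proof.
move=> h /h{}h /h{}h.
have := cabsD (g x - g y - (x - y)) (x - y); rewrite subrK.
have := cabs_ge0 (x - y); lra.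
Qed.

Lemma near_id_inj (r : R) (g : C -> C) x y : near_id r g ->
  cabs x <= r -> cabs y <= r -> g x = g y -> x = y.
Proof.
move=> h hx hy e; have := near_id_expand h hx hy.
by rewrite e subrr cabs0 mulr0 => /cabs_le0/eqP; rewrite subr_eq0 => /eqP.
Qed.

(** The map x |-> x - (g x - w), a contraction of factor 1/2, is iterated from 0. The bound 2 |w| (1
    - 2^-n) on the n-th point keeps the orbit in the disk where the hypothesis applies. *)
Lemma near_id_surj (r : R) (g : C -> C) w : 0 < r -> g 0 = 0 -> near_id r g ->
  cabs w <= r / 2 -> exists2 x, cabs x <= 2 * cabs w & g x = w.
Proof.
move=> r0 g0 hg hw.
pose s := fix s n := if n is n'.+1 then s n' - (g (s n') - w) else 0 : C.
have w0 := cabs_ge0 w.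
pose h := (2^-1 : R).
have hE n : h ^+ n = 2 * h ^+ n.+1 by rewrite exprS /h; field.
have h0 n : 0 < h ^+ n by rewrite exprn_gt0 // invr_gt0.
have hs n : cabs (s n) <= 2 * cabs w * (1 - h ^+ n) /\ cabs (s n.+1 - s n) <= cabs w * h ^+ n.
  elim: n => [|n [IH1 IH2]].
    rewrite /= !expr0 subrr cabs0 mulr0 g0 mulr1; split=> //.
    by rewrite (_ : _ - _ = w) //; ring.
  have hn := hE n; have a0 := h0 n; have a1 := h0 n.+1.
  have S1 : cabs (s n.+1) <= 2 * cabs w * (1 - h ^+ n.+1).
    have := cabsD (s n.+1 - s n) (s n); rewrite subrK.
    rewrite hn in IH1 IH2; lra.
  split=> //.
  have -> : s n.+2 - s n.+1 = - (g (s n.+1) - g (s n) - (s n.+1 - s n)).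
    by rewrite /=; ring.
  rewrite cabsN (le_trans (hg _ _ _ _)) //; last by rewrite exprS /h; lra.
    by apply: (le_trans S1); nra.
  by apply: (le_trans IH1); nra.
have h01 : 0 <= h < 1 by rewrite /h; lra.
have [x hx] := geo_lim h01 (fun n => (hs n).2).
have hx2 n : cabs (s n - x) <= 4 * cabs w * h ^+ n.
  apply: (le_trans (hx n)); have -> : 1 - h = 2^-1 by rewrite /h; lra.
  by rewrite invrK; lra.
have xw : cabs x <= 2 * cabs w.
  rewrite -subr_le0; apply: (@le_geo0 _ _ (4 * cabs w) h) => // n.
  have := hx2 n; have := (hs n).1; have := h0 n.
  by have := cabs_le_sub x (s n); rewrite cabsBC; nra.
exists x => //.
apply/eqP; rewrite -subr_eq0; apply/eqP/cabs_le0.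
apply: (@le_geo0 _ _ (9 * cabs w) h) => // n.
have xr : cabs x <= r by lra.
have sr : cabs (s n) <= r by apply: (le_trans (hs n).1); have := h0 n; nra.
have := near_id_lip hg xr sr; rewrite [cabs (x - _)]cabsBC.
have := (hs n).2; rewrite /= addrAC subrr add0r cabsN.
by have := cabsB3 (g (s n)) (g x) w; have := hx2 n; lra.
Qed.

End LocalInversion.

(** * Complex differentiability by first-order expansions *)

Section ComplexDerivative.
Context {R : realType}.
Local Notation C := (Cplx R).
Implicit Types (f g : C -> C) (z w D : C).

(** Stated without quotients and with real epsilons, so that estimates on [cabs] apply directly;
    [cderiv_derivable] leads back to the derivative used in [brennan_holds]. *)
Definition cderiv f z D := forall e : R, 0 < e -> exists2 d : R, 0 < d &
  forall w, cabs (w - z) < d -> cabs (f w - f z - D * (w - z)) <= e * cabs (w - z).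

Definition ccont f z := forall e : R, 0 < e -> exists2 d : R, 0 < d &
  forall w, cabs (w - z) < d -> cabs (f w - f z) < e.

Lemma cderiv_lip f z D : cderiv f z D -> exists2 d : R, 0 < d &
  forall w, cabs (w - z) < d -> cabs (f w - f z) <= (cabs D + 1) * cabs (w - z).
Proof.
move=> h; have [d d0 hd] := h 1 ltr01; exists d => // w /hd.
by have := cabsD (f w - f z - D * (w - z)) (D * (w - z)); rewrite subrK cabsM; lra.
Qed.

Lemma cderiv_cont f z D : cderiv f z D -> ccont f z.
Proof.
move=> /cderiv_lip[d d0 hd] e e0.
have D0 := cabs_ge0 D.
exists (Num.min d (e / (cabs D + 1))); first by rewrite lt_min d0 divr_gt0 //; lra.
move=> w; rewrite lt_min => /andP[/hd h]; rewrite ltr_pdivlMr; last lra.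
by rewrite mulrC; apply: le_lt_trans.
Qed.

Lemma cderiv_cst c z : cderiv (fun _ => c) z 0.
Proof.
by move=> e e0; exists 1 => // w _; rewrite subrr mul0r subrr cabs0 mulr_ge0 ?cabs_ge0 // ltW.
Qed.

Lemma cderiv_id z : cderiv id z 1.
Proof.
by move=> e e0; exists 1 => // w _; rewrite mul1r subrr cabs0 mulr_ge0 ?cabs_ge0 // ltW.
Qed.

Lemma cderivD f g z Df Dg : cderiv f z Df -> cderiv g z Dg ->
  cderiv (fun w => f w + g w) z (Df + Dg).
Proof.
move=> hf hg e e0; have e20 : 0 < e / 2 by lra.
have [d d0 hd] := hf _ e20; have [d' d'0 hd'] := hg _ e20.
exists (Num.min d d'); first by rewrite lt_min d0.
move=> w; rewrite lt_min => /andP[/hd h /hd' h'].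
rewrite (_ : _ - _ - _ = (f w - f z - Df * (w - z)) + (g w - g z - Dg * (w - z))); last by ring.
by apply: (le_trans (cabsD _ _)); lra.
Qed.

Lemma cderivM f g z Df Dg : cderiv f z Df -> cderiv g z Dg ->
  cderiv (fun w => f w * g w) z (Df * g z + f z * Dg).
Proof.
move=> hf hg e e0.
have fz0 := cabs_ge0 (f z); have gz0 := cabs_ge0 (g z); have Df0 := cabs_ge0 Df.
pose M := cabs (f z) + cabs (g z) + cabs Df + 1.
have M0 : 0 < M by rewrite /M; lra.
pose e' := Num.min 1 (e / (4 * M)).
have e'0 : 0 < e' by rewrite lt_min ltr01 divr_gt0 // mulr_gt0.
have e'1 : e' <= 1 by rewrite ge_min lexx.
have e'e : e' * (4 * M) <= e by rewrite -ler_pdivlMr ?mulr_gt0 // ge_min lexx orbT.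
have [d d0 hd] := hf _ e'0; have [d' d'0 hd'] := hg _ e'0.
have [d2 d20 hd2] := cderiv_cont hg e'0.
exists (Num.min d (Num.min d' d2)); first by rewrite !lt_min d0 d'0.
move=> w; rewrite !lt_min => /andP[/hd h /andP[/hd' h' /hd2 h2]].
rewrite (_ : _ - _ - _ = (f w - f z - Df * (w - z)) * (g w - g z) + (f w - f z - Df * (w - z)) * g z
  + (Df * (w - z) * (g w - g z)) + f z * (g w - g z - Dg * (w - z))); last by ring.
set A := f w - f z - Df * (w - z) in h *; set B := g w - g z - _ in h' *.
set G := g w - g z in h2 *.
have := cabsD (A * G + A * g z + Df * (w - z) * G) (f z * B).
have := cabsD (A * G + A * g z) (Df * (w - z) * G).
have := cabsD (A * G) (A * g z).
rewrite !cabsM; have := cabs_ge0 A; have := cabs_ge0 B; have := cabs_ge0 G; have := cabs_ge0 (w - z).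
set t := cabs (w - z) in h h' *; move: h h' h2.
set a := cabs A; set b := cabs B; set c := cabs G => h h' h2 t0 c0 b0 a0 i1 i2 i3.
apply: (@le_trans _ _ (e' * (4 * M) * t)); last by rewrite ler_wpM2r.
have j1 : a * c <= e' * t by nra.
have j2 : a * cabs (g z) <= e' * t * cabs (g z) by rewrite ler_wpM2r.
have j3 : cabs Df * t * c <= cabs Df * t * e' by rewrite ler_wpM2l ?mulr_ge0 // ltW.
have j4 : cabs (f z) * b <= cabs (f z) * (e' * t) by rewrite ler_wpM2l.
have et : 0 <= e' * t by rewrite mulr_ge0 // ltW.
by rewrite /M; nra.
Qed.

Lemma cderiv_comp f g z Df Dg : cderiv f z Df -> cderiv g (f z) Dg ->
  cderiv (fun w => g (f w)) z (Dg * Df).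
Proof.
move=> hf hg e e0.
have Df0 := cabs_ge0 Df; have Dg0 := cabs_ge0 Dg.
have [dl dl0 hl] := cderiv_lip hf.
pose e1 := e / (2 * (cabs Df + 1)); pose e2 := e / (2 * (cabs Dg + 1)).
have e10 : 0 < e1 by rewrite divr_gt0 // mulr_gt0 //; lra.
have e20 : 0 < e2 by rewrite divr_gt0 // mulr_gt0 //; lra.
have e1e : e1 * (cabs Df + 1) = e / 2 by rewrite /e1; field; lra.
have e2e : e2 * (cabs Dg + 1) = e / 2 by rewrite /e2; field; lra.
have [d1 d10 h1] := hg _ e10; have [d2 d20 h2] := hf _ e20.
have [d3 d30 h3] := cderiv_cont hf d10.
exists (Num.min dl (Num.min d2 d3)); first by rewrite !lt_min dl0 d20.
move=> w; rewrite !lt_min => /andP[/hl hl' /andP[/h2{}h2 /h3/h1{}h1]].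
rewrite (_ : _ - _ - _ = (g (f w) - g (f z) - Dg * (f w - f z)) + Dg * (f w - f z - Df * (w - z))); last by ring.
apply: (le_trans (cabsD _ _)); rewrite cabsM.
have t0 := cabs_ge0 (w - z).
have : cabs Dg * cabs (f w - f z - Df * (w - z)) <= (cabs Dg + 1) * (e2 * cabs (w - z)).
  by rewrite ler_pM ?cabs_ge0 //; lra.
have : e1 * cabs (f w - f z) <= e1 * ((cabs Df + 1) * cabs (w - z)) by rewrite ler_pM2l.
have -> : (cabs Dg + 1) * (e2 * cabs (w - z)) = e / 2 * cabs (w - z) by rewrite -e2e; ring.
have -> : e1 * ((cabs Df + 1) * cabs (w - z)) = e / 2 * cabs (w - z) by rewrite -e1e; ring.
lra.
Qed.

Lemma cderivV z : z != 0 -> cderiv (fun w => w^-1) z (- z^-1 ^+ 2).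
Proof.
move=> z0 e e0; have az0 : 0 < cabs z by rewrite cabs_gt0.
exists (Num.min (cabs z / 2) (e * cabs z ^+ 3 / 2)).
  by rewrite lt_min !divr_gt0 // mulr_gt0 // exprn_gt0.
move=> w; rewrite lt_min => /andP[h1 h2].
have aw : cabs z / 2 < cabs w by have := cabs_le_sub z w; rewrite cabsBC; lra.
have w0 : w != 0 by rewrite -cabs_gt0; lra.
rewrite (_ : _ - _ - _ = (w - z) ^+ 2 / (w * z ^+ 2)); last by field; rewrite z0 w0.
rewrite cabsM cabsX cabsV cabsM cabsX ler_pdivrMr; last by rewrite mulr_gt0 ?exprn_gt0 //; lra.
rewrite expr2 (_ : e * _ * _ = e * (cabs w * cabs z ^+ 2) * cabs (w - z)); last by ring.
rewrite ler_wpM2r ?cabs_ge0 //; apply: (le_trans (ltW h2)).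
rewrite -mulrA ler_pM2l // (_ : _ / 2 = cabs z / 2 * cabs z ^+ 2); last by ring.
by rewrite ler_wpM2r ?exprn_ge0 ?cabs_ge0 // ltW.
Qed.

Lemma cderiv_eq f z D D' : D = D' -> cderiv f z D -> cderiv f z D'.
Proof. by move=> ->. Qed.

Lemma cderiv_ext f g z D (r : R) : 0 < r ->
  (forall w, cabs (w - z) < r -> f w = g w) -> cderiv f z D -> cderiv g z D.
Proof.
move=> r0 E h e /h[d d0 hd]; exists (Num.min d r); first by rewrite lt_min d0.
by move=> w; rewrite lt_min => /andP[/hd + hr]; rewrite !E // subrr cabs0.
Qed.

Lemma cderiv_horner (p : {poly C}) z : cderiv (horner p) z (p^`()).[z].
Proof.
elim/poly_ind: p => [|p c IH].
  rewrite derivC horner0; apply: (@cderiv_ext (fun _ => 0) _ _ _ 1) => //; last exact: cderiv_cst.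
  by move=> w _; rewrite horner0.
apply: (@cderiv_ext (fun w => p.[w] * w + c) _ _ _ 1) => //.
  by move=> w _; rewrite !hornerE.
apply: cderiv_eq (cderivD (cderivM IH (cderiv_id z)) (cderiv_cst c z)).
by rewrite derivD derivM derivX derivC !hornerE.
Qed.

Lemma cderivXn z n : cderiv (fun w => w ^+ n) z (n%:R * z ^+ n.-1).
Proof.
apply: (@cderiv_ext (horner 'X^n) _ _ _ 1) => //; first by move=> w _; rewrite !hornerE.
by apply: cderiv_eq (cderiv_horner 'X^n z); rewrite derivXn hornerMn !hornerE mulr_natl.
Qed.

(** This takes the place of the Cauchy estimates, for the terms of a series and for the Boettcher
    map at infinity. It suffices to test the expansion at one point z + t with t > 0 small. *)
Lemma cderiv_bound f z D (L r : R) : 0 < r -> cderiv f z D ->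
  (forall w, cabs (w - z) < r -> cabs (f w - f z) <= L * cabs (w - z)) -> cabs D <= L.
Proof.
move=> r0 h hL; rewrite -subr_le0.
apply/ler_addgt0Pr => e e0; rewrite add0r.
have [d d0 hd] := h _ e0.
pose t := Num.min d r / 2.
have t0 : 0 < t by rewrite divr_gt0 // lt_min d0.
have td : t < d /\ t < r.
  by have : Num.min d r <= d /\ Num.min d r <= r; [rewrite !ge_min !lexx orbT|rewrite /t in t0 *; lra].
pose w := z + real_complex R t.
have wz : w - z = real_complex R t by rewrite /w addrC addKr.
have awz : cabs (w - z) = t by rewrite wz cabs_real gtr0_norm.
have := hd w; have := hL w; rewrite awz => /(_ td.2) h1 /(_ td.1) h2.
have := cabsB (f w - f z) (f w - f z - D * (w - z)).
rewrite (_ : _ - (_ - _) = D * (w - z)); last by ring.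
rewrite cabsM awz => h3; rewrite -(ler_pM2r t0) mulrBl; lra.
Qed.

Lemma cderiv_derivable f z D : cderiv f z D -> derivable f z 1 /\ derive1 f z = D.
Proof.
move=> h.
have key : (fun k : C => k^-1 *: (f (k + z) - f z)) @ 0^' --> D.
  apply/cvgrPdist_le => e e0.
  have [r r0 ->] : exists2 r : R, 0 < r & e = real_complex R r.
    by case: e e0 => a b; rewrite ltcE /= => /andP[/eqP -> ?]; exists a.
  have [d d0 hd] := h _ r0.
  rewrite near_withinE; apply/nbhs_ballP; exists (real_complex R d : C) => /=; first by rewrite ltcR.
  move=> k; rewrite /ball /= sub0r normrN normC_cabs ltcR => kd k0.
  rewrite normC_cabs lecR -[_ *: _]/(_ * _).
  rewrite (_ : D - _ = - ((f (k + z) - f z - D * k) * k^-1)); last by field.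
  have := hd (k + z); rewrite addrK => /(_ kd).
  have kk0 : 0 < cabs k by rewrite cabs_gt0.
  by rewrite cabsN cabsM cabsV -ler_pdivrMr.
split.
  by apply/cvg_ex; exists D; move: key; rewrite /= => key; under eq_fun do rewrite /= /GRing.scale /= mulr1.
exact/cvg_lim.
Qed.

End ComplexDerivative.

(** * The complex exponential and its local inverse at 1 *)

Section ComplexExponential.
Context {R : realType}.
Local Notation C := (Cplx R).
Implicit Types (z w D : C).

Lemma is_derive_approx (f : R -> R) (x d : R) : is_derive x 1 f d ->
  forall e : R, 0 < e -> exists2 dl : R, 0 < dl &
    forall h, `|h| < dl -> `|f (x + h) - f x - d * h| <= e * `|h|.
Proof.
move=> [df dv] e e0.
have : (fun h : R => h^-1 *: ((f \o shift x) (h *: 1) - f x)) @ 0^' --> d.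
  by rewrite -dv.
move=> /cvgrPdist_le/(_ _ e0); rewrite near_withinE => /nbhs_ballP[dl /= dl0 hd].
exists dl => // h hh; have [->|h0] := eqVneq h 0.
  by rewrite addr0 subrr mulr0 subrr normr0 mulr0.
have := hd h; rewrite /ball /= sub0r normrN => /(_ hh h0).
rewrite -[_ *: 1]/(h * 1) mulr1 -[_ *: _]/(_ * _) [h + x]addrC => hd'.
rewrite (_ : _ - _ = - ((d - h^-1 * (f (x + h) - f x)) * h)); last by field.
by rewrite normrN normrM ler_wpM2r.
Qed.

Definition cexp z : C :=
  Complex (expR (complex.Re z) * cos (complex.Im z)) (expR (complex.Re z) * sin (complex.Im z)).

Lemma cexp0 : cexp 0 = 1.
Proof. by rewrite /cexp /= expR0 cos0 sin0 mulr1 mulr0. Qed.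

Lemma cexpD z w : cexp (z + w) = cexp z * cexp w.
Proof.
case: z w => a b [c d]; rewrite /cexp /= expRD cosD sinD.
rewrite -[RHS]/(Complex _ _); congr Complex; ring.
Qed.

Lemma cexp_neq0 z : cexp z != 0.
Proof.
apply/negP => /eqP h; have := cexpD z (- z).
by rewrite subrr cexp0 h mul0r => /eqP; rewrite oner_eq0.
Qed.

Lemma cexpB z w : cexp (z - w) = cexp z / cexp w.
Proof. by rewrite -[in RHS](subrK w z) [in RHS]cexpD mulfK // cexp_neq0. Qed.

Lemma cexpMn z n : cexp (n%:R * z) = cexp z ^+ n.
Proof.
elim: n => [|n IH]; first by rewrite mul0r cexp0.
by rewrite -natr1 mulrDl mul1r cexpD IH exprSr.
Qed.

(** Here [aE], [aK] and [aS] are the sizes of the errors in the first-order expansions of [expR],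
    [cos] and [sin] at 0, while [X], [Y] and [t] are |x|, |y| and |x + iy|. The errors add up to at
    most 10 e' t. *)
Let cexp_arith (X Y t aE aK aS A B D e' e : R) : 0 < e' -> e' <= 1 -> e' * 10 <= e ->
  0 <= X -> 0 <= Y -> X <= t -> Y <= t -> t < e' -> 0 <= aK -> 0 <= A -> 0 <= B -> 0 <= D ->
  aE <= e' * X -> aK <= e' * Y -> aS <= e' * Y -> A <= 1 + X + aE -> B <= X + aE -> D <= Y + aS ->
  aE + A * aK + (aS + B * D) <= e * t.
Proof.
move=> e'0 e'1 e'e X0 Y0 xt yt te K0 A0 B0 D0 hE hK hS i1 i2 i3.
have eX : e' * X <= X by rewrite ler_piMl.
have eY : e' * Y <= Y by rewrite ler_piMl.
have eXt : e' * X <= e' * t by rewrite ler_pM2l.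
have eYt : e' * Y <= e' * t by rewrite ler_pM2l.
have A3 : A <= 3 by lra.
have B2 : B <= 2 * e' by lra.
have D2 : D <= 2 * t by lra.
have AK : A * aK <= 3 * (e' * t) by rewrite ler_pM //; lra.
have BD : B * D <= 2 * e' * (2 * t) by rewrite ler_pM.
have t0 : 0 <= t by lra.
have et : e' * 10 * t <= e * t by rewrite ler_wpM2r.
lra.
Qed.

Lemma cderiv_cexp0 : cderiv cexp 0 1.
Proof.
move=> e e0; have [e' [e'0 e'1 e'e]] : exists e' : R, [/\ 0 < e', e' <= 1 & e' * 10 <= e].
  exists (Num.min 1 (e / 10)); split; first by rewrite lt_min ltr01 divr_gt0.
    by rewrite ge_min lexx.
  by rewrite -ler_pdivlMr // ge_min lexx orbT.
have [d1 d10 h1] := is_derive_approx (is_derive_expR 0) e'0.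
have [d2 d20 h2] := is_derive_approx (is_derive_cos 0) e'0.
have [d3 d30 h3] := is_derive_approx (is_derive_sin 0) e'0.
exists (Num.min e' (Num.min d1 (Num.min d2 d3))); first by rewrite !lt_min e'0 d10 d20.
case=> x y; rewrite !lt_min cexp0 subr0 mul1r; set z := Complex x y : C.
move=> /andP[he /andP[hd1 /andP[hd2 hd3]]].
have xz : `|x| <= cabs z := cabs_Re z.
have yz : `|y| <= cabs z := cabs_Im z.
have := h1 x (le_lt_trans xz hd1); have := h2 y (le_lt_trans yz hd2).
have := h3 y (le_lt_trans yz hd3).
rewrite !add0r expR0 cos0 sin0 oppr0 mul0r !mul1r subr0 addr0.
set E := expR x - 1 - x; set K := cos y - 1; set S := sin y - y => hS hK hE.
apply: (le_trans (cabs_ReIm _)).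
rewrite !ReB !ImB /= !subr0.
have -> : expR x * cos y - 1 - x = E + (1 + x + E) * K by rewrite /E /K; ring.
have -> : expR x * sin y - y = S + (x + E) * (y + S) by rewrite /E /S; ring.
have := ler_normD E ((1 + x + E) * K); have := ler_normD S ((x + E) * (y + S)).
rewrite !normrM.
have := ler_normD (1 + x) E; have := ler_normD 1 x; rewrite normr1.
have := ler_normD x E; have := ler_normD y S.
move=> i1 i2 i3 i4 i5 i6.
apply: (le_trans (lerD i6 i5)). apply: (@cexp_arith `|x| `|y| (cabs z) _ _ _ _ _ _ e') => //.
by rewrite (le_trans i4) // lerD2r.
Qed.

Lemma cderiv_cexp z : cderiv cexp z (cexp z).
Proof.
have h : cderiv (fun w => w - z) z 1.
  by apply: cderiv_eq (cderivD (cderiv_id z) (cderiv_cst (- z) z)); rewrite addr0.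
have h' : cderiv cexp (z - z) 1 by rewrite subrr; exact: cderiv_cexp0.
have := cderivM (cderiv_cst (cexp z) z) (cderiv_comp h h').
rewrite mul0r add0r !mulr1 => h2; apply: cderiv_ext ltr01 _ h2 => w _.
by rewrite -cexpD [z + _]addrC subrK.
Qed.

(** The defect for a pair x, y is e^y (e^(x-y) - 1 - (x-y)) + (e^y - 1) (x-y), so the expansion and
    the continuity at 0 control all pairs of points near 0. *)
Lemma near_id_cexp : exists2 r : R, 0 < r & near_id r (fun d => cexp d - 1).
Proof.
have e8 : (0 : R) < 8^-1 by lra.
have [d d0 hd] := cderiv_cexp0 e8.
have r8 : (0 : R) < 4^-1 by lra.
have [d' d'0 hd'] := cderiv_cont cderiv_cexp0 r8.
pose m := Num.min d d'.
have m0 : 0 < m by rewrite lt_min d0.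
have md : m <= d by rewrite ge_min lexx.
have md' : m <= d' by rewrite ge_min lexx orbT.
exists (m / 3); first lra.
move=> x y hx hy.
rewrite (_ : _ - _ = cexp y * (cexp (x - y) - 1 - (x - y)) + (cexp y - 1) * (x - y)); last first.
  by rewrite cexpB; field; exact: cexp_neq0.
apply: (le_trans (cabsD _ _)); rewrite !cabsM.
have xy : cabs (x - y) < d by have := cabsB x y; lra.
have := hd (x - y); rewrite subr0 mul1r cexp0 => /(_ xy) h1.
have := hd' y; rewrite subr0 cexp0 => h2; have {}h2 : cabs (cexp y - 1) < 4^-1 by apply: h2; lra.
have h3 : cabs (cexp y) <= 2 by have := cabsD (cexp y - 1) 1; rewrite subrK cabs1; lra.
have := cabs_ge0 (x - y); have := cabs_ge0 (cexp y); have := cabs_ge0 (cexp y - 1).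
have := cabs_ge0 (cexp (x - y) - 1 - (x - y)).
nra.
Qed.

Lemma clog_exists : exists (r : R) (clog : C -> C), [/\ 0 < r,
  near_id r (fun d => cexp d - 1) &
  forall w, cabs (w - 1) <= r / 2 -> cabs (clog w) <= 2 * cabs (w - 1) /\ cexp (clog w) = w].
Proof.
have [r r0 hr] := near_id_cexp.
pose P w d := cabs d <= 2 * cabs (w - 1) /\ cexp d = w.
exists r, (fun w => xget 0 [set d | P w d]); split => // w hw.
have [|x xw e] := near_id_surj r0 _ hr hw; first by rewrite cexp0 subrr.
apply: (@xgetPex _ 0 [set d | P w d]); exists x; split => //.
by apply: (addIr (- 1)).
Qed.

(** The logarithm is only a local inverse of [cexp] near 1, with an anonymous radius on which [cexp]
    is injective. No branch of the argument is cut: global logarithms are continued along paths by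
    adding logarithms of ratios close to 1. *)
Definition clog_radius : R := projT1 (cid clog_exists).
Definition clog : C -> C := projT1 (cid (projT2 (cid clog_exists))).

Lemma clog_spec : [/\ 0 < clog_radius,
  near_id clog_radius (fun d => cexp d - 1) &
  forall w, cabs (w - 1) <= clog_radius / 2 -> cabs (clog w) <= 2 * cabs (w - 1) /\ cexp (clog w) = w].
Proof. exact: projT2 (cid (projT2 (cid clog_exists))). Qed.

Lemma clog_radius_gt0 : 0 < clog_radius. Proof. by case: clog_spec. Qed.

Lemma clog_le w : cabs (w - 1) <= clog_radius / 2 -> cabs (clog w) <= 2 * cabs (w - 1).
Proof. by case: clog_spec => _ _ h /h[]. Qed.

Lemma cexpK w : cabs (w - 1) <= clog_radius / 2 -> cexp (clog w) = w.
Proof. by case: clog_spec => _ _ h /h[]. Qed.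

Lemma cexp_inj z w : cabs z <= clog_radius -> cabs w <= clog_radius -> cexp z = cexp w -> z = w.
Proof. by case: clog_spec => _ h _ hz hw e; apply: (near_id_inj h) => //; rewrite e. Qed.

Lemma cexp_eq1 z : cabs z <= clog_radius -> cexp z = 1 -> z = 0.
Proof.
move=> hz e; apply: cexp_inj => //; last by rewrite cexp0.
by rewrite cabs0 ltW // clog_radius_gt0.
Qed.

Lemma clog1 : clog 1 = 0.
Proof.
apply: cabs_le0; have := @clog_le 1; rewrite subrr cabs0 mulr0; apply.
by have := clog_radius_gt0; lra.
Qed.

Lemma clog_lip w w' : cabs (w - 1) <= clog_radius / 2 -> cabs (w' - 1) <= clog_radius / 2 ->
  cabs (clog w - clog w') <= 2 * cabs (w - w').
Proof.
move=> hw hw'; case: clog_spec => r0 h _.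
have := near_id_expand h (le_trans (clog_le hw) _) (le_trans (clog_le hw') _).
rewrite !cexpK // (_ : w - 1 - (w' - 1) = w - w'); last by ring.
by apply; lra.
Qed.

Lemma clogK z : cabs z <= clog_radius -> cabs (cexp z - 1) <= clog_radius / 2 -> clog (cexp z) = z.
Proof.
move=> hz h; apply: cexp_inj => //; last by rewrite cexpK.
by apply: (le_trans (clog_le h)); lra.
Qed.

Lemma cderiv_clog1 : cderiv clog 1 1.
Proof.
move=> e e0; have e20 : 0 < e / 2 by lra.
have [d d0 hd] := cderiv_cexp0 e20.
have r0 := clog_radius_gt0.
exists (Num.min (d / 2) (clog_radius / 2)); first by rewrite lt_min; lra.
move=> w; rewrite lt_min => /andP[h1 h2].
have c1 := clog_le (ltW h2).
have := hd (clog w); rewrite subr0 cexpK ?(ltW h2) // cexp0 clog1 mul1r => h3.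
rewrite subr0 mul1r cabsBC; apply: (le_trans (h3 _)); nra.
Qed.

(** Near [z], continuity forces L w = L z + clog (h w / h z), and the right side is differentiable
    by the chain rule. *)
Lemma cderiv_log (L h : C -> C) z D (r : R) : 0 < r -> ccont L z -> cderiv h z D ->
  (forall w, cabs (w - z) < r -> cexp (L w) = h w) -> cderiv L z (D / h z).
Proof.
move=> r0 Lc hD E.
have hz : h z = cexp (L z) by rewrite E // subrr cabs0.
have hz0 : h z != 0 by rewrite hz cexp_neq0.
have q0 := clog_radius_gt0.
have h1 : cderiv (fun w => h w / h z) z (D / h z).
  by apply: cderiv_eq (cderivM hD (cderiv_cst (h z)^-1 z)); rewrite mulr0 addr0.
have [d d0 hd] := Lc _ q0.
have q20 : 0 < clog_radius / 2 by lra.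
have [d' d'0 hd'] := cderiv_cont h1 q20.
have h2 : cderiv clog (h z / h z) 1 by rewrite divff //; exact: cderiv_clog1.
have h3 := cderivD (cderiv_comp h1 h2) (cderiv_cst (L z) z).
have m0 : 0 < Num.min r (Num.min d d') by rewrite !lt_min r0 d0.
rewrite mul1r addr0 in h3; apply: (cderiv_ext m0) h3 => w.
rewrite !lt_min => /andP[wr /andP[wd wd']].
have e : h w / h z = cexp (L w - L z) by rewrite cexpB E // hz.
rewrite e clogK ?subrK //; first exact/ltW/hd.
by rewrite -e; have := hd' _ wd'; rewrite divff // => /ltW.
Qed.

End ComplexExponential.
Arguments clog_radius R : clear implicits.

(** * Series of maps with geometrically decreasing Lipschitz constants *)

Section Series.
Context {R : realType}.
Local Notation C := (Cplx R).

Definition clim (s : nat -> C) (l : C) := forall e : R, 0 < e -> exists N, forall n, (N <= n)%N -> cabs (s n - l) < e.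

Lemma clim_unique s l l' : clim s l -> clim s l' -> l = l'.
Proof.
move=> h h'; apply/eqP; rewrite -subr_eq0; apply/eqP/cabs_le0.
apply/ler_addgt0Pr => e e0; rewrite add0r.
have e20 : 0 < e / 2 by lra.
have [N hN] := h _ e20; have [N' hN'] := h' _ e20.
have := hN (maxn N N') (leq_maxl _ _); have := hN' (maxn N N') (leq_maxr _ _).
by have := cabsB3 (s (maxn N N')) l l'; rewrite (cabsBC l (s _)); lra.
Qed.

Lemma geo_clim (q K : R) s l : 0 <= q < 1 -> (forall n, cabs (s n - l) <= K * q ^+ n) -> clim s l.
Proof.
move=> q01 h e e0.
have K0 : 0 <= K by have := h 0%N; rewrite expr0 mulr1; apply/le_trans/cabs_ge0.
have K1 : 0 < K + 1 by lra.
have [n hn] := geo_small q01 (divr_gt0 e0 K1).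
exists n => k nk; apply: (le_lt_trans (h k)).
have : q ^+ k <= q ^+ n by case/andP: q01 => ? ?; apply: ler_wiXn2l => //; lra.
have : 0 <= q ^+ k by case/andP: q01 => ? ?; apply: exprn_ge0.
by move: hn; rewrite ltr_pdivlMr // mulrC; nra.
Qed.

Lemma clim_shift s l : clim (fun n => s n.+1) l -> clim s l.
Proof. by move=> h e /h[N hN]; exists N.+1 => -[//|n] /hN. Qed.

Lemma climD s l s' l' : clim s l -> clim s' l' -> clim (fun n => s n + s' n) (l + l').
Proof.
move=> h h' e e0; have e20 : 0 < e / 2 by lra.
have [N hN] := h _ e20; have [N' hN'] := h' _ e20.
exists (maxn N N') => n; rewrite geq_max => /andP[/hN{}hN /hN'{}hN'].
rewrite (_ : _ - _ = (s n - l) + (s' n - l')); last by ring.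
by apply: (le_lt_trans (cabsD _ _)); lra.
Qed.

Lemma climM s l c : clim s l -> clim (fun n => c * s n) (c * l).
Proof.
move=> h e e0; have c0 := cabs_ge0 c.
have c1 : 0 < cabs c + 1 by lra.
have [N hN] := h _ (divr_gt0 e0 c1); exists N => n /hN.
rewrite -mulrBr cabsM ltr_pdivlMr //; have := cabs_ge0 (s n - l); nra.
Qed.

Section LipschitzSeries.
Variables (r L q : R) (h : nat -> C -> C).
Hypotheses (q01 : 0 <= q < 1) (r0 : 0 < r) (L0 : 0 <= L).
Hypothesis hlip : forall k u v, cabs u <= r -> cabs v <= r ->
  cabs (h k u - h k v) <= L * q ^+ k * cabs (u - v).
Let S n u := \sum_(k < n) h k u.
Let q1 : 0 < 1 - q. Proof. by case/andP: q01; lra. Qed.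

Lemma lip_series_cvg (u : C) : cabs u <= r -> (forall k, h k 0 = 0) -> exists l, clim (S ^~ u) l.
Proof.
move=> ur h0; have [|l hl] := @geo_lim _ q (L * r) (S ^~ u) q01.
  move=> n; rewrite /S big_ord_recr /= addrAC subrr add0r.
  have := @hlip n u 0 ur; rewrite h0 cabs0 !subr0 => /(_ (ltW r0))/le_trans; apply.
  by rewrite [leRHS]mulrAC ler_wpM2l // mulr_ge0 // exprn_ge0 //; case/andP: q01.
exists l; apply: (@geo_clim q (2 * (L * r / (1 - q)))) => // n.
by apply: (le_trans (hl n)); rewrite le_eqVlt; apply/orP; left; apply/eqP; ring.
Qed.

(** The remainder after [n] terms is itself Lipschitz with a constant of order q^n. Bounding its
    differences, and not just its size, is what makes termwise differentiation possible. *)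
Lemma lip_series_tail T (u v : C) n : cabs u <= r -> cabs v <= r -> clim (S ^~ u) (T u) -> clim (S ^~ v) (T v) ->
  cabs ((T u - T v) - (S n u - S n v)) <= L / (1 - q) * q ^+ n * cabs (u - v).
Proof.
move=> ur vr hu hv; apply/ler_addgt0Pr => e e0.
have e20 : 0 < e / 2 by lra.
have [N hN] := hu _ e20; have [N' hN'] := hv _ e20.
pose k := maxn N N'.
have := hN (n + k)%N (leq_trans (leq_maxl _ _) (leq_addl _ _)).
have := hN' (n + k)%N (leq_trans (leq_maxr _ _) (leq_addl _ _)).
have qq i : 0 <= q ^+ i by rewrite exprn_ge0 //; case/andP: q01.
have t0 := cabs_ge0 (u - v).
have key : cabs ((S (n + k)%N u - S (n + k)%N v) - (S n u - S n v)) <=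
    L / (1 - q) * (q ^+ n - q ^+ (n + k)) * cabs (u - v).
  elim: k => [|k IH]; first by rewrite addn0 !subrr cabs0 mulr0 mul0r.
  rewrite addnS; set A := S (n + k)%N u - S (n + k)%N v in IH *.
  have -> : S (n + k).+1 u - S (n + k).+1 v = A + (h (n + k) u - h (n + k) v).
    by rewrite /A /S !big_ord_recr /=; ring.
  rewrite addrAC; apply: (le_trans (cabsD _ _)).
  have := hlip (n + k) ur vr.
  have -> : L / (1 - q) * (q ^+ n - q ^+ (n + k).+1) * cabs (u - v) =
     L / (1 - q) * (q ^+ n - q ^+ (n + k)) * cabs (u - v) + L * q ^+ (n + k) * cabs (u - v).
    by rewrite exprS; field; rewrite lt0r_neq0.
  lra.
have : L / (1 - q) * (q ^+ n - q ^+ (n + k)) * cabs (u - v) <= L / (1 - q) * q ^+ n * cabs (u - v).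
  by rewrite ler_wpM2r // ler_wpM2l ?divr_ge0 // ?(ltW q1) // lerBlDr lerDl.
have := cabsD (T u - T v - (S (n + k)%N u - S (n + k)%N v)) (S (n + k)%N u - S (n + k)%N v - (S n u - S n v)).
rewrite addrA subrK.
have := cabsB (S (n + k)%N v - T v) (S (n + k)%N u - T u).
rewrite (_ : S _ v - T v - _ = T u - T v - (S (n + k)%N u - S (n + k)%N v)); last by ring.
lra.
Qed.

Lemma lip_series_lip T (u v : C) : cabs u <= r -> cabs v <= r -> clim (S ^~ u) (T u) -> clim (S ^~ v) (T v) ->
  cabs (T u - T v) <= L / (1 - q) * cabs (u - v).
Proof.
move=> ur vr hu hv; have := lip_series_tail 0 ur vr hu hv.
by rewrite /S !big_ord0 expr0 mulr1 !subr0.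
Qed.

(** The derivatives of the terms are bounded by the Lipschitz constants, so their sum converges. An
    increment of the sum is then compared with that of a partial sum, the remainder costing a small
    multiple of |w - u|. *)
Lemma lip_series_deriv T (u : C) : cabs u < r -> (forall v, cabs v <= r -> clim (S ^~ v) (T v)) ->
  (forall k, exists D, cderiv (h k) u D) -> exists D, cderiv T u D.
Proof.
move=> ur hT hD.
have {hD} [d hd] : exists d : nat -> C, forall k, cderiv (h k) u (d k).
  by exists (fun k => projT1 (cid (hD k))) => k; case: cid.
have qq i : 0 <= q ^+ i by rewrite exprn_ge0 //; case/andP: q01.
pose D n := \sum_(k < n) d k.
have SD n : cderiv (S n) u (D n).
  rewrite /S /D; elim: n => [|n IH].
    rewrite big_ord0; apply: (@cderiv_ext _ (fun _ => 0) _ _ _ 1) => //; last exact: cderiv_cst.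
    by move=> w _; rewrite big_ord0.
  rewrite big_ord_recr; apply: cderiv_ext ltr01 _ (cderivD IH (hd n)) => w _.
  by rewrite big_ord_recr.
have ru : 0 < r - cabs u by lra.
have inr w : cabs (w - u) < r - cabs u -> cabs w <= r by have := cabs_le_sub w u; lra.
have [l hl] : exists l, forall n, cabs (D n - l) <= 2 * (L * q ^+ n / (1 - q)).
  apply: geo_lim => // n; rewrite /D big_ord_recr /= addrAC subrr add0r.
  by apply: (cderiv_bound ru (hd n)) => w /inr wr; apply: hlip => //; exact: ltW.
exists l => e e0.
have K0 : 0 < 3 * L / (1 - q) + 1 by rewrite ltr_wpDl // divr_ge0 ?mulr_ge0 // ltW.
have [n hn] := geo_small q01 (divr_gt0 e0 (mulr_gt0 (ltr0n R 2) K0)).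
have e20 : 0 < e / 2 by lra.
have [dl dl0 hdl] := SD n _ e20.
exists (Num.min dl (r - cabs u)); first by rewrite lt_min dl0.
move=> w; rewrite lt_min => /andP[/hdl h1 /inr wr].
have h2 := lip_series_tail n wr (ltW ur) (hT _ wr) (hT _ (ltW ur)).
have h3 := hl n.
rewrite (_ : _ - _ - _ = (T w - T u - (S n w - S n u)) + (S n w - S n u - D n * (w - u)) + (D n - l) * (w - u)); last by ring.
apply: (le_trans (cabsD _ _)); apply: (@le_trans _ _ (L / (1 - q) * q ^+ n * cabs (w - u) + e / 2 * cabs (w - u) + 2 * (L * q ^+ n / (1 - q)) * cabs (w - u))).
  rewrite cabsM lerD ?ler_wpM2r ?cabs_ge0 //.
  by apply: (le_trans (cabsD _ _)); lra.
rewrite -!mulrDl ler_wpM2r ?cabs_ge0 //.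
move: hn; rewrite ltr_pdivlMr ?mulr_gt0 // => hn.
have -> : L / (1 - q) * q ^+ n + e / 2 + 2 * (L * q ^+ n / (1 - q)) = e / 2 + 3 * L / (1 - q) * q ^+ n by ring.
have := qq n; lra.
Qed.

End LipschitzSeries.
End Series.

(** * Subdivision of rays and lifting of logarithms *)

Section ChainCover.
Context {R : realType}.
Local Notation C := (Cplx R).

Lemma within_cabs (T : topologicalType) (F : set_system T) {FF : Filter F} (f : T -> C) (l : C) :
  (f @ F --> l) <-> (forall e : R, 0 < e -> \forall x \near F, cabs (f x - l) < e).
Proof.
split=> h.
  move=> e e0; have /cvgrPdist_lt/(_ (real_complex R e)) := h.
  rewrite ltcR => /(_ e0); apply: filterS => x.
  by rewrite normC_cabs ltcR cabsBC.
apply/cvgrPdist_lt => e e0.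
have [r r0 ->] : exists2 r : R, 0 < r & e = real_complex R r.
  by case: e e0 => a b; rewrite ltcE /= => /andP[/eqP -> ?]; exists a.
by apply: filterS (h _ r0) => x; rewrite normC_cabs ltcR cabsBC.
Qed.

Lemma within_eps (V : normedModType R) (A : set V) (f : V -> C) : {within A, continuous f} ->
  forall x, A x -> forall e : R, 0 < e -> exists2 r : R, 0 < r &
    forall y, A y -> `|y - x| < r -> cabs (f y - f x) < e.
Proof.
move=> /subspace_continuousP h x Ax e e0.
have := (@within_cabs V (within A (nbhs x)) (within_filter _ (nbhs_filter x)) f (f x)).1 (h x Ax) _ e0.
rewrite near_withinE => /nbhs_normP[r /= r0 hr]; exists r => // y Ay yx.
by apply: hr => //; rewrite /ball_ /= distrC.
Qed.

(* A Lebesgue number argument: a relation that holds locally on a compact set,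
   star-shaped about 0, holds between consecutive points of a fine enough
   subdivision of every ray. *)
Lemma chain_cover (V : normedModType R) (A : set V) (Q : V -> V -> Prop) :
  compact A -> (forall (t : R) x, 0 <= t <= 1 -> A x -> A (t *: x)) ->
  (forall x, A x -> exists2 r : R, 0 < r &
     forall y z, A y -> A z -> `|y - x| < r -> `|z - x| < r -> Q y z) ->
  exists2 N, (0 < N)%N & forall x, A x -> forall j, (j < N)%N ->
    Q ((j%:R / N%:R) *: x) ((j.+1%:R / N%:R) *: x).
Proof.
move=> cA sA hQ.
have : \forall d \near (0 : R)^'+, A `<=` (fun x => forall y, A y -> `|y - x| < d -> Q x y).
  have /near_covering_withinP cA' := (compact_near_coveringP A).1 cA.
  apply: (cA' R (0^'+) (fun d x => forall y, A y -> `|y - x| < d -> Q x y)) => x Ax.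
  have [r r0 hr] := hQ _ Ax; have r20 : 0 < r / 2 by lra.
  exists (ball x (r / 2), [set d | d < r / 2]).
    by split => /=; [exact: nbhsx_ballx|exact: nbhs_right_lt].
  move=> [x' d] /= [bx dr] Ax' y Ay yx'; apply: hr => //.
    by move: bx; rewrite -ball_normE /ball_ /= distrC; lra.
  by move: bx; rewrite -ball_normE /ball_ /= distrC; have := ler_distD x' y x; lra.
move=> hd.
have [d [d0 {}hd]] : exists d : R, 0 < d /\ A `<=` (fun x => forall y, A y -> `|y - x| < d -> Q x y).
  have := filterI hd (nbhs_right_gt (0 : R)).
  by move=> /(_ _)/filter_ex[d [h1 h2]]; exists d.
have [M [_ hM]] := compact_bounded cA.
have {}hM x : A x -> `|x| <= `|M| + 1.
  by move=> Ax; apply: (hM (`|M| + 1)) => //; have := ler_norm M; lra.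
have M0 : 0 < `|M| + 1 by have := normr_ge0 M; lra.
pose N := (Num.truncn ((`|M| + 1) / d)).+1.
have hN : (`|M| + 1) / d < N%:R.
  by apply: truncnS_gt.
have N0 : 0 < (N%:R : R) by rewrite ltr0n.
exists N => // x Ax j jN.
have s01 i : (i <= N)%N -> 0 <= (i%:R / N%:R : R) <= 1.
  by move=> iN; rewrite divr_ge0 //= ler_pdivrMr // mul1r ler_nat.
apply: hd; [by apply: sA => //; apply: s01; exact: ltnW|by apply: sA => //; exact: s01|].
rewrite -scalerBl normrZ -mulrBl -natrB // subSnn mul1r ger0_norm ?invr_ge0 ?(ltW N0) //.
rewrite mulrC ltr_pdivrMr //; move: hN; rewrite ltr_pdivrMr // => hN.
by rewrite mulrC; apply: (le_lt_trans (hM _ Ax)).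
Qed.

(** Values of [d] at close points differ by a small number whose exponential is 1, hence agree, and
    the subdivision spreads this along each ray. This is the uniqueness of continuous logarithms. *)
Lemma cexp_const (V : normedModType R) (A : set V) (d : V -> C) :
  compact A -> (forall (t : R) x, 0 <= t <= 1 -> A x -> A (t *: x)) ->
  {within A, continuous d} -> (forall x y, A x -> A y -> cexp (d x) = cexp (d y)) ->
  forall x, A x -> d x = d 0.
Proof.
move=> cA sA dc de.
have r0 := @clog_radius_gt0 R; have r20 : 0 < clog_radius R / 2 by lra.
have [|N N0 hN] := @chain_cover V A (fun x y => d x = d y) cA sA.
  move=> x Ax; have [r rr hr] := within_eps dc Ax r20; exists r => // y z Ay Az yx zx.
  apply/eqP; rewrite -subr_eq0; apply/eqP/cexp_eq1.
    have := hr _ Ay yx; have := hr _ Az zx; rewrite [cabs (d z - _)]cabsBC.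
    by have := cabsB3 (d x) (d y) (d z); lra.
  by rewrite cexpB (de _ _ Ay Az) divff // cexp_neq0.
move=> x Ax.
have h j : (j <= N)%N -> d ((j%:R / N%:R) *: x) = d 0.
  elim: j => [|j IH] jN; first by rewrite mul0r scale0r.
  by rewrite -hN // IH // ltnW.
by rewrite -(h N) // divff ?scale1r // pnatr_eq0 -lt0n.
Qed.

Lemma within_comp_scale (V : normedModType R) (A : set V) (f : V -> C) (t : R) : {within A, continuous f} ->
  (forall x, A x -> A (t *: x)) -> {within A, continuous (fun x => f (t *: x))}.
Proof.
move=> /subspace_continuousP h sA; apply/subspace_continuousP => x Ax.
apply: cvg_trans (h _ (sA _ Ax)) => U /= hU.
have hc : (fun x : V => t *: x) @ x --> t *: x by exact: (@scaler_continuous _ _ t x).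
rewrite /within /=; have := hc _ hU; rewrite !nbhs_simpl /=.
by apply: filterS => y hy Ay; apply: hy; exact: sA.
Qed.

(** Along the ray to [x], k x / k 0 is a telescoping product of ratios close to 1, and [clog]
    applies to each. The number of ratios is the same for all [x], so continuity is that of a finite
    sum. Star-shaped compact sets cover paths and homotopies at once. *)
Lemma log_lift (V : normedModType R) (A : set V) (k : V -> C) (l0 : C) :
  compact A -> A 0 -> (forall (t : R) x, 0 <= t <= 1 -> A x -> A (t *: x)) ->
  {within A, continuous k} -> (forall x, A x -> k x != 0) -> cexp l0 = k 0 ->
  exists L : V -> C, [/\ L 0 = l0, {within A, continuous L} & forall x, A x -> cexp (L x) = k x].
Proof.
move=> cA A0 sA kc k0 hl0.
have r0 := @clog_radius_gt0 R; pose c := Num.min 4^-1 (clog_radius R / 32).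
have c0 : 0 < c by rewrite lt_min; lra.
have c4 : c <= 4^-1 by rewrite ge_min lexx.
have cr : c <= clog_radius R / 32 by rewrite ge_min lexx orbT.
pose Q x y := cabs (k y / k x - 1) < clog_radius R / 2.
have [|N N0 hN] := @chain_cover V A Q cA sA.
  move=> x Ax; have kx := k0 _ Ax; rewrite -cabs_gt0 in kx.
  have [r rr hr] := within_eps kc Ax (mulr_gt0 c0 kx); exists r => // y z Ay Az yx zx.
  have h1 := hr _ Ay yx; have h2 := hr _ Az zx.
  have ky0 := k0 _ Ay; have ky := ky0; rewrite -cabs_gt0 in ky.
  rewrite /Q (_ : _ - 1 = (k z - k y) / k y); last by field.
  rewrite cabsM cabsV ltr_pdivrMr //.
  have h3 := cabsB3 (k x) (k z) (k y); rewrite [cabs (k x - _)]cabsBC in h3.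
  have h4 := cabs_le_sub (k x) (k y); rewrite [cabs (k x - _)]cabsBC in h4.
  have : clog_radius R / 32 * cabs (k x) <= clog_radius R / 2 * (cabs (k x) / 16) by lra.
  have : c * cabs (k x) <= clog_radius R / 32 * cabs (k x) by rewrite ler_wpM2r ?cabs_ge0.
  have : cabs (k x) / 2 <= cabs (k y) by nra.
  move=> h5 h6 h7; have : clog_radius R / 2 * (cabs (k x) / 2) <= clog_radius R / 2 * cabs (k y) by rewrite ler_wpM2l //; lra.
  have : 0 < clog_radius R * cabs (k x) by rewrite mulr_gt0.
  lra.
pose s j : R := j%:R / N%:R.
have NR : 0 < (N%:R : R) by rewrite ltr0n.
have s01 i : (i <= N)%N -> 0 <= s i <= 1.
  by move=> iN; rewrite divr_ge0 //= ler_pdivrMr // mul1r ler_nat.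
have sAj i x : (i <= N)%N -> A x -> A (s i *: x) by move=> /s01 h; exact: sA.
pose L x := l0 + \sum_(j < N) clog (k (s j.+1 *: x) / k (s j *: x)).
exists L; split.
- by rewrite /L big1 ?addr0 // => j _; rewrite !scaler0 divff ?clog1 // k0.
- apply/subspace_continuousP => x Ax; apply: cvgD; first exact: cvg_cst.
  apply: cvg_big => [|j _]; first exact: add_continuous.
  have ratc : (fun x => k (s j.+1 *: x) / k (s j *: x)) @ within A (nbhs x) --> k (s j.+1 *: x) / k (s j *: x).
    have kcs i : (i <= N)%N -> (fun y => k (s i *: y)) @ within A (nbhs x) --> k (s i *: x).
      move=> iN; have h := within_comp_scale kc (fun y (Ay : A y) => sAj i y iN Ay).
      by move/subspace_continuousP: h; apply.
    have sk0 : k (s j *: x) != 0 by apply: k0; apply: sAj => //; exact: ltnW.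
    exact: (cvgM (kcs _ (ltn_ord j)) (cvgV sk0 (kcs _ (ltnW (ltn_ord j))))).
  apply/within_cabs => e e0.
  have hq : cabs (k (s j.+1 *: x) / k (s j *: x) - 1) < clog_radius R / 2 by exact: hN.
  pose e' := Num.min (e / 2) (clog_radius R / 2 - cabs (k (s j.+1 *: x) / k (s j *: x) - 1)).
  have e'0 : 0 < e' by rewrite lt_min; lra.
  have e'e : e' <= e / 2 by rewrite ge_min lexx.
  have e'r : e' <= clog_radius R / 2 - cabs (k (s j.+1 *: x) / k (s j *: x) - 1) by rewrite ge_min lexx orbT.
  have := (@within_cabs V (within A (nbhs x)) (within_filter _ (nbhs_filter x)) _ _).1 ratc _ e'0; apply: filterS => y hy.
  apply: (le_lt_trans (clog_lip _ _)); [|exact: ltW|lra].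
  set a := k _ / _ in hy *; set b := k _ / _ in hy hq e'r *.
  by have := cabsB3 b a 1; lra.
- move=> x Ax; rewrite /L cexpD hl0.
  have h n : (n <= N)%N -> cexp (\sum_(j < n) clog (k (s j.+1 *: x) / k (s j *: x))) = k (s n *: x) / k 0.
    elim: n => [|n IH] nN; first by rewrite big_ord0 cexp0 /s mul0r scale0r divff // k0.
    rewrite big_ord_recr /= cexpD IH ?(ltnW nN) // cexpK; last by apply: ltW; exact: hN.
    by field; rewrite (k0 _ A0) k0 //; apply: sAj => //; exact: ltnW.
  rewrite h // mulrC mulfVK ?k0 //.
  by rewrite /s divff ?scale1r // pnatr_eq0 -lt0n.
Qed.

End ChainCover.

(** * Logarithms on simply connected spaces *)

Section LogarithmOnSimplyConnected.
Context {R : realType}.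
Local Notation C := (Cplx R).

Lemma I01P (t : R) : I01 R t <-> 0 <= t <= 1.
Proof. by rewrite /I01 /= in_itv /=. Qed.

Lemma I01_0 : I01 R 0. Proof. by apply/I01P; rewrite lexx ler01. Qed.
Lemma I01_1 : I01 R 1. Proof. by apply/I01P; rewrite lexx ler01. Qed.

Lemma within_comp (S T U : topologicalType) (B : set S) (A : set T) (g : S -> T) (f : T -> U) :
  {within B, continuous g} -> (forall x, B x -> A (g x)) -> {within A, continuous f} ->
  {within B, continuous (fun x => f (g x))}.
Proof.
move=> /subspace_continuousP hg gA /subspace_continuousP hf; apply/subspace_continuousP => x Bx.
apply: cvg_trans (hf _ (gA _ Bx)) => P /= hP.
have := hg _ Bx _ hP; rewrite !nbhs_simpl /= /within /=.
by apply: filterS => y hy By; apply: hy => //; exact: gA.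
Qed.

Lemma continuous_within (S T : topologicalType) (A : set S) (f : S -> T) :
  (forall w, A w -> {for w, continuous f}) -> {within A, continuous f}.
Proof.
by move=> h; apply/subspace_continuousP => x Ax; apply: cvg_within_filter; exact: h.
Qed.

Lemma compact_I01 : compact (I01 R).
Proof. exact: segment_compact. Qed.

Lemma I01_star (t x : R) : 0 <= t <= 1 -> I01 R x -> I01 R (t *: x).
Proof.
move=> /andP[t0 t1] /I01P/andP[x0 x1]; apply/I01P; rewrite -[_ *: _]/(t * x).
by rewrite mulr_ge0 //= mulr_ile1.
Qed.

Lemma cexp_const01 (d : R -> C) : {within I01 R, continuous d} ->
  (forall x y, I01 R x -> I01 R y -> cexp (d x) = cexp (d y)) -> d 1 = d 0.
Proof. by move=> h1 h2; exact: (cexp_const compact_I01 I01_star h1 h2 I01_1). Qed.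

Lemma compact_square : compact (I01 R `*` I01 R).
Proof. by apply: compact_setX; exact: compact_I01. Qed.

Lemma square_star (t : R) (x : R * R) : 0 <= t <= 1 -> (I01 R `*` I01 R) x -> (I01 R `*` I01 R) (t *: x).
Proof. by move=> t01 [h1 h2]; split; exact: I01_star. Qed.

Definition concat (T : Type) (f g : R -> T) (s : R) : T := if s <= 1/2 then f (2 * s) else g (2 * s - 1).

Lemma concat_continuous (T : topologicalType) (f g : R -> T) : {within I01 R, continuous f} -> {within I01 R, continuous g} ->
  f 1 = g 0 -> {within I01 R, continuous (concat f g)}.
Proof.
move=> hf hg e.
have -> : I01 R = `[(0 : R), 1/2]%classic `|` `[(1/2 : R), 1]%classic.
  apply/seteqP; split=> [x /I01P|x] /=; rewrite ?in_itv /=.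
    by move=> /andP[h0 h1]; case: (leP x (1/2)) => h; [left|right]; lra.
  by case=> ?; apply/I01P; lra.
have c2 : continuous (fun s : R => 2 * s) by move=> s; apply: cvgM; [exact: cvg_cst|exact: cvg_id].
have c21 : continuous (fun s : R => 2 * s - 1).
  by move=> s; apply: cvgB; [exact: c2|exact: cvg_cst].
apply: withinU_continuous; try exact: itv_closed.
- have h : {within `[(0 : R), 1/2]%classic, continuous (fun s => f (2 * s))}.
    apply: (within_comp _ _ hf); first by apply: continuous_within => w _; exact: c2.
    by move=> x /=; rewrite in_itv /= => ?; apply/I01P; lra.
  apply: subspace_eq_continuous h => x; rewrite inE /= in_itv /= => /andP[_ h].
  by rewrite /from_subspace /concat h.
- have h : {within `[(1/2 : R), 1]%classic, continuous (fun s => g (2 * s - 1))}.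
    apply: (within_comp _ _ hg); first by apply: continuous_within => w _; exact: c21.
    by move=> x /=; rewrite in_itv /= => ?; apply/I01P; lra.
  apply: subspace_eq_continuous h => x; rewrite inE /= in_itv /= => /andP[h _].
  rewrite /from_subspace /concat; case: ifP => // h'.
  have -> : x = 1/2 by lra.
  by rewrite (_ : 2 * (1/2) = 1 :> R) ?subrr ?e //; lra.
Qed.

Lemma concat0 (T : Type) (f g : R -> T) : concat f g 0 = f 0.
Proof. by rewrite /concat divr_ge0 // mulr0. Qed.

Lemma concat1 (T : Type) (f g : R -> T) : concat f g 1 = g 1.
Proof.
rewrite /concat; have -> : ((1 : R) <= 1/2) = false by apply/negbTE; rewrite -ltNge; lra.
by congr g; lra.
Qed.

Lemma concat_map (T U : Type) (k : T -> U) (f g : R -> T) s :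
  k (concat f g s) = concat (k \o f) (k \o g) s.
Proof. by rewrite /concat; case: ifP. Qed.

Lemma concat_eq (T : Type) (f g f' g' : R -> T) : (forall s, I01 R s -> f s = f' s) ->
  (forall s, I01 R s -> g s = g' s) -> forall s, I01 R s -> concat f g s = concat f' g' s.
Proof.
move=> hf hg s /I01P Is; rewrite /concat; case: ifP => h.
  by apply: hf; apply/I01P; lra.
by apply: hg; apply/I01P; lra.
Qed.

Lemma concat_path (T : topologicalType) (A : set T) (f g : R -> T) :
  path_in A f -> path_in A g -> f 1 = g 0 -> path_in A (concat f g).
Proof.
move=> [hf fA] [hg gA] e; split; first exact: concat_continuous.
move=> _ [s /I01P Is <-]; rewrite /concat; case: ifP => h.
  by apply: fA; exists (2 * s) => //; apply/I01P; lra.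
by apply: gA; exists (2 * s - 1) => //; apply/I01P; lra.
Qed.

Lemma rev_continuous (T : topologicalType) (f : R -> T) : {within I01 R, continuous f} ->
  {within I01 R, continuous (fun s => f (1 - s))}.
Proof.
move=> hf; apply: (within_comp _ _ hf).
  by apply: continuous_within => w _; apply: cvgB; [exact: cvg_cst|exact: cvg_id].
by move=> x /I01P ?; apply/I01P; lra.
Qed.

Lemma rev_path (T : topologicalType) (A : set T) (f : R -> T) : path_in A f -> path_in A (fun s => f (1 - s)).
Proof.
move=> [hf fA]; split; first exact: rev_continuous.
by move=> _ [s /I01P Is <-]; apply: fA; exists (1 - s) => //; apply/I01P; lra.
Qed.

Section Lift.
Variables (T : topologicalType) (A : set T) (k : T -> C).
Hypothesis sc : simply_connected R A.
Hypothesis kc : {within A, continuous k}.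
Hypothesis k0 : forall w, A w -> k w != 0.

Definition log_along (g : R -> T) (L : R -> C) :=
  {within I01 R, continuous L} /\ forall s, I01 R s -> cexp (L s) = k (g s).

Lemma path_inP g s : path_in A g -> I01 R s -> A (g s).
Proof. by move=> [_ h] Is; apply: h; exists s. Qed.

Lemma log_along_exists g l : path_in A g -> cexp l = k (g 0) -> exists2 L, log_along g L & L 0 = l.
Proof.
move=> gA hl.
have gc : {within I01 R, continuous (fun s => k (g s))}.
  by apply: (within_comp gA.1 _ kc) => s; exact: path_inP.
have [|L [L0 Lc Lk]] := log_lift compact_I01 I01_0 I01_star gc _ hl.
  by move=> s Is; apply: k0; exact: path_inP.
by exists L.
Qed.

(** A logarithm [M] over the square of the homotopy differs from [L] by a constant on the bottom
    side, is constant on the top side, where [H] is, and has equal increments on the vertical sides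
    because H (0, t) = H (1, t). *)
Lemma log_along_loop g L : path_in A g -> g 0 = g 1 -> log_along g L -> L 1 = L 0.
Proof.
move=> gA g01 [Lc Lk].
have [_ [_ /(_ g gA g01)[H [Hc [HA [H0 [H1 Hl]]]]]]] := sc.
have HA' x : (I01 R `*` I01 R) x -> A (H x) by move=> Ix; apply: HA; exists x.
have kHc : {within I01 R `*` I01 R, continuous (fun x => k (H x))} := within_comp Hc HA' kc.
have I00 : (I01 R `*` I01 R) 0 by split; exact: I01_0.
have hl0 : cexp (L 0) = k (H 0).
  by rewrite Lk ?H0 //; exact: I01_0.
have [|M [M0 Mc Mk]] := log_lift compact_square I00 square_star kHc _ hl0.
  by move=> x Ix; apply: k0; exact: HA'.
have slice1 (t : R) : I01 R t -> {within I01 R, continuous (fun s => M (s, t))}.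
  move=> It; apply: (within_comp _ _ Mc); last by move=> s Is; split.
  by apply: continuous_within => w _; exact: (cvg_pair (@cvg_id _ (nbhs w)) (cvg_cst t)).
have slice2 (s : R) : I01 R s -> {within I01 R, continuous (fun t => M (s, t))}.
  move=> Is; apply: (within_comp _ _ Mc); last by move=> t It; split.
  by apply: continuous_within => w _; exact: (cvg_pair (cvg_cst s) (@cvg_id _ (nbhs w))).
have withinB (f h : R -> C) : {within I01 R, continuous f} -> {within I01 R, continuous h} ->
    {within I01 R, continuous (fun s => f s - h s)}.
  move=> /subspace_continuousP hf /subspace_continuousP hh; apply/subspace_continuousP => x Ix.
  by apply: cvgB; [exact: hf|exact: hh].
have i0 := I01_0; have i1 := I01_1.
have e1 : L 1 - M (1, 0) = L 0 - M (0, 0).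
  have /cexp_const01 := withinB _ _ Lc (slice1 _ i0); apply=> x y Ix Iy.
  have Ax := k0 (path_inP gA Ix); have Ay := k0 (path_inP gA Iy).
  by rewrite !cexpB !Lk ?Mk ?H0 ?divff.
have e2 : M (1, 1) = M (0, 1).
  have /cexp_const01 := slice1 _ i1; apply=> x y Ix Iy.
  by rewrite !Mk ?H1.
have e3 : M (0, 1) - M (1, 1) = M (0, 0) - M (1, 0).
  have /cexp_const01 := withinB _ _ (slice2 _ i0) (slice2 _ i1); apply=> x y Ix Iy.
  have hx t : I01 R t -> k (H (0, t)) != 0 by move=> It; apply: k0; apply: HA'.
  by rewrite !cexpB !Mk -?Hl // !divff ?hx.
move: e3; rewrite e2 subrr => /esym/eqP; rewrite subr_eq0 => /eqP e3.
by move: e1; rewrite e3 => /addIr.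
Qed.

(** The value at [w] is the end value of a lift along a path chosen from [x0] to [w]. The last
    clause, agreement of [l] with the lifts along all paths in [A], stands in for continuity: it is
    what monodromy gives without local assumptions on [A]. *)
Lemma simply_connected_log x0 l0 : A x0 -> cexp l0 = k x0 -> exists l : T -> C,
  [/\ l x0 = l0, forall w, A w -> cexp (l w) = k w &
    forall g L, path_in A g -> log_along g L -> L 0 = l (g 0) -> L 1 = l (g 1)].
Proof.
move=> Ax0 hl0; have [_ [pc _]] := sc.
pose P w (gL : (R -> T) * (R -> C)) := [/\ path_in A gL.1, gL.1 0 = x0, gL.1 1 = w, log_along gL.1 gL.2 & gL.2 0 = l0].
have hP w : A w -> exists gL, P w gL.
  move=> Aw; have [g [gA [g0 g1]]] := pc _ _ Ax0 Aw.
  have [|L hL L0] := @log_along_exists g l0 gA; first by rewrite g0.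
  by exists (g, L).
have {hP} [G hG] : exists G : T -> (R -> T) * (R -> C), forall w, A w -> P w (G w).
  exists (fun w => xget (fun=> x0, fun=> 0) [set gL | P w gL]) => w /hP.
  exact: (@xgetPex _ _ [set gL | P w gL]).
pose l w := (G w).2 1.
have key g L : path_in A g -> log_along g L -> L 0 = l (g 0) -> L 1 = l (g 1).
  move=> gA [Lc Lk] L0.
  have i0 := I01_0; have i1 := I01_1.
  have [pa a0 a1 [ac ak] al] := hG _ (path_inP gA i0).
  have [pb b0 b1 [bc bk] bl] := hG _ (path_inP gA i1).
  set al' := (G (g 0)).1 in pa a0 a1 ak; set La := (G (g 0)).2 in ac ak al.
  set be := (G (g 1)).1 in pb b0 b1 bk; set Lb := (G (g 1)).2 in bc bk bl.
  (* The loop runs from [x0] to g 0, along [g], and back from g 1 to [x0]. Adding [c] to the lift on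
     the way back makes the pieces match, so the total monodromy is [c] and must vanish. *)
  pose c := L 1 - Lb 1.
  have c1 : cexp c = 1 by rewrite /c cexpB Lk // bk // b1 divff // k0 //; exact: path_inP.
  have Lbc : {within I01 R, continuous (fun s => Lb (1 - s) + c)}.
    have := rev_continuous bc => /subspace_continuousP h; apply/subspace_continuousP => x Ix.
    by apply: cvgD; [exact: h|exact: cvg_cst].
  have pag : path_in A (concat al' g) by apply: concat_path.
  have Lag : log_along (concat al' g) (concat La L).
    split; first exact: (concat_continuous ac Lc (esym L0)).
    move=> s Is; rewrite (concat_map cexp) (concat_map k); exact: concat_eq.
  have ploop : path_in A (concat (concat al' g) (fun s => be (1 - s))).
    by apply: concat_path => //; [exact: rev_path|rewrite concat1 subr0 b1].
  have := @log_along_loop _ (concat (concat La L) (fun s => Lb (1 - s) + c)) ploop.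
  rewrite !concat0 !concat1 subrr a0 b0 al bl => /(_ erefl) h.
  suff : l0 + c = l0 by move=> /eqP; rewrite -subr_eq0 addrAC subrr add0r subr_eq0 => /eqP.
  apply: h; split.
    by apply: (concat_continuous Lag.1 Lbc); rewrite concat1 subr0 /c addrC subrK.
  move=> s Is; rewrite (concat_map cexp) (concat_map k); apply: concat_eq => // s' Is' /=; first exact: Lag.2.
  by rewrite cexpD c1 mulr1 bk //; move/I01P: Is' => ?; apply/I01P; lra.
exists l; split => //; last first.
  by move=> w Aw; have [pa a0 a1 [ac ak] al] := hG _ Aw; rewrite /l ak ?a1 //; exact: I01_1.
have [pa a0 a1 [ac ak] al] := hG _ Ax0.
rewrite -al; apply: log_along_loop pa _ (conj ac ak); by rewrite a0 a1.
Qed.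

End Lift.
End LogarithmOnSimplyConnected.

(** * Preimages under a monic polynomial *)

Section NearestRoot.
Context {R : realType}.
Local Notation C := (Cplx R).

Lemma min_seq (s : seq C) (F : C -> R) : s != [::] -> exists2 x, x \in s & forall y, y \in s -> F x <= F y.
Proof.
elim: s => // x [|y s] IH _.
  by exists x; rewrite ?mem_seq1 // => z; rewrite mem_seq1 => /eqP ->.
have [//|z zs hz] := IH; have [h|h] := leP (F x) (F z).
  exists x; rewrite ?mem_head // => t; rewrite inE => /orP[/eqP -> //|/hz].
  exact: le_trans.
exists z; first by rewrite inE zs orbT.
by move=> t; rewrite inE => /orP[/eqP ->|/hz//]; exact: ltW.
Qed.

(** A product dominates the corresponding power of its smallest factor. Applied to the roots of f -
    V, this is a quantitative continuity of roots and does the work of the open mapping theorem. *)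
Lemma seq_near (s : seq C) (z : C) : s != [::] ->
  exists2 w, w \in s & cabs (z - w) ^+ size s <= cabs (\prod_(w <- s) (z - w)).
Proof.
move=> /(min_seq (fun w => cabs (z - w)))[w ws hw]; exists w => //.
elim: s hw {ws} => [|x s IH] h; first by rewrite big_nil cabs1.
rewrite big_cons cabsM exprS ler_pM ?exprn_ge0 ?cabs_ge0 //; first by apply: h; rewrite mem_head.
by apply: IH => y ys; apply: h; rewrite inE ys orbT.
Qed.

End NearestRoot.

Section Preimages.
Context {R : realType}.
Local Notation C := (Cplx R).
Implicit Types (f : {poly C}) (V z w c : C).

(** Roots are listed with multiplicity: counting by [size] is then exact, and absence of critical
    points over [V] becomes absence of repetitions. *)
Definition preims f V : seq C := sval (closed_field_poly_normal (f - V%:P)).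

Variables (f : {poly C}) (m : nat).
Hypotheses (fmonic : f \is monic) (fsize : size f = m.+1) (m0 : (0 < m)%N).

Lemma size_subC V : (size (- V%:P : {poly C}) < size f)%N.
Proof. by rewrite size_polyN fsize ltnS (leq_trans (size_polyC_leq1 V)). Qed.

Lemma preims_prod V : f - V%:P = \prod_(w <- preims f V) ('X - w%:P).
Proof.
rewrite /preims; case: closed_field_poly_normal => /= r.
by rewrite lead_coefDl ?size_subC // (monicP fmonic) scale1r.
Qed.

Lemma size_preims V : size (preims f V) = m.
Proof.
by have /(congr1 (fun p : {poly C} => size p)) := preims_prod V; rewrite size_prod_XsubC size_polyDl ?size_subC // fsize => -[].
Qed.

Lemma horner_preims V z : f.[z] - V = \prod_(w <- preims f V) (z - w).
Proof.
have /(congr1 (horner^~ z)) := preims_prod V; rewrite hornerD hornerN hornerC => ->.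
by rewrite horner_prod; apply: eq_bigr => w _; rewrite hornerXsubC.
Qed.

Lemma mem_preims V w : (w \in preims f V) = (f.[w] == V).
Proof. by rewrite -root_prod_XsubC -preims_prod rootE !hornerE subr_eq0. Qed.

Lemma preims_near V z : exists2 w, w \in preims f V & cabs (z - w) ^+ m <= cabs (f.[z] - V).
Proof.
have [|w ws] := @seq_near _ (preims f V) z; first by rewrite -size_eq0 size_preims -lt0n.
by rewrite size_preims -horner_preims; exists w.
Qed.

Lemma preims_uniq_noncrit V w : uniq (preims f V) -> f.[w] = V -> (f^`()).[w] != 0.
Proof.
move=> u fw; have : separable.separable_poly (f - V%:P).
  by rewrite preims_prod separable.separable_prod_XsubC.
rewrite separable.separable_poly.unlock derivB derivC subr0 => h.
by apply: coprimep_root h _; rewrite rootE !hornerE fw subrr.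
Qed.

Lemma noncrit_preims_uniq V : (forall w, f.[w] = V -> (f^`()).[w] != 0) -> uniq (preims f V).
Proof.
move=> h; rewrite -separable.separable_prod_XsubC -preims_prod separable.separable_poly.unlock derivB derivC subr0.
apply: Pdiv.ClosedField.root_coprimep => w; rewrite rootE !hornerE subr_eq0 => /eqP; exact: h.
Qed.

End Preimages.

(** * Roots of unity, and connectedness of a ray *)

Section RootsOfUnity.
Context {R : realType}.
Local Notation C := (Cplx R).

Lemma nth_roots_exist (c : C) m : (0 < m)%N -> c != 0 ->
  exists s : seq C, [/\ uniq s, size s = m & forall x, x \in s -> x ^+ m = c ^+ m].
Proof.
move=> m0 c0; exists (preims 'X^m (c ^+ m)).
have sX : size ('X^m : {poly C}) = m.+1 by rewrite size_polyXn.
have mX := monicXn C m.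
split; [|exact: size_preims|].
  apply: (noncrit_preims_uniq mX sX m0) => w; rewrite hornerXn => wm.
  have w0 : w != 0.
    by apply/eqP => w0; move: wm; rewrite w0 expr0n (gtn_eqF m0) /= => /esym/eqP; rewrite expf_eq0 (negbTE c0) andbF.
  by rewrite derivXn hornerMn hornerXn mulrn_eq0 negb_or -lt0n m0 expf_neq0.
by move=> x; rewrite (mem_preims mX sX) // hornerXn => /eqP.
Qed.

(** If w^m = 1 with [w] close to 1, then m times [clog w] is a small number with exponential 1,
    hence 0. *)
Lemma unity_root_near1 m : (0 < m)%N -> exists2 e : R, 0 < e & forall w : C, cabs (w - 1) < e -> w ^+ m = 1 -> w = 1.
Proof.
move=> m0; have r0 := @clog_radius_gt0 R; have mR : (1 : R) <= m%:R by rewrite ler1n.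
exists (clog_radius R / (2 * m%:R)); first by rewrite divr_gt0 // mulr_gt0 //; lra.
move=> w; rewrite ltr_pdivlMr; last by lra.
move=> hw wm; have a0 := cabs_ge0 (w - 1).
have hw' : cabs (w - 1) <= clog_radius R / 2 by nra.
rewrite -(cexpK hw').
have h : m%:R * clog w = 0.
  apply: cexp_eq1; last by rewrite cexpMn cexpK.
  by rewrite cabsM cabs_nat; have := clog_le hw'; nra.
move: h => /eqP; rewrite mulf_eq0 pnatr_eq0 (gtn_eqF m0) /= => /eqP ->.
exact: cexp0.
Qed.

Lemma nth_root_sep (c : C) m : (0 < m)%N -> c != 0 -> exists2 e : R, 0 < e &
  forall a b, cabs (a - c) < e -> cabs (b - c) < e -> a ^+ m = b ^+ m -> a = b.
Proof.
move=> m0 c0; have [e e0 he] := unity_root_near1 m0.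
have ac : 0 < cabs c by rewrite cabs_gt0.
have ec : 0 < e * cabs c by rewrite mulr_gt0.
exists (Num.min (cabs c / 2) (e * cabs c / 4)); first by rewrite lt_min; lra.
move=> a b; rewrite !lt_min => /andP[a1 a2] /andP[b1 b2] ab.
have bc : cabs c / 2 < cabs b by have := cabs_le_sub c b; rewrite cabsBC; lra.
have b0 : b != 0 by rewrite -cabs_gt0; lra.
have : a / b = 1.
  apply: he; last by rewrite exprMn exprVn ab divff // expf_neq0.
  rewrite (_ : a / b - 1 = (a - b) / b); last by field.
  rewrite cabsM cabsV ltr_pdivrMr; last lra.
  have := cabsB3 c a b; rewrite [cabs (c - _)]cabsBC.
  have : e * (cabs c / 2) < e * cabs b by rewrite ltr_pM2l.
  lra.
by move/(congr1 (fun x => x * b)); rewrite mulfVK // mul1r.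
Qed.

(** The supremum of the initial intervals on which [P] holds satisfies [P] by closedness, and
    openness carries [P] beyond it unless it is 1. *)
Lemma ray_connected (P : R -> Prop) (t0 : R) : t0 <= 1 -> P t0 ->
  (forall t, t0 <= t <= 1 -> P t -> exists2 d : R, 0 < d & forall t', t0 <= t' <= 1 -> `|t' - t| < d -> P t') ->
  (forall t, t0 <= t <= 1 -> (forall d : R, 0 < d -> exists2 t', t0 <= t' <= 1 /\ `|t' - t| < d & P t') -> P t) ->
  P 1.
Proof.
move=> t01 P0 hop hcl.
pose A := [set s : R | t0 <= s <= 1 /\ forall t, t0 <= t <= s -> P t].
have At0 : A t0 by split; [lra|move=> t ht; have -> : t = t0 by lra].
have hA : has_sup A by split; [exists t0|exists 1 => s [h _]; lra].
pose s := sup A.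
have s0 : t0 <= s by apply: ub_le_sup => //; exact: hA.2.
have s1 : s <= 1 by apply: ge_sup; [exists t0|move=> x [h _]; lra].
have hlt t : t0 <= t < s -> P t.
  move=> /andP[h1 h2]; have [|x [hx Px] xs] := @sup_adherent _ A (s - t) _ hA; first lra.
  by apply: Px; rewrite h1 /=; rewrite -/s in xs; lra.
have Ps : P s.
  apply: hcl; first lra; move=> d d0.
  have [e|ne] := eqVneq s t0; first by exists t0 => //; rewrite e subrr normr0; split => //; lra.
  have s0' : t0 < s by rewrite lt_neqAle eq_sym ne.
  exists (Num.max t0 (s - d / 2)); last by apply: hlt; rewrite le_max lexx gt_max s0' /=; lra.
  have : t0 <= Num.max t0 (s - d / 2) /\ s - d / 2 <= Num.max t0 (s - d / 2) < s.
    by rewrite !le_max !lexx orbT gt_max s0'; split => //; lra.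
  by move=> [h1 h2]; split; [lra|rewrite ltr_norml; lra].
have [s1'|s1'] := eqVneq s 1; first by rewrite -s1'.
have {}s1' : s < 1 by rewrite lt_neqAle s1'.
have [d d0 hd] := hop s (introT andP (conj s0 s1)) Ps.
pose s' := Num.min 1 (s + d / 2).
have hs' : s < s' /\ s' <= 1 /\ s' <= s + d / 2 by rewrite /s' lt_min !ge_min !lexx orbT s1' /=; split => //; lra.
have : A s'.
  split; first lra; move=> t ht; have [h|h] := ltP t s; first by apply: hlt; lra.
  by apply: hd; [lra|rewrite ltr_norml; lra].
move=> /(ub_le_sup hA.2); rewrite -/s; lra.
Qed.

End RootsOfUnity.

(* A semiconjugacy Phi of f to z^m which is a homeomorphism onto a punctured disk
   near infinity is a bijection onto the punctured unit disk: being onto is an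
   open and closed condition along each ray, and since the m distinct m-th roots
   of each value are attained at the m preimages of one point, these preimages
   are distinct, which gives injectivity. *)
Section Semiconjugacy.
Context {R : realType}.
Local Notation C := (Cplx R).
Variables (f : {poly C}) (m : nat) (Om : C -> Prop) (Phi : C -> C) (r : R).
Hypotheses (fmonic : f \is monic) (fsize : size f = m.+1) (m1 : (1 < m)%N).
Hypothesis Om_f : forall z, Om f.[z] <-> Om z.
Hypothesis Phi0 : forall z, Om z -> Phi z != 0.
Hypothesis Phi1 : forall z, Om z -> cabs (Phi z) < 1.
Hypothesis Phi_f : forall z, Om z -> Phi f.[z] = Phi z ^+ m.
Hypothesis Phi_cont : forall z, Om z -> ccont Phi z.
Hypotheses (r0 : 0 < r) (r1 : r <= 1).
(** Level [n] is the preimage of the disk of radius [r] under the [n]-th iterate of z^m. The levels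
    exhaust the open unit disk, so induction on them extends what is assumed on the small disk. *)
Let lev n (z : C) := cabs z ^+ (m ^ n) < r.
Let m0 : (0 < m)%N. Proof. exact: ltnW. Qed.

Let surj n := forall z : C, z != 0 -> lev n z -> exists2 w, Om w & Phi w = z.
Let inj n := forall w w' : C, Om w -> Om w' -> lev n (Phi w) -> Phi w = Phi w' -> w = w'.
Let opn n := forall w : C, Om w -> lev n (Phi w) -> forall e : R, 0 < e -> exists2 d : R, 0 < d &
  forall z : C, cabs (z - Phi w) < d -> exists2 w', Om w' & cabs (w' - w) < e /\ Phi w' = z.

Hypotheses (base_surj : surj 0) (base_inj : inj 0) (base_opn : opn 0).

Let levX n z : lev n.+1 z = lev n (z ^+ m).
Proof. by rewrite /lev cabsX -exprM expnS. Qed.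

Let small_root (e : R) : 0 < e -> exists2 d : R, 0 < d & forall a b : C, cabs (a - b) ^+ m < d -> cabs (a - b) < e.
Proof.
move=> e0; exists (e ^+ m); first exact: exprn_gt0.
by move=> a b; rewrite ltr_pXn2r ?nnegrE ?cabs_ge0 // ltW.
Qed.

(** For [z] near Phi w, openness at level [n] lifts z^m to a point V' near f w, and some preimage w'
    of V' is near [w]. Then Phi w' and [z] have the same [m]-th power and are both close to the
    nonzero number Phi w, hence are equal. *)
Let opn_step n : opn n -> opn n.+1.
Proof.
move=> IH w Ow lw e e0.
have OV : Om f.[w] by apply/Om_f.
have [ec ec0 hec] := nth_root_sep m0 (Phi0 Ow).
have [ep ep0 hep] := Phi_cont Ow ec0.
have mm : 0 < Num.min e ep by rewrite lt_min e0.
have [d1 d10 hd1] := small_root mm.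
have lV : lev n (Phi f.[w]) by rewrite Phi_f // -levX.
have [d2 d20 hd2] := IH _ OV lV _ d10.
have [d3 d30 hd3] := cderiv_cont (cderivXn (Phi w) m) d20.
exists (Num.min d3 ec); first by rewrite lt_min d30.
move=> z; rewrite lt_min => /andP[/hd3 h3 hc]; rewrite -Phi_f // in h3.
have [V' OV' [hV' PV']] := hd2 _ h3.
have [w' w's hw'] := preims_near fmonic fsize m0 V' w.
rewrite (mem_preims fmonic fsize) // in w's.
have Ow' : Om w' by apply/Om_f; rewrite (eqP w's).
have : cabs (w - w') < Num.min e ep.
  by apply: hd1; apply: le_lt_trans hw' _; rewrite cabsBC.
rewrite cabsBC lt_min => /andP[h4 /hep h5].
exists w' => //; split => //; apply: hec => //.
by rewrite -Phi_f // (eqP w's).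
Qed.

Let opn_all n : opn n.
Proof. by elim: n => [|n IH]; [exact: base_opn|exact: opn_step]. Qed.

Let surj_step n : surj n -> inj n -> surj n.+1.
Proof.
move=> IHs IHi z z0 lz.
have lz1 (t : R) : 0 <= t <= 1 -> lev n.+1 (real_complex R t * z).
  move=> t01; apply: le_lt_trans lz; apply: lerXn2r; rewrite ?nnegrE ?cabs_ge0 //.
  by rewrite cabsM cabs_real ger0_norm; have := cabs_ge0 z; nra.
have z1 : cabs z < 1.
  rewrite ltNge; apply/negP => h; move: lz; rewrite /lev ltNge (le_trans r1) // exprn_ege1 //.
have az : 0 < cabs z by rewrite cabs_gt0.
have [t0 [t00 t0r]] : exists t0 : R, 0 < t0 /\ t0 < r by exists (r / 2); move: r0; lra.
have nz t : t0 <= t -> real_complex R t * z != 0.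
  by move=> h; rewrite mulf_neq0 // -cabs_gt0 cabs_real normr_gt0; lra.
rewrite -[z]mul1r -[1]/(real_complex R 1).
apply: (@ray_connected R (fun t => exists2 w, Om w & Phi w = real_complex R t * z) t0).
- exact/ltW/(lt_le_trans t0r r1).
- apply: base_surj; first exact: nz.
  by rewrite /lev expn0 expr1 cabsM cabs_real ger0_norm ?(ltW t00) //; nra.
- move=> t ht [w Ow Pw].
  have lw : lev n.+1 (Phi w) by rewrite Pw; apply: lz1; lra.
  have [d d0 hd] := opn_all Ow lw ltr01.
  exists d => // t' ht' tt; have [|w' Ow' [_ Pw']] := hd (real_complex R t' * z); last by exists w'.
  rewrite Pw -mulrBl -rmorphB cabsM cabs_real.
  by have := normr_ge0 (t' - t); nra.
- move=> t ht hcl.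
  have tz0 := nz t (proj1 (andP ht)).
  have [|V OV PV] := IHs ((real_complex R t * z) ^+ m) (expf_neq0 _ tz0).
    by rewrite -levX; apply: lz1; lra.
  have Oroot w : w \in preims f V -> Om w.
    by rewrite (mem_preims fmonic fsize) // => /eqP e; apply/Om_f; rewrite e.
  apply: contrapT => hno.
  (* If no preimage of [V] is sent to t z, then near these finitely many points the values of [Phi]
     keep a distance [d] from t z. *)
  have [d d0 hd] : exists2 d : R, 0 < d & forall w y, w \in preims f V -> cabs (y - w) < d -> d <= cabs (Phi y - real_complex R t * z).
    have : forall w, w \in preims f V -> Phi w != real_complex R t * z.
      by move=> w ws; apply/eqP => e; apply: hno; exists w => //; exact: Oroot.
    elim: (preims f V) Oroot => [|w s IH] Os hs; first by exists 1.
    have [w' w's|w' w's|d d0 hd] := IH _ _; [by apply: Os; rewrite inE w's orbT|by apply: hs; rewrite inE w's orbT|].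
    have e0 : 0 < cabs (Phi w - real_complex R t * z) / 2.
      by rewrite divr_gt0 // cabs_gt0 subr_eq0 hs // mem_head.
    have [d' d'0 hd'] := Phi_cont (Os _ (mem_head _ _)) e0.
    exists (Num.min d (Num.min d' (cabs (Phi w - real_complex R t * z) / 2))); first by rewrite !lt_min d0 d'0.
    move=> w' y; rewrite inE => /orP[/eqP ->|w's]; rewrite !lt_min => /andP[h1 /andP[h2 h3]].
      rewrite !ge_min; apply/orP; right; apply/orP; right.
      by have := hd' _ h2; have := cabsB3 (Phi y) (Phi w) (real_complex R t * z); rewrite [cabs (Phi w - Phi _)]cabsBC; lra.
    by rewrite ge_min (hd w').
  have [d1 d10 hd1] := small_root d0.
  have lV : lev n (Phi V) by rewrite PV -levX; apply: lz1; lra.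
  have [d2 d20 hd2] := opn_all OV lV d10.
  have [d3 d30 hd3] := cderiv_cont (cderivXn (real_complex R t * z) m) d20.
  have mm : 0 < Num.min d d3 by rewrite lt_min d0.
  have [t' [ht' tt] [w Ow Pw]] := hcl _ mm.
  have tz : cabs (real_complex R t' * z - real_complex R t * z) < Num.min d d3.
    by rewrite -mulrBl -rmorphB cabsM cabs_real; have := normr_ge0 (t' - t); nra.
  move: tz; rewrite lt_min => /andP[tz1 /hd3]; rewrite -PV -Pw -Phi_f // => /hd2[V' OV' [hV' PV']].
  have lfw : lev n (Phi f.[w]) by rewrite Phi_f // -levX Pw; apply: lz1; lra.
  (* Injectivity at level [n] identifies f w with the point V' found near [V], so [w] lies near a
     preimage of [V] although Phi w is within [d] of t z. *)
  have e : f.[w] = V' by apply: IHi => //; apply/Om_f.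
  have [w' w's hw'] := preims_near fmonic fsize m0 V w.
  have : cabs (w - w') < d by apply: hd1; apply: le_lt_trans hw' _; rewrite e.
  by move=> /(hd _ _ w's); rewrite Pw leNgt tz1.
Qed.

Let preims_Phi_uniq n V z : surj n.+1 -> inj n -> Om V -> z != 0 -> lev n.+1 z -> Phi V = z ^+ m ->
  uniq (map Phi (preims f V)).
Proof.
move=> hs hi OV z0 lz PV.
have [s [us ss hss]] := nth_roots_exist m0 z0.
apply: leq_size_uniq us _ _; last by rewrite size_map (size_preims fmonic fsize) // ss.
move=> x xs; have xm := hss _ xs.
have x0 : x != 0.
  by apply/eqP => x0; move: xm; rewrite x0 expr0n (gtn_eqF m0) /= => /esym/eqP; rewrite expf_eq0 (negbTE z0) andbF.
have lx : lev n.+1 x by rewrite levX xm -levX.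
have [w Ow Pw] := hs _ x0 lx.
apply/mapP; exists w => //; rewrite (mem_preims fmonic fsize) //; apply/eqP.
by apply: hi; rewrite ?Om_f // Phi_f // Pw xm // -levX.
Qed.

Let uniq_map_inj (s : seq C) w w' : uniq (map Phi s) -> w \in s -> w' \in s -> Phi w = Phi w' -> w = w'.
Proof.
elim: s => // x s IH /= /andP[xs us]; rewrite !inE => /orP[/eqP ->|ws] /orP[/eqP ->|w's] e //.
- by move: xs; rewrite e map_f.
- by move: xs; rewrite -e map_f.
- exact: IH.
Qed.

Let inj_step n : surj n.+1 -> inj n -> inj n.+1.
Proof.
move=> hs hi w w' Ow Ow' lw e.
have ef : f.[w] = f.[w'].
  apply: hi; rewrite ?Om_f // !Phi_f ?e // -levX -e //.
have OV : Om f.[w] by apply/Om_f.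
have := @preims_Phi_uniq n f.[w] (Phi w) hs hi OV (Phi0 Ow) lw (Phi_f Ow).
move=> /uniq_map_inj; apply => //; rewrite (mem_preims fmonic fsize) // ef //.
Qed.

Let all_levels n : surj n /\ inj n.
Proof.
elim: n => [|n [IHs IHi]]; first by split.
have hs := surj_step IHs IHi; split => //; exact: inj_step.
Qed.

Let lev_exists z : cabs z < 1 -> exists n, lev n z.
Proof.
move=> z1; have [|k hk] := @geo_small R (cabs z) r _ r0; first by rewrite cabs_ge0.
exists k; apply: le_lt_trans hk; apply: ler_wiXn2l; rewrite ?cabs_ge0 ?ltW //.
exact/ltnW/ltn_expl.
Qed.

Lemma semiconj_surj z : z != 0 -> cabs z < 1 -> exists2 w, Om w & Phi w = z.
Proof. by move=> z0 /lev_exists[n]; have [hs _] := all_levels n; exact: hs. Qed.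

Lemma semiconj_inj w w' : Om w -> Om w' -> Phi w = Phi w' -> w = w'.
Proof.
move=> Ow Ow'; have [n ln] := lev_exists (Phi1 Ow); have [_ hi] := all_levels n; exact: hi.
Qed.

(** The [m] preimages of f w have distinct images under [Phi], so they are distinct themselves, and
    f takes the value f w with simple roots only. *)
Lemma semiconj_noncrit w : Om w -> (f^`()).[w] != 0.
Proof.
move=> Ow; have [n ln] := lev_exists (Phi1 Ow).
have [_ hi] := all_levels n; have [hs hi'] := all_levels n.+1.
have OV : Om f.[w] by apply/Om_f.
have ln1 : lev n.+1 (Phi w).
  rewrite levX /lev cabsX -exprM mulnC exprM; apply: le_lt_trans ln.
  by rewrite ler_iXnr ?exprn_ge0 ?cabs_ge0 ?exprn_ile1 ?cabs_ge0 ?(ltW (Phi1 Ow)).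
have := @preims_Phi_uniq n f.[w] (Phi w) hs hi OV (Phi0 Ow) ln1 (Phi_f Ow).
by move=> /map_uniq u; apply: (preims_uniq_noncrit fmonic fsize m0 u).
Qed.

End Semiconjugacy.

(** * Neighbourhoods on the Riemann sphere *)

Section SphereTopology.
Context {R : realType}.
Local Notation C := (Cplx R).

Lemma compact_cabs_bounded (K : set C) : compact K -> exists M : R, forall z, K z -> cabs z <= M.
Proof.
move=> cK.
have /near_covering_withinP cK' := (compact_near_coveringP K).1 cK.
have h : \forall M \near +oo%R, K `<=` (fun z => cabs z <= M).
  apply: (cK' R +oo%R (fun M z => cabs z <= M)) => z Kz.
  exists (ball z 1, [set M | cabs z + 1 < M]).
    split; first exact: (nbhsx_ballx _ _ ltr01).
    by apply: nbhs_pinfty_gt; rewrite num_real.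
  move=> [w M] /= [bw hM] Kw; move: bw; rewrite /ball /= normC_cabs -[1]/(real_complex R 1) ltcR.
  by have := cabs_le_sub w z; rewrite cabsBC; lra.
have [M hM] := filter_ex h; by exists M.
Qed.

Lemma complex_continuous : continuous (fun x : R * R => Complex x.1 x.2 : C).
Proof.
move=> x; apply/within_cabs => e e0; have e20 : 0 < e / 2 by lra.
exists (ball x.1 (e / 2), ball x.2 (e / 2)); first by split; exact: nbhsx_ballx.
move=> y [h1 h2]; apply: le_lt_trans (cabs_ReIm _) _; rewrite ReB ImB /=.
rewrite /ball /= in h1 h2.
by rewrite distrC [X in _ + X]distrC; lra.
Qed.

Lemma nbhs_cabsP (z : C) (P : set C) :
  nbhs z P <-> exists2 d : R, 0 < d & forall w, cabs (w - z) < d -> P w.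
Proof.
split.
  move=> /nbhs_ballP[d /= d0 hd].
  have [r r0 dr] : exists2 r : R, 0 < r & d = real_complex R r.
    by case: d d0 {hd} => a b; rewrite ltcE /= => /andP[/eqP -> ?]; exists a.
  exists r => // w wz; apply: hd.
  rewrite /ball /= dr; have : `|z - w| < real_complex R r :> C by rewrite normC_cabs ltcR cabsBC.
  exact.
move=> [d d0 hd]; apply/nbhs_ballP; exists (real_complex R d : C) => /=; first by rewrite ltcR.
move=> w bw; apply: hd; move: bw; rewrite /ball /= => bw.
have : `|z - w| < real_complex R d :> C by exact: bw.
by rewrite normC_cabs ltcR cabsBC.
Qed.

Lemma nbhs_infinityP (P : set (Chat R)) :
  nbhs (None : Chat R) P <-> P None /\ exists M : R, forall z, M < cabs z -> P (Some z).
Proof.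
split.
  case=> K [cK clK] KP; split; first by apply: KP; right.
  have [M hM] := compact_cabs_bounded cK; exists M => z Mz; apply: KP; left.
  by exists z => // /hM; rewrite leNgt Mz.
move=> [PN [M hM]].
pose K := (fun x : R * R => Complex x.1 x.2 : C) @` (`[- `|M|, `|M|]%classic `*` `[- `|M|, `|M|]%classic).
have cK : compact K.
  apply: continuous_compact; first exact/continuous_subspaceT/complex_continuous.
  by apply: compact_setX; exact: segment_compact.
exists K.
  split => //; apply: compact_closed => //; exact: norm_hausdorff.
move=> [z|] // [] // [w Kw] [<-]; apply: hM; rewrite ltNge; apply/negP => h; apply: Kw.
exists (complex.Re w, complex.Im w); last by case: (w).
have M0 : cabs w <= `|M| by apply: le_trans h _; exact: ler_norm.
by split; rewrite /= in_itv /= -ler_norml; apply: le_trans M0; [exact: cabs_Re|exact: cabs_Im].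
Qed.

(** A coordinate at infinity with a movable centre: a set that avoids [c] is read entirely in the
    finite variable [u]. *)
Definition sphere_chart (c u : C) : Chat R := if u == 0 then None else Some (c + u^-1).

Lemma sphere_chart_continuous c : continuous (sphere_chart c).
Proof.
move=> u P; rewrite /sphere_chart; case: eqVneq => [->|u0] hP.
  have [PN [M hM]] := (nbhs_infinityP P).1 hP.
  have c0 := cabs_ge0 c; have M0 := normr_ge0 M; have M1 := ler_norm M.
  have k0 : 0 < `|M| + cabs c + 1 by lra.
  apply/nbhs_ballP; exists (real_complex R (`|M| + cabs c + 1)^-1 : C) => /=; first by rewrite ltcR invr_gt0.
  move=> w; rewrite /ball /= sub0r normrN normC_cabs ltcR => hw.
  case: eqVneq => // w0; apply: hM.
  have aw : 0 < cabs w by rewrite cabs_gt0.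
  have : `|M| + cabs c + 1 < cabs w^-1 by rewrite cabsV -[ltLHS]invrK ltf_pV2 // posrE invr_gt0.
  by have := cabs_le_sub w^-1 (- c); rewrite opprK cabsN [w^-1 + c]addrC; lra.
have hc : (fun w : C => c + w^-1) @ u --> c + u^-1.
  exact: (cvgD (cvg_cst c) (cvgV u0 (@cvg_id _ (nbhs u)))).
have h1 : nbhs u (fun w => P (Some (c + w^-1))) := hc _ hP.
have h2 : nbhs u (fun w : C => w != 0).
  apply/nbhs_ballP; exists (real_complex R (cabs u) : C) => /=; first by rewrite ltcR cabs_gt0.
  move=> w; rewrite /ball /= normC_cabs ltcR => h.
  by apply/eqP => w0; move: h; rewrite w0 subr0 ltxx.
apply: filterS (filterI h1 h2) => w [/= hw w0].
by rewrite (negbTE w0).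
Qed.

Lemma ccontP (f : C -> C) (z : C) : ccont f z <-> f @ z --> f z.
Proof.
split => [h|/(@within_cabs _ C (nbhs z) (nbhs_filter z) f (f z)) h].
  apply/(@within_cabs _ C (nbhs z) (nbhs_filter z) f (f z)) => e /h[d d0 hd].
  by apply/nbhs_cabsP; exists d.
by move=> e /h /nbhs_cabsP.
Qed.

End SphereTopology.

(** * Bounds for polynomials on disks, and fixed points *)

Section PolynomialEstimates.
Context {R : realType}.
Local Notation C := (Cplx R).

Lemma poly_bounded (p : {poly C}) (r : R) : exists2 B : R, 0 <= B & forall x, cabs x <= r -> cabs p.[x] <= B.
Proof.
elim/poly_ind: p => [|p c [B B0 hB]].
  by exists 0 => // x _; rewrite horner0 cabs0.
exists (B * `|r| + cabs c) => [|x xr]; first by rewrite addr_ge0 ?mulr_ge0 ?cabs_ge0.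
rewrite !hornerE; apply: le_trans (cabsD _ _) _; rewrite cabsM lerD2r ler_pM ?cabs_ge0 ?hB //.
by apply: le_trans xr (ler_norm r).
Qed.

Lemma poly_lipschitz (p : {poly C}) (r : R) : exists2 L : R, 0 <= L &
  forall x y, cabs x <= r -> cabs y <= r -> cabs (p.[x] - p.[y]) <= L * cabs (x - y).
Proof.
elim/poly_ind: p => [|p c [L L0 hL]].
  by exists 0 => // x y _ _; rewrite !horner0 subrr cabs0 mul0r.
have [B B0 hB] := poly_bounded p r.
exists (L * `|r| + B) => [|x y xr yr]; first by rewrite addr_ge0 ?mulr_ge0.
rewrite !hornerE (_ : _ - _ = (p.[x] - p.[y]) * x + p.[y] * (x - y)); last by ring.
apply: le_trans (cabsD _ _) _; rewrite !cabsM mulrDl lerD //; last by rewrite ler_wpM2r ?cabs_ge0 ?hB.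
rewrite mulrAC ler_pM ?cabs_ge0 ?hL //; exact: le_trans xr (ler_norm r).
Qed.

(** A fixed point is never in the basin of infinity; one of them is the centre kappa of the
    coordinate u = 1 / (z - kappa). *)
Lemma fixpoint_exists (f : {poly C}) : (2 < size f)%N -> exists c, f.[c] = c.
Proof.
move=> sf; have : size (f - 'X) != 1%N.
  by rewrite size_polyDl ?size_polyN ?size_polyX //; case: (size f) sf => [|[|[]]].
by case/closed_rootP => c; rewrite rootE !hornerE subr_eq0 => /eqP; exists c.
Qed.

End PolynomialEstimates.

(** * The polynomial in the coordinate 1 / (z - kappa) *)

Section ChartAtInfinity.
Context {R : realType}.
Local Notation C := (Cplx R).
Variables (f : {poly C}) (m : nat) (kappa : C).
Hypotheses (fmonic : f \is monic) (fsize : size f = m.+1) (m1 : (1 < m)%N) (fk : f.[kappa] = kappa).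
Let m0 : (0 < m)%N. Proof. exact: ltnW. Qed.

Definition basin : set (Chat R) := basin_infinity (horner f).

Lemma basin_horner z : basin (Some f.[z]) <-> basin (Some z).
Proof.
split=> h M; have [N hN] := h M.
  by exists N.+1 => -[|n] // /hN; rewrite -iterSr.
by exists N => n nN; rewrite -iterSr; apply: hN; exact: leqW.
Qed.

Lemma kappa_notin_basin : ~ basin (Some kappa).
Proof.
move=> /(_ (cabs kappa))[N /(_ N (leqnn _))].
suff -> : iter N (horner f) kappa = kappa by rewrite ltxx.
by elim: N => //= n ->.
Qed.

(** This is u^m (f (kappa + 1/u) - kappa), written as a product over the roots of f - kappa so that
    it is visibly a polynomial with value 1 at 0. In the coordinate [u], f becomes u^m / Q(u). *)
Definition denomQ : {poly C} := \prod_(w <- preims f kappa) ((kappa - w)%:P * 'X + 1).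
Local Notation Q := denomQ.

Lemma denomQ0 : Q.[0] = 1.
Proof. by rewrite /Q horner_prod big1 // => w _; rewrite !hornerE ?mulr0 ?add0r. Qed.

Lemma denomQE u : u != 0 -> Q.[u] = u ^+ m * (f.[kappa + u^-1] - kappa).
Proof.
move=> u0; rewrite (horner_preims fmonic fsize) // -[in RHS](size_preims fmonic fsize m0 kappa) /Q.
elim: (preims f kappa) => [|w s IH]; first by rewrite !big_nil hornerC expr0 mulr1.
rewrite !big_cons hornerM IH exprS !hornerE /=; field.
exact: u0.
Qed.

Definition chartG u : C := u ^+ m / Q.[u].
Local Notation G := chartG.
Definition chartU u : Prop := basin (sphere_chart kappa u).
Local Notation U := chartU.

Lemma chartG0 : G 0 = 0.
Proof. by rewrite /G expr0n (gtn_eqF m0) mul0r. Qed.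

Lemma chartUE u : u != 0 -> U u = basin (Some (kappa + u^-1)).
Proof. by move=> u0; rewrite /U /sphere_chart (negbTE u0). Qed.

Lemma chartU0 : U 0.
Proof. by rewrite /U /sphere_chart eqxx. Qed.

(** A zero u of Q would make kappa + 1/u a preimage of [kappa], which is fixed and so outside the
    basin. *)
Lemma denomQ_neq0 u : U u -> Q.[u] != 0.
Proof.
have [->|u0] := eqVneq u 0; first by rewrite denomQ0 oner_neq0.
rewrite chartUE // denomQE // mulf_eq0 expf_eq0 (negbTE u0) andbF /= subr_eq0.
move=> Uu; apply/eqP => e; apply: kappa_notin_basin; rewrite -e.
exact/basin_horner.
Qed.

Lemma chartG_neq0 u : u != 0 -> Q.[u] != 0 -> G u != 0.
Proof. by move=> u0 q0; rewrite /G mulf_neq0 ?invr_eq0 ?expf_neq0. Qed.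

Lemma chartG_conj u : u != 0 -> Q.[u] != 0 -> kappa + (G u)^-1 = f.[kappa + u^-1].
Proof.
move=> u0 q0; rewrite /G invf_div {1}denomQE // mulrAC mulfV ?expf_neq0 // mul1r; ring.
Qed.

Lemma chartG_iff u : Q.[u] != 0 -> U (G u) <-> U u.
Proof.
move=> q0; have [->|u0] := eqVneq u 0; first by rewrite chartG0.
by rewrite !chartUE ?chartG_neq0 // chartG_conj // basin_horner.
Qed.

Lemma chartG_U u : U u -> U (G u).
Proof. by move=> Uu; apply/chartG_iff => //; exact: denomQ_neq0. Qed.

Lemma cderiv_chartG u : Q.[u] != 0 -> exists D, cderiv G u D.
Proof.
move=> q0; have h := cderiv_comp (cderiv_horner Q u) (cderivV q0).
have h2 := cderivM (cderivXn u m) h.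
by eexists; exact: h2.
Qed.

(** Since m > 1 and Q(0) = 1, the Lipschitz constant of u^m / Q(u) on the disk of radius rho is
    O(rho). With [L] and [K] Lipschitz constants of Q and u^(m-1) on the unit disk, rho is taken so
    that |Q - 1| <= 1/8 and the contraction factor is at most 1/2. *)
Lemma chart_ball : exists rho : R, [/\ 0 < rho <= 1,
  forall u, cabs u <= rho -> Q.[u] != 0,
  forall u v, cabs u <= rho -> cabs v <= rho -> cabs (G u - G v) <= cabs (u - v) / 2 &
  exists2 L : R, 0 <= L & forall u v, cabs u <= rho -> cabs v <= rho -> cabs (Q.[u]^-1 - Q.[v]^-1) <= L * cabs (u - v)].
Proof.
have [L L0 hL] := poly_lipschitz Q 1.
have [K K0 hK] := poly_lipschitz ('X^(m.-1) : {poly C}) 1.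
pose rho := Num.min 1 (1 / (16 * (L + K + 1))).
have LK : 0 < L + K + 1 by lra.
have LK0 : 0 < 16 * (L + K + 1) by lra.
have r0 : 0 < rho by rewrite lt_min ltr01 divr_gt0.
have r1 : rho <= 1 by rewrite ge_min lexx.
have rL : rho * (16 * (L + K + 1)) <= 1 by rewrite -ler_pdivlMr // ge_min lexx orbT.
clearbody rho.
have hQ u : cabs u <= rho -> cabs (Q.[u] - 1) <= 1 / 8.
  move=> ur; have := hL u 0 (le_trans ur r1); rewrite denomQ0 cabs0 subr0 => /(_ ler01).
  have := cabs_ge0 u; nra.
have hQ1 u : cabs u <= rho -> 1 / 2 <= cabs Q.[u] <= 2.
  move=> /hQ h; have := cabs_le_sub 1 Q.[u]; rewrite cabsBC cabs1.
  by have := cabsD (Q.[u] - 1) 1; rewrite subrK cabs1; lra.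
have q0 u : cabs u <= rho -> Q.[u] != 0 by move=> /hQ1; rewrite -cabs_gt0; lra.
exists rho; split => //; first by rewrite r0.
  move=> u v ur vr; have u1 := le_trans ur r1; have v1 := le_trans vr r1.
  have qu := q0 _ ur; have qv := q0 _ vr.
  have -> : G u - G v = (u ^+ m * (Q.[v] - Q.[u]) + Q.[u] * (u ^+ m - v ^+ m)) / (Q.[u] * Q.[v]).
    by rewrite /G; field; rewrite qu qv.
  have h1 : cabs (u ^+ m) <= rho.
    rewrite cabsX; apply: le_trans ur; apply: ler_iXnr => //; exact: cabs_ge0.
  have h2 : cabs (u ^+ m - v ^+ m) <= rho * (K + 1) * cabs (u - v).
    have -> : u ^+ m - v ^+ m = u * (u ^+ m.-1 - v ^+ m.-1) + (u - v) * v ^+ m.-1.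
      by rewrite -(prednK m0) !exprS /=; ring.
    apply: le_trans (cabsD _ _) _; rewrite !cabsM.
    have := hK u v u1 v1; rewrite !hornerXn => h.
    have h3 : cabs (v ^+ m.-1) <= rho.
      rewrite cabsX; apply: le_trans vr; apply: ler_iXnr => //; last exact: cabs_ge0.
      by case: (m) m1 => [|[]].
    have : cabs u * cabs (u ^+ m.-1 - v ^+ m.-1) <= rho * (K * cabs (u - v)) by rewrite ler_pM ?cabs_ge0.
    have : cabs (u - v) * cabs (v ^+ m.-1) <= cabs (u - v) * rho by rewrite ler_wpM2l ?cabs_ge0.
    lra.
  have := hL v u v1 u1; rewrite [cabs (v - u)]cabsBC => h3.
  have /andP[a1 a2] := hQ1 _ ur; have /andP[b1 b2] := hQ1 _ vr.
  rewrite cabsM cabsV ler_pdivrMr ?cabs_gt0 ?mulf_neq0 // cabsM.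
  apply: le_trans (cabsD _ _) _; rewrite !cabsM.
  have t0 := cabs_ge0 (u - v).
  have i1 : cabs (u ^+ m) * cabs (Q.[v] - Q.[u]) <= rho * (L * cabs (u - v)) by rewrite ler_pM ?cabs_ge0.
  have i2 : cabs Q.[u] * cabs (u ^+ m - v ^+ m) <= 2 * (rho * (K + 1) * cabs (u - v)) by rewrite ler_pM ?cabs_ge0.
  have i3 : 1 / 4 <= cabs Q.[u] * cabs Q.[v] by nra.
  have i4 : cabs (u - v) / 2 * (1 / 4) <= cabs (u - v) / 2 * (cabs Q.[u] * cabs Q.[v]) by rewrite ler_wpM2l //; lra.
  have i5 : rho * (16 * (L + K + 1)) * cabs (u - v) <= 1 * cabs (u - v) by rewrite ler_wpM2r.
  have i6 : 0 <= rho * L * cabs (u - v) by rewrite !mulr_ge0 // ltW.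
  lra.
exists (4 * L); first by rewrite mulr_ge0.
move=> u v ur vr; have u1 := le_trans ur r1; have v1 := le_trans vr r1.
have qu := q0 _ ur; have qv := q0 _ vr.
have -> : Q.[u]^-1 - Q.[v]^-1 = (Q.[v] - Q.[u]) / (Q.[u] * Q.[v]) by field; rewrite qu qv.
have /andP[a1 a2] := hQ1 _ ur; have /andP[b1 b2] := hQ1 _ vr.
rewrite cabsM cabsV ler_pdivrMr ?cabs_gt0 ?mulf_neq0 // cabsM.
have := hL v u v1 u1; rewrite [cabs (v - u)]cabsBC => h3.
have i3 : 1 / 4 <= cabs Q.[u] * cabs Q.[v] by nra.
have i4 : 4 * L * cabs (u - v) * (1 / 4) <= 4 * L * cabs (u - v) * (cabs Q.[u] * cabs Q.[v]).
  by rewrite ler_wpM2l // !mulr_ge0 ?cabs_ge0.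
lra.
Qed.

End ChartAtInfinity.

(** * A logarithm of 1 / Q on the basin *)

Section LogOfDenominator.
Context {R : realType}.
Local Notation C := (Cplx R).
Variables (f : {poly C}) (m : nat) (kappa : C).
Hypotheses (fmonic : f \is monic) (fsize : size f = m.+1) (m1 : (1 < m)%N) (fk : f.[kappa] = kappa).
Let m0 : (0 < m)%N. Proof. exact: ltnW. Qed.
Local Notation Q := (denomQ f kappa).
Local Notation G := (chartG f m kappa).
Local Notation U := (chartU f kappa).

Lemma iter_chartG_U n u : U u -> U (iter n G u).
Proof. by move=> Uu; elim: n => //= n IH; apply: (chartG_U fmonic fsize m1 fk). Qed.

Lemma iter_chartG_conj n u : u != 0 -> U u ->
  iter n G u != 0 /\ kappa + (iter n G u)^-1 = iter n (horner f) (kappa + u^-1).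
Proof.
move=> u0 Uu; elim: n => [|n [IH0 IH]] //=.
have q := denomQ_neq0 fmonic fsize m1 fk (iter_chartG_U n Uu).
by rewrite (chartG_neq0 m IH0 q) (chartG_conj fmonic fsize m1 IH0 q) IH.
Qed.

Lemma iter_chartG0 n : iter n G 0 = 0.
Proof. by elim: n => //= n ->; exact: chartG0. Qed.

Lemma chartU_reach u (e : R) : 0 < e -> U u -> exists n, cabs (iter n G u) < e.
Proof.
move=> e0 Uu; have [->|u0] := eqVneq u 0.
  by exists 0%N; rewrite /= cabs0.
have := Uu; rewrite chartUE // => /(_ (e^-1 + cabs kappa))[N /(_ N (leqnn _))].
have [gn0 <-] := iter_chartG_conj N u0 Uu => h; exists N.
have := cabsD kappa (iter N G u)^-1; rewrite cabsV => h2.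
have : e^-1 < (cabs (iter N G u))^-1 by lra.
by rewrite ltf_pV2 // posrE cabs_gt0.
Qed.

Variable rho : R.
Hypotheses (rho0 : 0 < rho) (Qball : forall u, cabs u <= rho -> Q.[u] != 0).
Hypothesis Gball : forall u v, cabs u <= rho -> cabs v <= rho -> cabs (G u - G v) <= cabs (u - v) / 2.

Lemma chartG_half u : cabs u <= rho -> cabs (G u) <= cabs u / 2.
Proof.
move=> ur; have := Gball ur (v := 0); rewrite cabs0 chartG0 // !subr0; apply.
exact: ltW.
Qed.

Lemma iter_chartG_half n u : cabs u <= rho -> cabs (iter n G u) <= cabs u * 2^-1 ^+ n.
Proof.
move=> ur; elim: n => [|n IH]; first by rewrite mulr1.
have h : 0 <= (2^-1 : R) ^+ n <= 1 by rewrite exprn_ge0 ?exprn_ile1 //; lra.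
have := cabs_ge0 u => u0.
have : cabs (iter n G u) <= rho by nra.
by move=> /chartG_half /=; rewrite exprS; lra.
Qed.

Lemma iter_chartG_ball n u : cabs u <= rho -> cabs (iter n G u) <= rho.
Proof.
move=> ur; apply: le_trans (iter_chartG_half n ur) (le_trans _ ur).
by rewrite ler_piMr ?cabs_ge0 // exprn_ile1 //; lra.
Qed.

Lemma iter_chartG_lip n u v : cabs u <= rho -> cabs v <= rho ->
  cabs (iter n G u - iter n G v) <= 2^-1 ^+ n * cabs (u - v).
Proof.
move=> ur vr; elim: n => [|n IH]; first by rewrite mul1r.
have := Gball (iter_chartG_ball n ur) (iter_chartG_ball n vr).
by rewrite /= exprS; lra.
Qed.

Lemma chartU_ball u : cabs u <= rho -> U u.
Proof.
have [-> _|u0] := eqVneq u 0; first exact: chartU0.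
move=> ur; rewrite chartUE // => M.
have h n : iter n G u != 0 /\ kappa + (iter n G u)^-1 = iter n (horner f) (kappa + u^-1).
  elim: n => [|n [IH0 IH]] //=.
  have q := Qball (iter_chartG_ball n ur).
  by rewrite (chartG_neq0 m IH0 q) (chartG_conj fmonic fsize m1 IH0 q) IH.
have k0 := cabs_ge0 kappa; have M0 := normr_ge0 M.
have u1 : 0 < cabs u by rewrite cabs_gt0.
pose e := (`|M| + cabs kappa + 1)^-1.
have e0 : 0 < e by rewrite invr_gt0; lra.
have [|N hN] := @geo_small R 2^-1 (e / cabs u) _ (divr_gt0 e0 u1); first lra.
exists N => n nN; have [g0 <-] := h n.
have gn : cabs (iter n G u) < e.
  apply: le_lt_trans (iter_chartG_half n ur) _; rewrite -ltr_pdivlMl // mulrC.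
  by apply: le_lt_trans hN; apply: ler_wiXn2l => //; lra.
have : `|M| + cabs kappa + 1 < (cabs (iter n G u))^-1.
  by rewrite -[ltLHS]invrK ltf_pV2 // posrE ?cabs_gt0.
have := cabs_le_sub (iter n G u)^-1 (- kappa); rewrite opprK cabsN cabsV addrC.
by have := ler_norm M; rewrite [_^-1 + kappa]addrC; lra.
Qed.

Lemma denomQ_near u : Q.[u] != 0 -> exists2 d : R, 0 < d & forall w, cabs (w - u) < d -> Q.[w] != 0.
Proof.
rewrite -cabs_gt0 => q0; have [d d0 hd] := cderiv_cont (cderiv_horner Q u) q0.
exists d => // w /hd; rewrite -cabs_gt0 cabsBC => h.
by have := cabs_le_sub Q.[u] Q.[w]; lra.
Qed.

(** Induction on the time to reach the small disk: where Q does not vanish, [U] is its own preimage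
    under the continuous map [G]. *)
Lemma chartU_open u : U u -> exists2 d : R, 0 < d & forall w, cabs (w - u) < d -> U w.
Proof.
move=> Uu; have [n hn] := chartU_reach rho0 Uu.
elim: n u Uu hn => [|n IH] u Uu hn.
  exists (rho - cabs u) => [|w wu]; first by move: hn => /=; lra.
  by apply: chartU_ball; have := cabs_le_sub w u; lra.
have q0 := denomQ_neq0 fmonic fsize m1 fk Uu.
have [|d d0 hd] := IH _ (chartG_U fmonic fsize m1 fk Uu); first by rewrite -iterSr.
have [D hD] := cderiv_chartG m q0.
have [d1 d10 h1] := cderiv_cont hD d0.
have [d2 d20 h2] := denomQ_near q0.
exists (Num.min d1 d2) => [|w]; first by rewrite lt_min d10.
rewrite lt_min => /andP[/h1/hd h3 /h2 h4].
exact/(chartG_iff fmonic fsize m1 h4).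
Qed.

(** The function 1 / Q is read on the sphere, with value 1 at infinity, and its logarithm is
    continued along paths. Continuity at [u] comes from straight segments: along them l u + clog (Q
    u / Q v) is a lift, and its increment is small near [u]. *)
Lemma log_denomQ : simply_connected R (basin f) -> exists l : C -> C,
  [/\ l 0 = 0, forall u, U u -> cexp (l u) = Q.[u]^-1 & forall u, U u -> ccont l u].
Proof.
move=> sc.
pose k (w : Chat R) : C := if w is Some z then Q.[(z - kappa)^-1]^-1 else 1.
have k_chart u : k (sphere_chart kappa u) = Q.[u]^-1.
  rewrite /k /sphere_chart; case: eqVneq => [->|u0]; first by rewrite denomQ0 invr1.
  by rewrite addrAC subrr add0r invrK.
have chart_surj w : basin f w -> exists2 u, U u & w = sphere_chart kappa u.
  case: w => [z|] bz; last by exists 0; [exact: chartU0|rewrite /sphere_chart eqxx].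
  have zk : z - kappa != 0.
    by rewrite subr_eq0; apply/eqP => e; apply: (@kappa_notin_basin _ f kappa fk); rewrite -e.
  have e : z = kappa + ((z - kappa)^-1)^-1 by rewrite invrK addrC subrK.
  exists (z - kappa)^-1; first by rewrite chartUE ?invr_eq0 // -e.
  by rewrite /sphere_chart invr_eq0 (negbTE zk) -e.
have k0 w : basin f w -> k w != 0.
  move=> /chart_surj[u Uu ->]; rewrite k_chart invr_eq0.
  exact: (denomQ_neq0 fmonic fsize m1 fk).
have QVder u : Q.[u] != 0 -> exists D, cderiv (fun w => Q.[w]^-1) u D.
  by move=> q0; eexists; exact: (cderiv_comp (cderiv_horner Q u) (cderivV q0)).
have kc : {within basin f, continuous k}.
  apply: continuous_within => -[z|] bz; last first.
    move=> P /(@nbhs_cabsP R) [d d0 hd]; apply/nbhs_infinityP; split; first by apply: hd; rewrite subrr cabs0.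
    have [|D hD] := QVder 0; first by rewrite denomQ0 oner_neq0.
    have [d1 d10 h1] := cderiv_cont hD d0.
    exists (d1^-1 + cabs kappa) => z zM; apply: hd => /=.
    move: h1; rewrite denomQ0 invr1; apply; rewrite subr0 cabsV.
    have : d1^-1 < cabs (z - kappa) by have := cabs_le_sub z kappa; lra.
    by move=> h; rewrite -[ltRHS]invrK ltf_pV2 // posrE ?invr_gt0 //; apply: lt_trans h; rewrite invr_gt0.
  have zk : z - kappa != 0.
    by rewrite subr_eq0; apply/eqP => e; apply: (@kappa_notin_basin _ f kappa fk); rewrite -e.
  have hz := cderivD (cderiv_id z) (cderiv_cst (- kappa) z).
  have h2 := cderiv_comp hz (cderivV zk).
  have Uz : U (z - kappa)^-1 by rewrite chartUE ?invr_eq0 // invrK addrC subrK.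
  have [D hD] := QVder _ (denomQ_neq0 fmonic fsize m1 fk Uz).
  have /ccontP h3 := cderiv_cont (cderiv_comp h2 hD).
  by move=> P hP; apply: h3.
have [|l [l0 lk lpath]] := @simply_connected_log R (Chat R) (basin f) k sc kc k0 None 0 I; first by rewrite cexp0.
pose L u := l (sphere_chart kappa u).
have Lexp u : U u -> cexp (L u) = Q.[u]^-1 by move=> Uu; rewrite /L lk // k_chart.
exists L; split => //; first by rewrite /L /sphere_chart eqxx.
move=> u Uu e e0; have qu := denomQ_neq0 fmonic fsize m1 fk Uu.
have cr0 := @clog_radius_gt0 R.
pose r w := Q.[u] / Q.[w].
have rder w : Q.[w] != 0 -> ccont r w.
  move=> /QVder[D hD]; apply: cderiv_cont (cderivM (cderiv_cst Q.[u] w) hD).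
have ru : r u = 1 by rewrite /r divff.
pose e' := Num.min (e / 2) (clog_radius R / 2).
have e'0 : 0 < e' by rewrite lt_min; lra.
have [d1 d10 h1] := rder _ qu _ e'0; rewrite ru in h1.
have [d2 d20 h2] := chartU_open Uu.
pose d := Num.min d1 d2.
have hU w : cabs (w - u) < d -> U w by rewrite lt_min => /andP[_ /h2].
have hr w : cabs (w - u) < d -> cabs (r w - 1) < e / 2 /\ cabs (r w - 1) < clog_radius R / 2.
  by rewrite lt_min => /andP[/h1 + _]; rewrite lt_min => /andP.
exists d => [|w wu]; first by rewrite lt_min d10.
pose seg (s : R) : C := u + real_complex R s * (w - u).
have seg_near s : I01 R s -> cabs (seg s - u) < d.
  move/I01P => hs; rewrite /seg addrC addKr cabsM cabs_real ger0_norm; last by lra.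
  by have := cabs_ge0 (w - u); nra.
have segc : {within I01 R, continuous seg}.
  apply: continuous_within => s _; apply/within_cabs => eps eps0.
  have wu0 := cabs_ge0 (w - u).
  have wu1 : 0 < cabs (w - u) + 1 by lra.
  apply/nbhs_normP; exists (eps / (cabs (w - u) + 1)) => /=; first exact: divr_gt0.
  move=> t; rewrite /ball_ /= => hst.
  rewrite /seg (_ : _ - _ = real_complex R (t - s) * (w - u)); last by rewrite rmorphB; ring.
  rewrite cabsM cabs_real distrC; move: hst; rewrite ltr_pdivlMr // => hst.
  by apply: le_lt_trans hst; rewrite ler_wpM2l //; lra.
pose B := [set v : C | cabs (v - u) < d].
have Wc : {within B, continuous (fun v => L u + clog (r v))}.
  apply: continuous_within => v Bv; apply/(ccontP (fun v => L u + clog (r v))) => eps eps0.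
  have [h3 h4] := hr _ Bv.
  pose eps' := Num.min (eps / 2) (clog_radius R / 2 - cabs (r v - 1)).
  have eps'0 : 0 < eps' by rewrite lt_min; lra.
  have [d3 d30 h5] := rder _ (denomQ_neq0 fmonic fsize m1 fk (hU _ Bv)) _ eps'0.
  exists d3 => // v' /h5; rewrite lt_min => /andP[h6 h7].
  rewrite (_ : _ - _ = clog (r v') - clog (r v)); last by ring.
  apply: le_lt_trans (clog_lip _ (ltW h4)) _; last by lra.
  by have := cabsB3 (r v) (r v') 1; lra.
have seg0 : seg 0 = u by rewrite /seg rmorph0 mul0r addr0.
have seg1 : seg 1 = w by rewrite /seg rmorph1 mul1r addrC subrK.
have hp : path_in (basin f) (fun s => sphere_chart kappa (seg s)).
  split; last by move=> _ [s Is <-]; apply: hU; exact: seg_near.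
  apply: (@within_comp _ _ _ _ setT seg (sphere_chart kappa) segc) => //.
  by apply: continuous_within => v _; exact: sphere_chart_continuous.
have hl : log_along k (fun s => sphere_chart kappa (seg s)) (fun s => L u + clog (r (seg s))).
  split; first by apply: (@within_comp _ _ _ _ B seg _ segc _ Wc) => s Is; exact: seg_near.
  move=> s Is; have sn := seg_near _ Is; rewrite k_chart cexpD Lexp // cexpK; last exact: ltW (hr _ sn).2.
  by rewrite /r mulrA mulVf ?mul1r.
have := lpath _ _ hp hl; rewrite seg0 seg1 ru clog1 addr0 => /(_ erefl) h.
have [h3 h4] := hr _ wu.
rewrite /L -h addrAC subrr add0r.
by apply: le_lt_trans (clog_le (ltW h4)) _; lra.
Qed.

End LogOfDenominator.

(** * The Boettcher function *)

Section BoettcherFunction.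
Context {R : realType}.
Local Notation C := (Cplx R).
Variables (f : {poly C}) (m : nat) (kappa : C).
Hypotheses (fmonic : f \is monic) (fsize : size f = m.+1) (m1 : (1 < m)%N) (fk : f.[kappa] = kappa).
Let m0 : (0 < m)%N. Proof. exact: ltnW. Qed.
Local Notation Q := (denomQ f kappa).
Local Notation G := (chartG f m kappa).
Local Notation U := (chartU f kappa).

Section Construction.
Variables (l : C -> C) (rho L : R).
Hypotheses (l0 : l 0 = 0) (lexp : forall u, U u -> cexp (l u) = Q.[u]^-1).
Hypothesis lcont : forall u, U u -> ccont l u.
Hypotheses (rho0 : 0 < rho) (rho1 : rho <= 1) (Qball : forall u, cabs u <= rho -> Q.[u] != 0).
Hypothesis Gball : forall u v, cabs u <= rho -> cabs v <= rho -> cabs (G u - G v) <= cabs (u - v) / 2.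
Hypothesis L0 : 0 <= L.
Hypothesis llip : forall u v, cabs u <= rho -> cabs v <= rho -> cabs (l u - l v) <= L * cabs (u - v).

Let c : C := m%:R^-1.
Let term k u := c ^+ k.+1 * l (iter k G u).
Let S n u := \sum_(k < n) term k u.
(** The logarithm of the Boettcher product, that is, the sum of l (G^k u) / m^(k+1). It solves m H u
    = l u + H (G u), which turns F u = u exp (H u) into a solution of F (G u) = F u ^ m. The value 0
    is a default where the sum diverges. *)
Definition boettcher_log u := xget 0 [set a | clim (S ^~ u) a].
Local Notation H := boettcher_log.

Let mC : (m%:R : C) != 0. Proof. by rewrite pnatr_eq0 -lt0n. Qed.

Let c_le1 k : cabs c ^+ k <= 1.
Proof.
rewrite exprn_ile1 ?cabs_ge0 // /c cabsV cabs_nat invf_le1 ?ler1n //.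
by rewrite ltr0n.
Qed.

Let half01 : 0 <= (2^-1 : R) < 1. Proof. by lra. Qed.

Let term_lip k u v : cabs u <= rho -> cabs v <= rho ->
  cabs (term k u - term k v) <= L * 2^-1 ^+ k * cabs (u - v).
Proof.
move=> ur vr; rewrite /term -mulrBr cabsM cabsX.
have h := llip (iter_chartG_ball m1 rho0 Gball k ur) (iter_chartG_ball m1 rho0 Gball k vr).
have h2 := iter_chartG_lip m1 rho0 Gball k ur vr.
apply: (@le_trans _ _ (1 * (L * (2^-1 ^+ k * cabs (u - v))))); last by rewrite mul1r mulrA.
rewrite ler_pM ?exprn_ge0 ?cabs_ge0 ?c_le1 //; apply: le_trans h _.
by rewrite ler_wpM2l.
Qed.

Let term0 k : term k 0 = 0.
Proof. by rewrite /term iter_chartG0 // l0 mulr0. Qed.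

Let S_shift n u : S n.+1 u = c * l u + c * S n (G u).
Proof.
rewrite /S big_ord_recl /= /term expr1 /=; congr (_ + _).
by rewrite mulr_sumr; apply: eq_bigr => k _ /=; rewrite -iterS iterSr exprS mulrA.
Qed.

(** The Lipschitz bounds on the terms hold on the small disk; elsewhere convergence is pulled back
    through the functional equation, by induction on the time to reach the disk. Differentiability
    is extended in the same way. *)
Let cvg_U u : U u -> exists a, clim (S ^~ u) a.
Proof.
move=> Uu; have [n hn] := chartU_reach fmonic fsize m1 fk rho0 Uu.
elim: n u Uu hn => [|n IH] u Uu hn.
  by apply: (lip_series_cvg half01 rho0 L0 term_lip) term0; exact: ltW.
have [|a ha] := IH _ (chartG_U fmonic fsize m1 fk Uu); first by rewrite -iterSr.
exists (c * l u + c * a); apply: clim_shift.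
have hc : clim (fun=> c * l u) (c * l u) by move=> e e0; exists 0%N => k _; rewrite subrr cabs0.
have := climD hc (climM c ha).
by move=> h e /h[N hN]; exists N => k /hN; rewrite S_shift.
Qed.

Lemma boettcher_logP u : U u -> clim (S ^~ u) (H u).
Proof. by move=> /cvg_U h; apply: (@xgetPex _ 0 [set a | clim (S ^~ u) a]). Qed.

Lemma boettcher_log_eq u : U u -> H u = c * l u + c * H (G u).
Proof.
move=> Uu; apply: clim_unique (boettcher_logP Uu) _; apply: clim_shift.
have hc : clim (fun=> c * l u) (c * l u) by move=> e e0; exists 0%N => k _; rewrite subrr cabs0.
have := climD hc (climM c (boettcher_logP (chartG_U fmonic fsize m1 fk Uu))).
by move=> h e /h[N hN]; exists N => k /hN; rewrite S_shift.
Qed.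

Let Uball u : cabs u <= rho -> U u.
Proof. exact: (chartU_ball fmonic fsize m1 rho0 Qball Gball). Qed.

Lemma boettcher_log_lip u v : cabs u <= rho -> cabs v <= rho -> cabs (H u - H v) <= 2 * L * cabs (u - v).
Proof.
move=> ur vr; have := lip_series_lip half01 L0 term_lip ur vr (boettcher_logP (Uball ur)) (boettcher_logP (Uball vr)).
by rewrite (_ : L / (1 - 2^-1) = 2 * L) //; field.
Qed.

Lemma boettcher_log0 : H 0 = 0.
Proof.
have z : cabs (0 : C) <= rho by rewrite cabs0 ltW.
apply: clim_unique (boettcher_logP (Uball z)) _ => e e0; exists 0%N => n _.
by rewrite /S big1 ?subrr ?cabs0 // => k _; exact: term0.
Qed.

Let l_deriv u : U u -> exists D, cderiv l u D.
Proof.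
move=> Uu; have q0 := denomQ_neq0 fmonic fsize m1 fk Uu.
have [d d0 hd] := chartU_open fmonic fsize m1 fk rho0 Qball Gball Uu.
have hQ := cderiv_comp (cderiv_horner Q u) (cderivV q0).
by eexists; apply: (cderiv_log d0 (lcont Uu) hQ) => w /hd/lexp.
Qed.

Let iterG_deriv n u : U u -> exists D, cderiv (fun w => iter n G w) u D.
Proof.
move=> Uu; elim: n => [|n [D hD]]; first by exists 1; exact: cderiv_id.
have [D' hD'] := cderiv_chartG m (denomQ_neq0 fmonic fsize m1 fk (iter_chartG_U fmonic fsize m1 fk n Uu)).
by exists (D' * D); exact: (cderiv_comp hD hD').
Qed.

Lemma boettcher_log_deriv u : U u -> exists D, cderiv H u D.
Proof.
move=> Uu; have [n hn] := chartU_reach fmonic fsize m1 fk rho0 Uu.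
elim: n u Uu hn => [|n IH] u Uu hn.
  apply: (lip_series_deriv half01 L0 term_lip (T := H) hn) => [v vr|k].
    exact: boettcher_logP (Uball vr).
  have [D hD] := iterG_deriv k Uu.
  have [D' hD'] := l_deriv (iter_chartG_U fmonic fsize m1 fk k Uu).
  have := cderivM (cderiv_cst (c ^+ k.+1) u) (cderiv_comp hD hD').
  by eexists; eassumption.
have [|D hD] := IH _ (chartG_U fmonic fsize m1 fk Uu); first by rewrite -iterSr.
have [D1 hD1] := l_deriv Uu.
have [D2 hD2] := iterG_deriv 1 Uu.
have h := cderivD (cderivM (cderiv_cst c u) hD1) (cderivM (cderiv_cst c u) (cderiv_comp hD2 hD)).
have [d d0 hd] := chartU_open fmonic fsize m1 fk rho0 Qball Gball Uu.
by eexists; apply: (cderiv_ext d0 _ h) => w /hd/boettcher_log_eq ->.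
Qed.

Definition boettcher_fun u := u * cexp (H u).
Local Notation F := boettcher_fun.

Lemma boettcher_fun_eq u : U u -> F (G u) = F u ^+ m.
Proof.
move=> Uu; have q0 := denomQ_neq0 fmonic fsize m1 fk Uu.
have e : m%:R * H u = l u + H (G u).
  by rewrite (boettcher_log_eq Uu) mulrDr !mulrA divff // !mul1r.
have : cexp (H u) ^+ m = Q.[u]^-1 * cexp (H (G u)) by rewrite -cexpMn e cexpD lexp.
by rewrite /F exprMn => ->; rewrite /G mulrA.
Qed.

Lemma boettcher_fun_deriv u : U u -> exists D, cderiv F u D.
Proof.
move=> /boettcher_log_deriv[D hD].
have := cderivM (cderiv_id u) (cderiv_comp hD (cderiv_cexp _)).
by eexists; eassumption.
Qed.

(** The factor exp (H u) is within 4 L |u| of 1 and has Lipschitz constant 4 L, so F u - u has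
    Lipschitz constant at most 8 L r; the choice of [r] makes this at most 1/2. *)
Lemma boettcher_fun_near_id : exists2 r : R, 0 < r <= rho & near_id r F.
Proof.
have [_ hcl _] := @clog_spec R.
have cr0 := @clog_radius_gt0 R.
have L0' := L0; have L1 : 0 < L + 1 by lra.
pose r := Num.min rho (Num.min (clog_radius R / (2 * (L + 1))) (1 / (16 * (L + 1)))).
have r0 : 0 < r by rewrite !lt_min rho0 !divr_gt0 // mulr_gt0.
have rr : r <= rho by rewrite ge_min lexx.
have rc : r * (2 * (L + 1)) <= clog_radius R.
  by rewrite -ler_pdivlMr ?mulr_gt0 // !ge_min lexx !orbT.
have rL : r * (16 * (L + 1)) <= 1.
  by rewrite -ler_pdivlMr ?mulr_gt0 // !ge_min lexx !orbT.
clearbody r; exists r; first by rewrite r0.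
have Hsmall u : cabs u <= r -> cabs (H u) <= 2 * L * cabs u.
  move=> ur; have := boettcher_log_lip (le_trans ur rr) (v := 0).
  by rewrite cabs0 boettcher_log0 !subr0; apply; exact: ltW.
have Hc u : cabs u <= r -> cabs (H u) <= clog_radius R.
  by move=> ur; have := Hsmall _ ur; have := cabs_ge0 u; nra.
have explip u v : cabs u <= r -> cabs v <= r -> cabs (cexp (H u) - cexp (H v)) <= 4 * L * cabs (u - v).
  move=> ur vr; have := near_id_lip hcl (Hc _ ur) (Hc _ vr).
  rewrite (_ : cexp (H u) - 1 - _ = cexp (H u) - cexp (H v)); last by ring.
  by have := boettcher_log_lip (le_trans ur rr) (le_trans vr rr); lra.
move=> u v ur vr; rewrite /F.
rewrite (_ : _ - _ - _ = (cexp (H u) - 1) * (u - v) + v * (cexp (H u) - cexp (H v))); last by ring.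
have := explip u 0 ur; rewrite cabs0 boettcher_log0 cexp0 subr0 => /(_ (ltW r0)) h1.
have h2 := explip u v ur vr.
apply: le_trans (cabsD _ _) _; rewrite !cabsM.
have t0 := cabs_ge0 (u - v); have u0 := cabs_ge0 u; have v0 := cabs_ge0 v.
have i1 : cabs (cexp (H u) - 1) * cabs (u - v) <= (4 * L * r) * cabs (u - v).
  by rewrite ler_wpM2r //; apply: le_trans h1 _; rewrite ler_wpM2l // mulr_ge0.
have i2 : cabs v * cabs (cexp (H u) - cexp (H v)) <= r * (4 * L * cabs (u - v)).
  by rewrite ler_pM ?cabs_ge0.
have i3 : r * (16 * (L + 1)) * cabs (u - v) <= 1 * cabs (u - v) by rewrite ler_wpM2r.
have i4 : 0 <= r * cabs (u - v) by rewrite mulr_ge0 // ltW.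
lra.
Qed.

End Construction.

Lemma boettcher_exists : simply_connected R (basin f) -> exists (F : C -> C) (r : R),
  [/\ 0 < r <= 1, (forall u, cabs u <= r -> Q.[u] != 0) /\
    (forall u v, cabs u <= r -> cabs v <= r -> cabs (G u - G v) <= cabs (u - v) / 2),
    [/\ F 0 = 0, near_id r F & forall u, U u -> u != 0 -> F u != 0],
    forall u, U u -> F (G u) = F u ^+ m & forall u, U u -> exists D, cderiv F u D].
Proof.
move=> sc.
have [rho0 [/andP[rho00 rho01] Qb Gb [L L0 hL]]] := chart_ball f kappa m1.
have [l [l0 lexp lcont]] := log_denomQ fmonic fsize m1 fk rho00 Qb Gb sc.
have cr0 := @clog_radius_gt0 R; have cr2 : 0 < clog_radius R / 2 by lra.
have U0 := chartU0 f kappa.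
have [d1 d10 h1] := lcont _ U0 _ cr0.
have q00 : Q.[0] != 0 := denomQ_neq0 fmonic fsize m1 fk U0.
have [d2 d20 h2] := cderiv_cont (cderiv_comp (cderiv_horner Q 0) (cderivV q00)) cr2.
(* On a disk this small the continued logarithm [l] stays within [clog_radius], so it is the local
   logarithm of 1 / Q and inherits a Lipschitz bound. *)
pose rho := Num.min rho0 (Num.min (d1 / 2) (d2 / 2)).
have hrho : 0 < rho by rewrite !lt_min rho00; lra.
have hr0 : rho <= rho0 by rewrite ge_min lexx.
have hr1 : rho < d1 by apply: (@le_lt_trans _ _ (d1 / 2)); [rewrite !ge_min lexx orbT|lra].
have hr2 : rho < d2 by apply: (@le_lt_trans _ _ (d2 / 2)); [rewrite !ge_min lexx !orbT|lra].
clearbody rho.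
have hrho1 : rho <= 1 by lra.
have Qb' u : cabs u <= rho -> Q.[u] != 0 by move=> h; apply: Qb; lra.
have Gb' u v : cabs u <= rho -> cabs v <= rho -> cabs (G u - G v) <= cabs (u - v) / 2.
  by move=> hu hv; apply: Gb; lra.
have Ub u : cabs u <= rho -> U u := @chartU_ball _ _ _ _ fmonic fsize m1 rho hrho Qb' Gb' u.
have hq u : cabs u <= rho -> cabs (Q.[u]^-1 - 1) <= clog_radius R / 2.
  by move=> ur; have := h2 u; rewrite denomQ0 // invr1 subr0 => h; apply/ltW/h; lra.
have lE u : cabs u <= rho -> l u = clog (Q.[u]^-1).
  move=> ur; rewrite -(lexp _ (Ub _ ur)) clogK //; last by rewrite lexp ?hq //; exact: Ub.
  by have := h1 u; rewrite l0 !subr0 => h; apply/ltW/h; lra.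
have llip u v : cabs u <= rho -> cabs v <= rho -> cabs (l u - l v) <= 2 * L * cabs (u - v).
  move=> ur vr; rewrite !lE //; apply: le_trans (clog_lip _ _) _; rewrite ?hq //.
  by rewrite -mulrA ler_pM2l // hL //; lra.
have L20 : 0 <= 2 * L by rewrite mulr_ge0.
have [r /andP[r0 rr] hr] := boettcher_fun_near_id l0 hrho Qb' Gb' L20 llip.
exists (boettcher_fun l), r; split.
- by rewrite r0 /=; lra.
- by split=> [u h|u v h h']; [apply: Qb'; lra|apply: Gb'; lra].
- split=> //; first by rewrite /boettcher_fun mul0r.
  by move=> u _ u0; rewrite mulf_neq0 ?cexp_neq0.
- by move=> u; apply: boettcher_fun_eq llip u.
- by move=> u; apply: boettcher_fun_deriv llip u.
Qed.

End BoettcherFunction.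

(** * The Riemann map of the basin *)

Section Uniformization.
Context {R : realType}.
Local Notation C := (Cplx R).
Variables (f : {poly C}) (m : nat) (kappa : C).
Hypotheses (fmonic : f \is monic) (fsize : size f = m.+1) (m1 : (1 < m)%N) (fk : f.[kappa] = kappa).
Hypothesis sc : simply_connected R (basin f).
Let m0 : (0 < m)%N. Proof. exact: ltnW. Qed.
Local Notation Q := (denomQ f kappa).
Local Notation G := (chartG f m kappa).
Local Notation U := (chartU f kappa).
Local Notation Om z := (basin f (Some z)).
Let v (z : C) : C := (z - kappa)^-1.

Let vK z : kappa + (v z)^-1 = z.
Proof. by rewrite /v invrK addrC subrK. Qed.

Let Kv u : v (kappa + u^-1) = u.
Proof. by rewrite /v addrAC subrr add0r invrK. Qed.

Let v_neq0 z : Om z -> v z != 0.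
Proof.
move=> Oz; rewrite invr_eq0 subr_eq0; apply/eqP => e.
by apply: (@kappa_notin_basin _ f kappa fk); rewrite -e.
Qed.

Let v_U z : Om z -> U (v z).
Proof. by move=> Oz; rewrite chartUE ?v_neq0 // vK. Qed.

Let v_f z : Om z -> G (v z) = v f.[z].
Proof.
move=> Oz; have := chartG_conj fmonic fsize m1 (v_neq0 Oz) (denomQ_neq0 fmonic fsize m1 fk (v_U Oz)).
by rewrite vK => <-; rewrite Kv.
Qed.

Let U_Om u : u != 0 -> U u -> Om (kappa + u^-1).
Proof. by move=> u0; rewrite chartUE. Qed.

Let v_cont z : Om z -> cderiv v z (- v z ^+ 2).
Proof.
move=> Oz; have h := cderivD (cderiv_id z) (cderiv_cst (- kappa) z).
have z0 : z - kappa != 0 by rewrite -invr_eq0; exact: v_neq0.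
by apply: cderiv_eq (cderiv_comp h (cderivV z0)); rewrite addr0 mulr1.
Qed.

Section WithF.
Variables (F : C -> C) (r : R).
Hypotheses (r0 : 0 < r) (Qball : forall u, cabs u <= r -> Q.[u] != 0).
Hypothesis Gball : forall u w, cabs u <= r -> cabs w <= r -> cabs (G u - G w) <= cabs (u - w) / 2.
Hypotheses (F0 : F 0 = 0) (Fid : near_id r F) (Fn0 : forall u, U u -> u != 0 -> F u != 0).
Hypothesis FG : forall u, U u -> F (G u) = F u ^+ m.
Hypothesis Fder : forall u, U u -> exists D, cderiv F u D.
Let Phi z := F (v z).

Let Uball u : cabs u <= r -> U u.
Proof. exact: (chartU_ball fmonic fsize m1 r0 Qball Gball). Qed.

Let Fup u : cabs u <= r -> cabs (F u) <= 2 * cabs u.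
Proof.
by move=> ur; have := near_id_lip Fid ur (y := 0); rewrite F0 cabs0 !subr0; apply; exact: ltW.
Qed.

Let Flow u : cabs u <= r -> cabs u <= 2 * cabs (F u).
Proof.
by move=> ur; have := near_id_expand Fid ur (y := 0); rewrite F0 cabs0 !subr0; apply; exact: ltW.
Qed.

Let Fiter n u : U u -> F (iter n G u) = F u ^+ (m ^ n).
Proof.
move=> Uu; elim: n => [|n IH] //=.
by rewrite FG ?IH ?expnSr ?exprM //; exact: (iter_chartG_U fmonic fsize m1 fk).
Qed.

(** Some iterate of [u] is so close to 0 that |F| < 1 there, and the value of [F] at this iterate is
    a power of F u. *)
Let F_lt1 u : U u -> cabs (F u) < 1.
Proof.
move=> Uu; have e0 : 0 < Num.min r (1 / 2) by rewrite lt_min r0; lra.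
have [n] := chartU_reach fmonic fsize m1 fk e0 Uu.
rewrite lt_min => /andP[/ltW /Fup h1 h2]; rewrite Fiter // cabsX in h1.
rewrite ltNge; apply/negP => /(exprn_ege1 (m ^ n)); lra.
Qed.

(** Small values of [F] occur only near infinity; this makes injectivity on a disk into injectivity
    at level 0. Otherwise, just before the orbit enters the disk, z = kappa + 1/u and hence f z are
    bounded, so G u and then F (G u) are bounded below; but F (G u) is a power of F u and still
    small. *)
Let low_bound : exists s : R, [/\ 0 < s, s <= r / 2, s <= 1 & forall u, U u -> cabs (F u) < s -> cabs u <= r].
Proof.
have [B B0 hB] := poly_bounded f (r^-1 + cabs kappa).
have k0 := cabs_ge0 kappa.
pose M := B + cabs kappa + 1.
have M0 : 0 < M by rewrite /M; lra.
pose s := Num.min 1 (Num.min (r / 2) (M^-1 / 2)).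
have s0 : 0 < s by rewrite !lt_min ltr01 !divr_gt0 // invr_gt0.
have s1 : s <= 1 by rewrite ge_min lexx.
have s2 : s <= r / 2 by rewrite !ge_min lexx orbT.
have s3 : s <= M^-1 / 2 by rewrite !ge_min lexx !orbT.
exists s; split => // u Uu hs; rewrite leNgt; apply/negP => ru.
have [n hn] := chartU_reach fmonic fsize m1 fk r0 Uu.
elim: n u Uu hs ru hn => [|n IH] u Uu hs ru hn; first by move: hn => /=; lra.
have u0 : u != 0 by rewrite -cabs_gt0; apply: lt_trans ru.
have UG := chartG_U fmonic fsize m1 fk Uu.
have FGs : cabs (F (G u)) < s.
  rewrite FG // cabsX; apply: le_lt_trans hs; apply: ler_iXnr; rewrite ?cabs_ge0 //.
  exact/ltW/F_lt1.
have [Gr|Gr] := leP (cabs (G u)) r; last by apply: (IH (G u)) => //; rewrite -iterSr.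
have Oz := U_Om u0 Uu; set z := kappa + u^-1 in Oz.
have uz : u = v z by rewrite /z Kv.
have fz : cabs (f.[z] - kappa) <= M.
  apply: le_trans (cabsB _ _) _; rewrite /M -addrA lerD //; last lra.
  apply: hB; apply: le_trans (cabsD _ _) _; rewrite addrC lerD2r cabsV lef_pV2 ?posrE ?cabs_gt0 //.
  exact: ltW.
have Ofz : Om f.[z] by apply/basin_horner.
have fz0 : 0 < cabs (f.[z] - kappa) by rewrite cabs_gt0 -invr_eq0; exact: v_neq0.
have GM : M^-1 <= cabs (G u) by rewrite uz v_f // /v cabsV lef_pV2 ?posrE.
by have := Flow Gr; lra.
Qed.

Let Om_f z : Om f.[z] <-> Om z. Proof. exact: basin_horner. Qed.
Let Phi0 z : Om z -> Phi z != 0. Proof. by move=> Oz; apply: Fn0; [exact: v_U|exact: v_neq0]. Qed.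
Let Phi1 z : Om z -> cabs (Phi z) < 1. Proof. by move=> Oz; apply: F_lt1; exact: v_U. Qed.
Let Phi_f z : Om z -> Phi f.[z] = Phi z ^+ m.
Proof. by move=> Oz; rewrite /Phi -v_f // FG //; exact: v_U. Qed.

Let Phi_der z : Om z -> exists D, cderiv Phi z D.
Proof.
move=> Oz; have [D hD] := Fder (v_U Oz).
by eexists; exact: (cderiv_comp (v_cont Oz) hD).
Qed.

Let Phi_cont z : Om z -> ccont Phi z.
Proof. by move=> /Phi_der[D hD]; exact: cderiv_cont hD. Qed.

Let semiconj_base : exists s : R, [/\ 0 < s, s <= 1,
  forall z, z != 0 -> cabs z ^+ (m ^ 0) < s -> exists2 w, Om w & Phi w = z,
  forall w w', Om w -> Om w' -> cabs (Phi w) ^+ (m ^ 0) < s -> Phi w = Phi w' -> w = w' &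
  forall w, Om w -> cabs (Phi w) ^+ (m ^ 0) < s -> forall e : R, 0 < e -> exists2 d : R, 0 < d &
    forall z, cabs (z - Phi w) < d -> exists2 w', Om w' & cabs (w' - w) < e /\ Phi w' = z].
Proof.
have [s [s0 s2 s1 hs]] := low_bound.
exists s; rewrite expn0; split => //.
- move=> z z0; rewrite expr1 => zs.
  have [|x xz Fx] := near_id_surj (w := z) r0 F0 Fid; first by lra.
  have x0 : x != 0 by apply/eqP => x0; move: z0; rewrite -Fx x0 F0 eqxx.
  exists (kappa + x^-1); last by rewrite /Phi Kv.
  by apply: U_Om => //; apply: Uball; lra.
- move=> w w' Ow Ow'; rewrite expr1 => ws e.
  have h1 := hs _ (v_U Ow) ws; have := ws; rewrite e => ws'.
  have h2 := hs _ (v_U Ow') ws'.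
  by rewrite -(vK w) -(vK w') (near_id_inj Fid h1 h2 e).
- move=> w Ow; rewrite expr1 => ws e e0.
  have h1 := hs _ (v_U Ow) ws.
  have ic := cderivD (cderiv_cst kappa (v w)) (cderivV (v_neq0 Ow)).
  have [d1 d10 hd1] := cderiv_cont ic e0; rewrite vK in hd1.
  have P0 : 0 < cabs (Phi w) by rewrite cabs_gt0 Phi0.
  exists (Num.min (d1 / 2) (Num.min (s - cabs (Phi w)) (cabs (Phi w)))).
    by rewrite !lt_min P0 subr_gt0 ws divr_gt0.
  move=> z; rewrite !lt_min => /andP[z1 /andP[z2 z3]].
  have zs : cabs z < s by have := cabs_le_sub z (Phi w); lra.
  have z0 : z != 0 by apply/eqP => z0; move: z3; rewrite z0 sub0r cabsN ltxx.
  have [|x xz Fx] := near_id_surj (w := z) r0 F0 Fid; first by lra.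
  have x0 : x != 0 by apply/eqP => x0; move: z0; rewrite -Fx x0 F0 eqxx.
  have xr : cabs x <= r by lra.
  exists (kappa + x^-1); first by apply: U_Om => //; exact: Uball.
  split; last by rewrite /Phi Kv.
  by apply: hd1; have := near_id_expand Fid xr h1; rewrite Fx -/(Phi w); lra.
Qed.

Let Fhat (w : Chat R) : C := if w is Some z then Phi z else 0.

Let Phi_surj z : z != 0 -> cabs z < 1 -> exists2 w, Om w & Phi w = z.
Proof.
have [s [s0 s1 h1 h2 h3]] := semiconj_base.
exact: (semiconj_surj fmonic fsize m1 Om_f Phi0 Phi_f Phi_cont s0 s1 h1 h2 h3).
Qed.

Let Phi_inj w w' : Om w -> Om w' -> Phi w = Phi w' -> w = w'.
Proof.
have [s [s0 s1 h1 h2 h3]] := semiconj_base.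
exact: (semiconj_inj fmonic fsize m1 Om_f Phi0 Phi1 Phi_f Phi_cont s0 s1 h1 h2 h3).
Qed.

Let biholo : biholomorphic_onto_disk (basin f) Fhat.
Proof.
split; first by move=> [z|] // Oz /=; [exact: Phi1|rewrite cabs0].
split.
  move=> [z|] [z'|] // Oz Oz' /= e; first by rewrite (Phi_inj Oz Oz' e).
    by move: (Phi0 Oz); rewrite e eqxx.
  by move: (Phi0 Oz'); rewrite -e eqxx.
split.
  move=> u u1; have [->|u0] := eqVneq u 0; first by exists None.
  by have [z Oz <-] := Phi_surj u0 u1; exists (Some z).
split.
  by move=> z Oz; have [D hD] := Phi_der Oz; have [] := cderiv_derivable hD.
move=> _.
have U0 := chartU0 f kappa.
have [D hD] := Fder U0.
(* Around infinity the map is u |-> F (u / (1 - kappa u)), since 1 / (1/u - kappa) = u / (1 - kappa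
   u). *)
have h10 : 1 - kappa * 0 != 0 :> C by rewrite mulr0 subr0 oner_neq0.
have g1 : cderiv (fun u => 1 - kappa * u) 0 (- kappa).
  have := cderivD (cderiv_cst 1 0) (cderivM (cderiv_cst (- kappa) 0) (cderiv_id 0)).
  rewrite mul0r !add0r mulr1; apply: (@cderiv_ext _ _ _ _ _ 1) => // w _.
  by rewrite mulNr.
have g2 := cderivM (cderiv_id 0) (cderiv_comp g1 (cderivV h10)).
have hD' : cderiv F (0 * (1 - kappa * 0)^-1) D by rewrite mul0r.
have g3 := cderiv_comp g2 hD'.
have k1 : 0 < cabs kappa + 1 by have := cabs_ge0 kappa; lra.
have e10 : 0 < (cabs kappa + 1)^-1 by rewrite invr_gt0.
have := cderiv_ext e10 _ g3 => /(_ (fun u => if u == 0 then Fhat None else Fhat (Some u^-1))) h.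
apply: (cderiv_derivable (h _)).1 => w; rewrite subr0 => hw.
case: eqVneq => [->|w0] /=; first by rewrite mul0r F0.
rewrite /Phi /v; congr F.
have q0 : 1 - kappa * w != 0.
  apply/eqP => /eqP; rewrite subr_eq0 => /eqP e.
  have : cabs kappa * cabs w = 1 by rewrite -cabsM -e cabs1.
  move: hw; rewrite -[(cabs kappa + 1)^-1]div1r ltr_pdivlMr // => hw.
  by have := cabs_ge0 w; lra.
have -> : w^-1 - kappa = (1 - kappa * w) / w by field.
by rewrite invf_div.
Qed.

(** The outer estimates are those of [F] near 0 in the coordinate u = 1 / (z - kappa): the Lipschitz
    constant 2 of [F] and of its inverse bounds the derivative and |Psi|, and the contraction of [G]
    doubles the distance to kappa. *)
Lemma uniformization_aux : exists (Psi : C -> C) (Rad : R),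
  [/\ biholomorphic_onto_disk (basin f) (fun w => if w is Some z then Psi z else 0),
      forall z, Om z -> [/\ Psi z != 0, cabs (Psi z) < 1, Psi f.[z] = Psi z ^+ m,
        cderiv Psi z (derive1 Psi z) & (f^`()).[z] != 0],
      0 < Rad &
      forall z, Rad < cabs (z - kappa) -> [/\ Om z, 2 * cabs (z - kappa) <= cabs (f.[z] - kappa),
        cabs (derive1 Psi z) <= 2 / cabs (z - kappa) ^+ 2 & 1 / (2 * cabs (z - kappa)) <= cabs (Psi z)]].
Proof.
exists Phi, r^-1.
have dP z : Om z -> cderiv Phi z (derive1 Phi z).
  by move=> Oz; have [D hD] := Phi_der Oz; have [_ ->] := cderiv_derivable hD.
split=> //; first move=> z Oz.
- split; [exact: Phi0|exact: Phi1|exact: Phi_f|exact: dP|].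
  have [s [s0 s1 h1 h2 h3]] := semiconj_base.
  exact: (semiconj_noncrit fmonic fsize m1 Om_f Phi0 Phi1 Phi_f Phi_cont s0 s1 h1 h2 h3).
- by rewrite invr_gt0.
- move=> z hz.
  have z0 : 0 < cabs (z - kappa) by apply: lt_trans hz; rewrite invr_gt0.
  have vr : cabs (v z) < r by rewrite /v cabsV -[ltRHS]invrK ltf_pV2 // posrE invr_gt0.
  have vz0 : v z != 0 by rewrite /v invr_eq0 -cabs_gt0.
  have Oz : Om z by rewrite -(vK z); apply: U_Om => //; apply: Uball; exact: ltW.
  have zE : cabs (v z) = (cabs (z - kappa))^-1 by rewrite /v cabsV.
  have vz : cabs (v z) <= r := ltW vr.
  split => //.
  + have := chartG_half m1 r0 Gball vz; rewrite v_f // /v !cabsV => h.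
    have fz0 : 0 < cabs (f.[z] - kappa).
      by rewrite cabs_gt0 -invr_eq0; apply: v_neq0; apply/Om_f.
    have : (cabs (f.[z] - kappa))^-1 <= (2 * cabs (z - kappa))^-1 by rewrite invfM mulrC.
    by rewrite lef_pV2 // posrE mulr_gt0.
  + have [D hD] := Fder (v_U Oz).
    have [_ ->] := cderiv_derivable (cderiv_comp (v_cont Oz) hD).
    rewrite cabsM cabsN cabsX zE exprVn ler_wpM2r ?invr_ge0 ?exprn_ge0 ?cabs_ge0 //.
    have rv : 0 < r - cabs (v z) by lra.
    apply: (cderiv_bound rv hD) => w hw; apply: (near_id_lip Fid) => //.
    by have := cabs_le_sub w (v z); lra.
  + have := Flow vz; rewrite zE -/(Phi z) => h.
    rewrite div1r invfM mulrC ler_pdivrMr // mulrC; exact: h.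
Qed.

End WithF.

Lemma basin_uniformization : exists (Psi : C -> C) (Rad : R),
  [/\ biholomorphic_onto_disk (basin f) (fun w => if w is Some z then Psi z else 0),
      forall z, Om z -> [/\ Psi z != 0, cabs (Psi z) < 1, Psi f.[z] = Psi z ^+ m,
        cderiv Psi z (derive1 Psi z) & (f^`()).[z] != 0],
      0 < Rad &
      forall z, Rad < cabs (z - kappa) -> [/\ Om z, 2 * cabs (z - kappa) <= cabs (f.[z] - kappa),
        cabs (derive1 Psi z) <= 2 / cabs (z - kappa) ^+ 2 & 1 / (2 * cabs (z - kappa)) <= cabs (Psi z)]].
Proof.
have [F [r [/andP[r0 r1] [Qb Gb] [F0 Fid Fn0] FG Fder]]] := boettcher_exists fmonic fsize m1 fk sc.
exact: (uniformization_aux r0 Qb Gb F0 Fid Fn0 FG Fder).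
Qed.
End Uniformization.

(** * Numerical inequalities for the transfer operator *)

Section RealInequalities.
Context {R : realType}.

Lemma pow_le (n : nat) (a b : R) : 0 <= a -> a <= b -> a ^+ n <= b ^+ n.
Proof. by move=> a0 ab; apply: lerXn2r => //; rewrite nnegrE //; exact: le_trans ab. Qed.

Lemma sum_le_size (T : eqType) (s : seq T) (F : T -> R) (B : R) :
  (forall w, w \in s -> F w <= B) -> \sum_(w <- s) F w <= (size s)%:R * B.
Proof.
elim: s => [|x s IH] h; first by rewrite big_nil mul0r.
rewrite big_cons /= -natr1 mulrDl mul1r addrC lerD ?h ?mem_head //.
by apply: IH => w ws; rewrite h // inE ws orbT.
Qed.

Lemma pow_le_1D (q : R) (k n : nat) : 0 <= q -> (k <= n)%N -> q ^+ k <= 1 + q ^+ n.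
Proof.
move=> q0 kn; have h0 := exprn_ge0 n q0; have [q1|q1] := leP q 1.
  by have := exprn_ile1 k q0 q1; lra.
have : q ^+ k <= q ^+ n by rewrite ler_weXn2l // ltW.
lra.
Qed.

(** For M = m and s = |w|^(m-1) the left side is a bound for |f' w|^2, which is compared with the
    value m^2 s^2 of the unperturbed map. *)
Lemma deriv_ineq (M e s p : R) : 3 <= M -> 0 <= e -> e <= 1 / 1000 -> 0 <= s -> s ^+ 2 <= p ->
  ((M + e) * s + e) ^+ 2 <= M ^+ 2 * (p + 4 * e * (1 + p)).
Proof.
move=> M3 e0 e1 s0 sp.
have p0 : 0 <= p by apply: le_trans sp; exact: sqr_ge0.
have s2 : s <= 1 + p by have := sqr_ge0 (s - 1); rewrite sqrrB; lra.
have -> : ((M + e) * s + e) ^+ 2 = M ^+ 2 * s ^+ 2 + e * ((2 * M + e) * s ^+ 2 + 2 * (M + e) * s + e) by ring.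
rewrite [leRHS]mulrDr lerD //; first by rewrite ler_wpM2l ?sqr_ge0.
have -> : M ^+ 2 * (4 * e * (1 + p)) = e * (M ^+ 2 * 4 * (1 + p)) by ring.
rewrite ler_wpM2l //.
have b1 : (2 * M + e) * s ^+ 2 <= (2 * M + 1) * (1 + p) by rewrite ler_pM ?sqr_ge0 //; lra.
have b2 : 2 * (M + e) * s <= 2 * (M + 1) * (1 + p) by rewrite ler_pM //; lra.
have M4 : 4 * M + 4 <= M ^+ 2 * 4 by rewrite expr2; nra.
have b3 : (4 * M + 4) * (1 + p) <= M ^+ 2 * 4 * (1 + p) by rewrite ler_wpM2r //; lra.
apply: le_trans b3; move: b1 b2 => b1 b2.
apply: le_trans (lerD (lerD b1 b2) (lexx e)) _; lra.
Qed.

(* The weight |w - c|^2 + 1 reduces the bound m^4 on the spectral radius of the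
   transfer operator of z^m + c at exponent 2 to this inequality, where
   q = |w|^2 and 31/10 bounds |c|^2 + 1. *)
Lemma transfer_ineq (m : nat) (q : R) : (3 <= m)%N -> 0 <= q ->
  q ^+ m + 31 / 10 * q ^+ m.-1 <= 9 / 10 * m%:R * (q ^+ m + 1).
Proof.
case: m => [|[|[|[|[|m]]]]] // _ q0 /=.
(* For m = 3 the difference of the sides is 17/10 q^3 - 31/10 q^2 + 27/10, with critical point
   62/51. The product is this cubic less its value there: a double root times the cofactor 17/10 q +
   31/30. *)
- have := mulr_ge0 (sqr_ge0 (q - 62 / 51)) (addr_ge0 (mulr_ge0 (ltW (divr_gt0 (ltr0n R 17) (ltr0n R 10))) q0) (ltW (divr_gt0 (ltr0n R 31) (ltr0n R 30)))).
  rewrite !exprS expr0; lra.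
- have : 0 <= (q - 1) ^+ 2 * (3 * q ^+ 2 + 2 * q + 1).
    by rewrite mulr_ge0 ?sqr_ge0 //; have := sqr_ge0 q; lra.
  have := exprn_ge0 4 q0; rewrite !exprS expr0; lra.
- have h := pow_le_1D q0 (leqnSn m.+4); have h0 := exprn_ge0 m.+4.+1 q0.
  have : 5%:R <= (m.+4.+1)%:R :> R by rewrite ler_nat.
  move=> h5; have : 9 / 10 * 5%:R * (q ^+ m.+4.+1 + 1) <= 9 / 10 * (m.+4.+1)%:R * (q ^+ m.+4.+1 + 1).
    by rewrite ler_wpM2r //; lra.
  lra.
Qed.

(** With [K] for |c|^2, the perturbation costs a term 41 e (1 + q^m) and a factor 1 + 4 e. As e <=
    1/1000 and m >= 3, these raise 9/10 to at most 92/100 and then to at most 19/20. *)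
Lemma transfer_ineq_perturbed (m : nat) (q e K : R) : (3 <= m)%N -> 0 <= q -> 0 <= e <= 1 / 1000 ->
  0 <= K <= 21 / 10 ->
  (q ^+ m.-1 + 4 * e * (1 + q ^+ m.-1)) * (q + K + 1 + e) * (1 + 4 * e) <=
  19 / 20 * m%:R * (q ^+ m + 1).
Proof.
move=> m3 q0 /andP[e0 e1] /andP[K0 K1].
have h := transfer_ineq m3 q0.
have hm : (3 : R) <= m%:R by rewrite ler_nat.
set p := q ^+ m.-1 in h *; set Y := q ^+ m in h *.
have pq : p * q = Y by rewrite /p -exprSr prednK //; case: (m) m3.
have p0 : 0 <= p by exact: exprn_ge0.
have Y0 : 0 <= Y by exact: exprn_ge0.
have pY : p <= 1 + Y by apply: pow_le_1D => //; exact: leq_pred.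
have qY : q <= 1 + Y by rewrite -{1}[q]expr1; apply: pow_le_1D => //; case: (m) m3.
have i1 : (p + 4 * e * (1 + p)) * (q + K + 1 + e) <= p * q + 31 / 10 * p + 41 * e * (1 + Y).
  have j1 : (p + 4 * e * (1 + p)) * (q + K + 1 + e) <= (p + 4 * e * (1 + p)) * (q + 31 / 10 + e).
    by rewrite ler_wpM2l //; nra.
  have j2 : (1 + p) * (q + 31 / 10 + e) <= 37 / 4 + 25 / 4 * Y.
    have : p * e <= p * (1 / 1000) by rewrite ler_wpM2l.
    lra.
  have j3 : 4 * e * ((1 + p) * (q + 31 / 10 + e)) <= 4 * e * (37 / 4 + 25 / 4 * Y).
    by rewrite ler_wpM2l // mulr_ge0.
  have j4 : e * p <= e * (1 + Y) by rewrite ler_wpM2l.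
  have j5 : 0 <= e * Y by rewrite mulr_ge0.
  lra.
have i2 : p * q + 31 / 10 * p <= 9 / 10 * m%:R * (Y + 1) by rewrite pq.
move=> {h pq pY qY K0 K1}.
have i3 : 41 * e * (1 + Y) <= 41 / 1000 * (1 + Y) by rewrite ler_wpM2r //; lra.
have i4 : 41 / 1000 * (1 + Y) <= 41 / 3000 * m%:R * (1 + Y) by rewrite ler_wpM2r //; lra.
have mY : 0 <= m%:R * (Y + 1) by rewrite mulr_ge0 // addr_ge0.
have i5 : (p + 4 * e * (1 + p)) * (q + K + 1 + e) <= 92 / 100 * m%:R * (Y + 1) by lra.
move=> {i2 i3 i4}.
apply: (@le_trans _ _ (92 / 100 * m%:R * (Y + 1) * (1 + 4 * e))).
  by rewrite ler_wpM2r //; move=> {i5}; lra.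
move=> {i5}.
have : 92 / 100 * m%:R * (Y + 1) * (1 + 4 * e) <= 92 / 100 * m%:R * (Y + 1) * (1 + 4 / 1000).
  by rewrite ler_wpM2l //; lra.
lra.
Qed.

End RealInequalities.

(** * A supersolution of the transfer operator *)

Section TransferOperator.
Context {R : realType}.
Local Notation C := (Cplx R).
Variables (f : {poly C}) (m : nat) (c : C) (e : R).
Hypotheses (fmonic : f \is monic) (fsize : size f = m.+1) (m3 : (3 <= m)%N).
Hypotheses (e0 : 0 <= e) (e1 : e <= 1 / 1000).
Hypothesis f_near : forall w, cabs (f.[w] - w ^+ m - c) <= e * (1 + cabs w ^+ m).
Hypothesis f'_near : forall w, cabs ((f^`()).[w] - m%:R * w ^+ m.-1) <= e * (1 + cabs w ^+ m.-1).
Hypothesis sum_preims : forall z, cabs (\sum_(w <- preims f z) w) <= e.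
Let m0 : (0 < m)%N. Proof. by case: (m) m3. Qed.
Let hm : (3 : R) <= m%:R. Proof. by rewrite ler_nat. Qed.

Let iter_escape z (t : R) : 0 < t -> (forall w, t <= cabs w -> 101 / 100 * cabs w <= cabs f.[w]) ->
  t <= cabs z -> basin f (Some z).
Proof.
move=> t0 hf tz M.
have h n : t <= cabs (iter n (horner f) z) /\ t * (101 / 100) ^+ n <= cabs (iter n (horner f) z).
  elim: n => [|n [h1 h2]]; first by rewrite expr0 mulr1.
  by have := hf _ h1; rewrite /= exprS; split; lra.
have q01 : 0 <= (100 / 101 : R) < 1 by lra.
have M1 : 0 < `|M| + 1 by have := normr_ge0 M; lra.
have [N hN] := geo_small q01 (divr_gt0 t0 M1).
exists N => n nN; apply: lt_le_trans (h n).2.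
have : (100 / 101 : R) ^+ n <= (100 / 101) ^+ N by apply: ler_wiXn2l => //; lra.
move=> h1; have {h1 hN} : (100 / 101 : R) ^+ n < t / (`|M| + 1) by lra.
rewrite ltr_pdivlMr //.
have -> : (100 / 101 : R) ^+ n = ((101 / 100) ^+ n)^-1 by rewrite -exprVn; congr (_ ^+ _); field.
have p0 : 0 < (101 / 100 : R) ^+ n by apply: exprn_gt0; lra.
by rewrite mulrC ltr_pdivrMr //; have := ler_norm M; lra.
Qed.

(** A critical point satisfies |w|^(m-1) <= e, so |f w| is at least |c| - 3 e. For larger |c| every
    point of at least this modulus escapes, and the critical point would lie in the basin. *)
Lemma center_bound : (forall w, basin f (Some w) -> (f^`()).[w] != 0) -> cabs c ^+ 2 <= 21 / 10.
Proof.
have e0' := e0; have e1' := e1; have hm' := hm.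
move=> ncrit; rewrite leNgt; apply/negP => hc.
have c0 := cabs_ge0 c.
(* The square of 1.449 is below 2.1, while 1.446, what remains after losing 3 e, still has square
   above 2.09. There |z|^m >= 2.09 |z|, and subtracting |c| <= |z| + 3 e and the perturbation leaves
   at least 1.01 |z|. *)
have c1 : 1449 / 1000 <= cabs c.
  rewrite leNgt; apply/negP => h.
  have := pow_le 2 c0 (ltW h); move: hc; set d := cabs c ^+ 2; rewrite expr2; lra.
have [w hw] : exists w, (f^`()).[w] = 0.
  have : size f^`() != 1%N.
    apply/eqP => s1; have : (f^`())`_m.-1 = 0 by rewrite nth_default // s1; case: (m) m3 => [|[]].
    rewrite coef_deriv prednK // (_ : f`_m = 1); last by have /monicP := fmonic; rewrite lead_coefE fsize.
    by move/eqP; rewrite pnatr_eq0 (gtn_eqF m0).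
  by case/closed_rootP => w; rewrite rootE => /eqP; exists w.
have := f'_near w; rewrite hw sub0r cabsN cabsM cabs_nat cabsX.
set s := cabs w ^+ m.-1 => hs.
have s0 : 0 <= s by rewrite exprn_ge0 ?cabs_ge0.
have se : s <= e by nra.
have w1 : cabs w <= 1.
  rewrite leNgt; apply/negP => h; have : 1 <= s by apply: exprn_ege1; exact: ltW.
  lra.
have wm : cabs w ^+ m <= e.
  rewrite -(prednK m0) exprSr; apply: le_trans se; rewrite ler_piMr //.
have fw : cabs c - 3 * e <= cabs f.[w].
  have := f_near w.
  have := cabsB (w ^+ m) (f.[w] - c); rewrite cabsX.
  have := cabs_le_sub c (c - f.[w]).
  rewrite (_ : c - (c - f.[w]) = f.[w]); last by ring.
  rewrite [cabs (c - f.[w])]cabsBC.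
  have := cabsD (f.[w] - w ^+ m - c) (w ^+ m).
  rewrite (_ : f.[w] - w ^+ m - c + w ^+ m = f.[w] - c); last by ring.
  rewrite cabsX; nra.
suff : basin f (Some w) by move=> /ncrit; rewrite hw eqxx.
apply/basin_horner; apply: (@iter_escape _ (cabs c - 3 * e)) => //; first by lra.
move=> z hz; set t := cabs z in hz *.
have t1 : 1446 / 1000 <= t by lra.
have tm : 209 / 100 * t <= t ^+ m.
  have -> : m = (m - 3 + 3)%N by rewrite subnK.
  rewrite exprD; have : 1 <= t ^+ (m - 3) by apply: exprn_ege1; lra.
  have : 209 / 100 * t <= t ^+ 3 by rewrite !exprS expr0; nra.
  by move=> h1 h2; have := ler_pM ler01 (ltW (lt_le_trans _ h1)) h2 (lexx (t ^+ 3)); nra.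
have := f_near z; rewrite -/t => h.
have := cabsD (f.[z]) (- (f.[z] - z ^+ m - c) - c).
rewrite (_ : f.[z] + (- (f.[z] - z ^+ m - c) - c) = z ^+ m); last by ring.
have := cabsB (- (f.[z] - z ^+ m - c)) c; rewrite !cabsN cabsX -/t.
have tm' : e * t ^+ m <= 1 / 1000 * t ^+ m by rewrite ler_wpM2r // exprn_ge0 // /t cabs_ge0.
nra.
Qed.

Lemma Re_mulD (a b d : C) : complex.Re ((a + b) * d) = complex.Re (a * d) + complex.Re (b * d).
Proof. by rewrite mulrDl; case: (a * d) (b * d) => x y [x' y']. Qed.

Lemma cabs_sub_sqr (w z : C) : cabs (w - z) ^+ 2 =
  cabs w ^+ 2 + cabs z ^+ 2 - 2 * complex.Re (w * (z^*)%C).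
Proof.
case: w z => a b [x y]; rewrite !cabs_sqr ReB ImB.
rewrite -[in RHS]/(Complex (a * x - b * - y) _) /=; ring.
Qed.

(** For z^m + c all preimages have the same |w|^2 = q, with q^m = |z - c|^2, and they sum to 0, so
    the cross terms in |w - c|^2 cancel. Both sides then depend on q alone: m^3 q^(m-1) (q + |c|^2 +
    1) against a multiple of m^4 (q^m + 1). The weight is made for this; a constant weight fails for
    large z. *)
Lemma transfer_bound z : cabs c ^+ 2 <= 21 / 10 ->
  \sum_(w <- preims f z) cabs (f^`()).[w] ^+ 2 * (cabs (w - c) ^+ 2 + 1) <=
  19 / 20 * m%:R ^+ 4 * (cabs (z - c) ^+ 2 + 1).
Proof.
have e0' := e0; have e1' := e1; have hm' := hm.
move=> hc; set T := cabs (z - c).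
have T0 : 0 <= T by exact: cabs_ge0.
have c0 := cabs_ge0 c.
have c1 : cabs c <= 3 / 2.
  rewrite leNgt; apply/negP => h.
  have h0 : 0 <= (3 / 2 : R) by lra.
  have := pow_le 2 h0 (ltW h); move: hc; set d := cabs c ^+ 2; rewrite expr2; lra.
(* Solving |w|^m <= T + e (1 + |w|^m) for |w|^m gives this bound for |w|^(2m). *)
pose X := ((T + e) / (1 - e)) ^+ 2.
have hX : X + 1 <= (1 + 4 * e) * (T ^+ 2 + 1).
  have e1m : 0 < (1 - e) ^+ 2 by rewrite exprn_gt0 //; lra.
  rewrite -lerBrDr /X expr_div_n ler_pdivrMr //.
  have T2 : 2 * T <= T ^+ 2 + 1 by have := sqr_ge0 (T - 1); rewrite sqrrB; lra.
  have a1 : (T + e) ^+ 2 <= (1 + e) * T ^+ 2 + e + e ^+ 2.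
    by rewrite sqrrD; have : e * (2 * T) <= e * (T ^+ 2 + 1); [rewrite ler_wpM2l|lra].
  have a2 : 1 + e <= (1 + 4 * e) * (1 - e) ^+ 2 by rewrite !exprS expr0; nra.
  have a3 : e + e ^+ 2 <= 4 * e * (1 - e) ^+ 2 by rewrite !exprS expr0; nra.
  have a4 : (1 + e) * T ^+ 2 <= (1 + 4 * e) * (1 - e) ^+ 2 * T ^+ 2 by rewrite ler_wpM2r ?sqr_ge0.
  lra.
have wX w : w \in preims f z -> (cabs w ^+ 2) ^+ m <= X.
  rewrite (mem_preims fmonic fsize) // => /eqP fw.
  have wm : cabs w ^+ m * (1 - e) <= T + e.
    have := f_near w; rewrite fw => h.
    have := cabsB (z - c) (z - w ^+ m - c).
    rewrite (_ : _ - (_ - _) = w ^+ m); last by ring.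
    by rewrite cabsX -/T; lra.
  rewrite exprAC /X; apply: pow_le; first by rewrite exprn_ge0 ?cabs_ge0.
  by rewrite ler_pdivlMr //; lra.
(* The preimages no longer have equal moduli; the largest |w|^2 serves for all of them, as the
   bounds used are increasing in it. *)
have [q [q0 qX qw]] : exists q : R, [/\ 0 <= q, q ^+ m <= X & forall w, w \in preims f z -> cabs w ^+ 2 <= q].
  have X0 : 0 <= X by exact: sqr_ge0.
  elim: (preims f z) wX => [|w s IH] hs.
    by exists 0; split => //; rewrite expr0n (gtn_eqF m0).
  have [|q [q0 qX qw]] := IH; first by move=> y ys; apply: hs; rewrite inE ys orbT.
  exists (Num.max q (cabs w ^+ 2)); split; first by rewrite le_max q0.
    by case: (leP q (cabs w ^+ 2)) => _ //; apply: hs; rewrite mem_head.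
  by move=> y; rewrite inE le_max => /orP[/eqP ->|/qw ->//]; rewrite lexx orbT.
pose p := q ^+ m.-1.
have p0 : 0 <= p by exact: exprn_ge0.
have dw w : w \in preims f z -> cabs (f^`()).[w] ^+ 2 <= m%:R ^+ 2 * (p + 4 * e * (1 + p)).
  move=> /qw hw; have := f'_near w.
  set s := cabs w ^+ m.-1 => hs.
  have s0 : 0 <= s by rewrite exprn_ge0 ?cabs_ge0.
  have sp : s ^+ 2 <= p by rewrite /s exprAC; apply: pow_le => //; exact: sqr_ge0.
  have ds : cabs (f^`()).[w] <= (m%:R + e) * s + e.
    have := cabsD ((f^`()).[w] - m%:R * w ^+ m.-1) (m%:R * w ^+ m.-1).
    by rewrite subrK cabsM cabs_nat cabsX -/s; lra.
  have : cabs (f^`()).[w] ^+ 2 <= ((m%:R + e) * s + e) ^+ 2.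
    by apply: pow_le => //; exact: cabs_ge0.
  move=> /le_trans; apply.
  exact: deriv_ineq.
have sumb : \sum_(w <- preims f z) (cabs (w - c) ^+ 2 + 1) <= m%:R * (q + cabs c ^+ 2 + 1 + e).
  (* The cross terms collapse to the sum of the preimages, whose modulus is at most [e]. *)
  have -> : \sum_(w <- preims f z) (cabs (w - c) ^+ 2 + 1) =
      \sum_(w <- preims f z) (cabs w ^+ 2 + cabs c ^+ 2 + 1) - 2 * complex.Re ((\sum_(w <- preims f z) w) * (c^*)%C).
    elim: (preims f z) => [|w s IH]; first by rewrite !big_nil mul0r /= mulr0 subrr.
    rewrite !big_cons IH cabs_sub_sqr Re_mulD; ring.
  have h1 : \sum_(w <- preims f z) (cabs w ^+ 2 + cabs c ^+ 2 + 1) <= m%:R * (q + cabs c ^+ 2 + 1).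
    rewrite -(size_preims fmonic fsize m0 z); apply: sum_le_size => w ws.
    by have := qw _ ws; lra.
  have h2 : - complex.Re ((\sum_(w <- preims f z) w) * (c^*)%C) <= e * cabs c.
    apply: le_trans (ler_norm _) _; rewrite normrN; apply: le_trans (cabs_Re _) _.
    rewrite cabsM ler_pM ?cabs_ge0 ?sum_preims //.
    by rewrite /cabs; case: (c) => a b /=; rewrite sqrrN.
  have h3 : 2 * (e * cabs c) <= m%:R * e by have : e * cabs c <= e * (3 / 2); [rewrite ler_wpM2l|]; nra.
  lra.
apply: (@le_trans _ _ (m%:R ^+ 2 * (p + 4 * e * (1 + p)) * (m%:R * (q + cabs c ^+ 2 + 1 + e)))).
  apply: (@le_trans _ _ (\sum_(w <- preims f z) m%:R ^+ 2 * (p + 4 * e * (1 + p)) * (cabs (w - c) ^+ 2 + 1))).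
    rewrite big_seq [leRHS]big_seq; apply: ler_sum => w ws.
    by rewrite ler_wpM2r ?dw //; have := sqr_ge0 (cabs (w - c)); lra.
  rewrite -mulr_sumr ler_wpM2l // mulr_ge0 ?sqr_ge0 //.
  by have : 0 <= e * (1 + p) by [rewrite mulr_ge0 //; lra]; lra.
have hE : 0 <= e <= 1 / 1000 by rewrite e0 e1.
have hK : 0 <= cabs c ^+ 2 <= 21 / 10 by rewrite sqr_ge0.
have := transfer_ineq_perturbed m3 q0 hE hK; rewrite -/p => key.
have e41 : 0 < 1 + 4 * e by lra.
have qX1 : q ^+ m + 1 <= (1 + 4 * e) * (T ^+ 2 + 1) by lra.
rewrite -(ler_pM2r e41).
have m30 : 0 <= (m%:R : R) ^+ 3 by rewrite exprn_ge0.
have k1 : m%:R ^+ 3 * ((p + 4 * e * (1 + p)) * (q + cabs c ^+ 2 + 1 + e) * (1 + 4 * e)) <= m%:R ^+ 3 * (19 / 20 * m%:R * (q ^+ m + 1)).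
  by rewrite ler_wpM2l.
have k2 : m%:R ^+ 3 * (19 / 20 * m%:R) * (q ^+ m + 1) <= m%:R ^+ 3 * (19 / 20 * m%:R) * ((1 + 4 * e) * (T ^+ 2 + 1)).
  by rewrite ler_wpM2l // !mulr_ge0 //; lra.
have -> : m%:R ^+ 2 * (p + 4 * e * (1 + p)) * (m%:R * (q + cabs c ^+ 2 + 1 + e)) * (1 + 4 * e) =
  m%:R ^+ 3 * ((p + 4 * e * (1 + p)) * (q + cabs c ^+ 2 + 1 + e) * (1 + 4 * e)) by ring.
apply: le_trans k1 _.
have -> : 19 / 20 * m%:R ^+ 4 * (T ^+ 2 + 1) * (1 + 4 * e) = m%:R ^+ 3 * (19 / 20 * m%:R) * ((1 + 4 * e) * (T ^+ 2 + 1)) by ring.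
by apply: le_trans k2; rewrite le_eqVlt; apply/orP; left; apply/eqP; ring.
Qed.

End TransferOperator.

(** * Polynomials close to z^m + c *)

Section NearUnicritical.
Context {R : realType}.
Local Notation C := (Cplx R).
Variables (m : nat) (a : nat -> C).
Hypothesis m3 : (3 <= m)%N.

Definition monic_poly : {poly C} := 'X^m + \sum_(k < m) a k *: 'X^k.
Local Notation f := monic_poly.

Lemma monic_poly_horner : horner f = monic_poly_fun m a.
Proof.
apply/funext => z; rewrite /f /monic_poly_fun !hornerE horner_sum; congr (_ + _).
by apply: eq_bigr => k _; rewrite !hornerE.
Qed.

Let low_size : (size (\sum_(k < m) a k *: 'X^k : {poly C})%R < size ('X^m : {poly C}))%N.
Proof.
rewrite size_polyXn ltnS; apply: leq_trans (size_sum _ _ _) _; apply/bigmax_leqP => k _.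
by apply: leq_trans (size_scale_leq _ _) _; rewrite size_polyXn.
Qed.

Lemma monic_poly_size : size f = m.+1.
Proof. by rewrite /f size_polyDl // size_polyXn. Qed.

Lemma monic_poly_monic : f \is monic.
Proof. by rewrite monicE /f lead_coefDl // lead_coefXn. Qed.

Lemma monic_poly_coef k : (k < m)%N -> f`_k = a k.
Proof.
move=> km; rewrite /f coefD coefXn (ltn_eqF km) add0r coef_sum (bigD1 (Ordinal km)) //= big1 ?addr0.
  by rewrite coefZ coefXn eqxx mulr1.
by move=> i ik; rewrite coefZ coefXn; case: eqP => [e|]; rewrite ?mulr0 //; move: ik; rewrite -val_eqE /= e eqxx.
Qed.

Variable e : R.
Hypothesis e0 : 0 < e.
(** The derivative has fewer than m perturbing terms, each carrying a factor k < m; hence the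
    square. *)
Let d : R := e / m%:R ^+ 2.
Hypothesis a_small : forall k, (1 <= k <= m.-1)%N -> cabs (a k) < d.

Let mR : (3 : R) <= m%:R. Proof. by rewrite ler_nat. Qed.
Let d0 : 0 < d. Proof. by rewrite divr_gt0 ?exprn_gt0 // ltr0n; case: (m) m3. Qed.
Let dm2 : m%:R ^+ 2 * d = e.
Proof. by rewrite /d mulrC divfK // expf_neq0 // pnatr_eq0; case: (m) m3. Qed.

Let dm : m%:R * d <= e.
Proof.
rewrite -dm2 ler_pM2r // expr2 ler_peMl //; apply: le_trans mR; by rewrite ler1n.
Qed.

Let sum_ord_le (n : nat) (F : 'I_n -> R) (B : R) : (forall i, F i <= B) -> \sum_(i < n) F i <= n%:R * B.
Proof.
move=> h; apply: le_trans (ler_sum _ (fun i _ => h i)) _.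
by rewrite sumr_const card_ord mulr_natl.
Qed.

Lemma monic_poly_near w : cabs (f.[w] - w ^+ m - a 0) <= e * (1 + cabs w ^+ m).
Proof.
have w0 := cabs_ge0 w; have wm := exprn_ge0 m w0.
rewrite monic_poly_horner /monic_poly_fun.
case: m m3 a_small dm d0 wm => // n _ hs dm' d0' wm.
rewrite big_ord_recl /= expr0 mulr1.
rewrite (_ : _ - _ - _ = \sum_(i < n) a (bump 0 i) * w ^+ bump 0 i); last by ring.
apply: le_trans (cabs_sum _ _ _) _.
apply: (@le_trans _ _ (n%:R * (d * (1 + cabs w ^+ n.+1)))).
  apply: sum_ord_le => i; rewrite cabsM cabsX ler_pM ?cabs_ge0 ?exprn_ge0 //.
    by apply/ltW/hs; rewrite /bump /=.
  by apply: pow_le_1D => //; rewrite /bump /= add1n ltnS ltnW.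
rewrite mulrA ler_wpM2r //; first by rewrite addr_ge0.
apply: le_trans dm'; rewrite ler_pM2r // ler_nat //.
Qed.

Lemma monic_poly_deriv_near w : cabs ((f^`()).[w] - m%:R * w ^+ m.-1) <= e * (1 + cabs w ^+ m.-1).
Proof.
have w0 := cabs_ge0 w; have wm := exprn_ge0 m.-1 w0.
have -> : (f^`()).[w] = m%:R * w ^+ m.-1 + \sum_(k < m) a k * (k%:R * w ^+ k.-1).
  rewrite /f derivD derivXn hornerD hornerMn hornerXn mulr_natl; congr (_ + _).
  rewrite raddf_sum horner_sum; apply: eq_bigr => k _ /=.
  by rewrite derivZ derivXn hornerZ hornerMn hornerXn mulr_natl.
rewrite addrAC subrr add0r; apply: le_trans (cabs_sum _ _ _) _.
apply: (@le_trans _ _ (m%:R * (m%:R * d * (1 + cabs w ^+ m.-1)))); last first.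
  rewrite (_ : m%:R * _ = m%:R ^+ 2 * d * (1 + cabs w ^+ m.-1)); last by ring.
  by rewrite dm2.
apply: sum_ord_le => k; rewrite !cabsM cabs_nat cabsX.
have [k0|k0] := posnP k; first by rewrite k0 mul0r mulr0 mulr_ge0 ?mulr_ge0 ?addr_ge0 // ltW.
have km : (k <= m.-1)%N by rewrite -ltnS prednK //; case: (m) m3.
rewrite mulrA [cabs _ * _]mulrC ler_pM ?mulr_ge0 ?cabs_ge0 ?exprn_ge0 //.
  by rewrite ler_pM ?cabs_ge0 ?ler_nat ?(ltnW (ltn_ord k)) // ltW // a_small // k0.
by apply: pow_le_1D => //; apply: leq_trans km; exact: leq_pred.
Qed.

(** By Vieta the sum is minus the coefficient of degree m - 1. As m - 1 > 0, it does not depend on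
    [z] and is one of the small coefficients. *)
Lemma monic_poly_sum_preims z : cabs (\sum_(w <- preims f z) w) <= e.
Proof.
have m0 : (0 < m)%N by case: (m) m3.
have sz := size_preims monic_poly_monic monic_poly_size m0 z.
have h : (f - z%:P)`_m.-1 = - \sum_(w <- preims f z) w.
  rewrite (preims_prod monic_poly_monic monic_poly_size m0) -[in LHS]sz coefPn_prod_XsubC //.
  by rewrite sz; case: (m) m3.
have m1 : (m.-1 == 0)%N = false by case: (m) m3 => [|[|]].
move: h; rewrite coefB coefC m1 subr0 monic_poly_coef; last by rewrite prednK.
move=> /(congr1 (fun x => cabs x)); rewrite cabsN => <-.
apply: le_trans (ltW (a_small _)) _; first by rewrite leqnn andbT; case: (m) m3 => [|[|]].
apply: le_trans dm; rewrite ler_peMl ?(ltW d0) //; apply: le_trans mR; by rewrite ler1n.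
Qed.

End NearUnicritical.

(** * Preimages under iterates *)

Section IteratedPreimages.
Context {R : realType}.
Local Notation C := (Cplx R).
Variables (f : {poly C}) (m : nat).
Hypotheses (fmonic : f \is monic) (fsize : size f = m.+1) (m0 : (0 < m)%N).

(** Composed on the right, so that the derivative at a point splits off its first step; this matches
    [preimsn], which takes preimages of the points already found. *)
Definition iterp n : {poly C} := iter n (fun p => p \Po f) 'X.

Lemma iterp_horner n z : (iterp n).[z] = iter n (horner f) z.
Proof. by elim: n z => [|n IH] z; rewrite /= ?hornerX // horner_comp IH -iterSr. Qed.

Lemma iterp_deriv n z : ((iterp n.+1)^`()).[z] = ((iterp n)^`()).[f.[z]] * (f^`()).[z].
Proof. by rewrite /= deriv_comp hornerM horner_comp. Qed.

Fixpoint preimsn n (xi : C) : seq C :=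
  if n is n'.+1 then flatten [seq preims f v | v <- preimsn n' xi] else [:: xi].

Lemma size_preimsn n xi : size (preimsn n xi) = (m ^ n)%N.
Proof.
elim: n => //= n IH; rewrite size_flatten /shape -map_comp.
rewrite (eq_map (g := fun=> m)); last by move=> v /=; rewrite (size_preims fmonic fsize).
have h (s : seq C) : sumn [seq m | _ <- s] = (size s * m)%N by elim: s => //= x s ->; rewrite mulSn.
by rewrite h IH expnSr.
Qed.

Lemma preimsn_prod n xi z : iter n (horner f) z - xi = \prod_(w <- preimsn n xi) (z - w).
Proof.
elim: n z => [|n IH] z; first by rewrite /= big_seq1.
rewrite iterSr IH /= big_flatten big_map; apply: eq_bigr => v _.
by rewrite (horner_preims fmonic fsize).
Qed.

(** By the chain rule, the part of the sum over the preimages of one point v is |(f^n)' v|^2 times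
    the transfer operator at v, so each further step costs a factor [L]. *)
Lemma preimsn_sum_le (g : C -> R) (L : R) n xi : 0 <= L ->
  (forall z, \sum_(w <- preims f z) cabs (f^`()).[w] ^+ 2 * g w <= L * g z) ->
  \sum_(w <- preimsn n xi) cabs ((iterp n)^`()).[w] ^+ 2 * g w <= L ^+ n * g xi.
Proof.
move=> L0 h; elim: n => [|n IH].
  by rewrite /= big_seq1 derivX hornerC cabs1 expr1n.
rewrite [preimsn _ _]/= big_flatten big_map.
apply: (@le_trans _ _ (\sum_(v <- preimsn n xi) cabs ((iterp n)^`()).[v] ^+ 2 * (L * g v))).
  apply: ler_sum => v _.
  apply: (@le_trans _ _ (cabs ((iterp n)^`()).[v] ^+ 2 * \sum_(w <- preims f v) cabs (f^`()).[w] ^+ 2 * g w)).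
    rewrite mulr_sumr big_seq [leRHS]big_seq; apply: ler_sum => w.
    rewrite (mem_preims fmonic fsize) // => /eqP e.
    by rewrite iterp_deriv e cabsM exprMn mulrA.
  by rewrite ler_wpM2l ?exprn_ge0 ?cabs_ge0.
rewrite exprS -mulrA; apply: le_trans (ler_wpM2l L0 IH).
by rewrite mulr_sumr le_eqVlt; apply/orP; left; apply/eqP; apply: eq_bigr => v _; ring.
Qed.

End IteratedPreimages.

(** * Covers by squares in place of a change of variables *)

Section SquareCover.
Context {R : realType}.
Local Notation C := (Cplx R).

Lemma poly_taylor (p : {poly C}) (r : R) : exists2 K : R, 0 <= K &
  forall x y, cabs x <= r -> cabs y <= r ->
    cabs (p.[x] - p.[y] - (p^`()).[y] * (x - y)) <= K * cabs (x - y) ^+ 2.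
Proof.
elim/poly_ind: p => [|p c [K K0 hK]].
  by exists 0 => // x y _ _; rewrite derivC !horner0 mul0r !subr0 cabs0 mul0r.
have [L L0 hL] := poly_lipschitz p r.
exists (K * `|r| + L) => [|x y xr yr]; first by rewrite addr_ge0 ?mulr_ge0.
have pE z : (p * 'X + c%:P).[z] = p.[z] * z + c by rewrite !hornerE.
have dE : ((p * 'X + c%:P)^`()).[y] = (p^`()).[y] * y + p.[y].
  by rewrite derivD derivM derivX derivC !hornerE.
rewrite !pE dE.
rewrite (_ : _ - _ - _ = (p.[x] - p.[y] - (p^`()).[y] * (x - y)) * y + (p.[x] - p.[y]) * (x - y)); last by ring.
have h1 : cabs ((p.[x] - p.[y] - (p^`()).[y] * (x - y)) * y) <= K * cabs (x - y) ^+ 2 * `|r|.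
  by rewrite cabsM ler_pM ?cabs_ge0 ?hK //; exact: le_trans yr (ler_norm r).
have h2 : cabs ((p.[x] - p.[y]) * (x - y)) <= L * cabs (x - y) * cabs (x - y).
  by rewrite cabsM ler_wpM2r ?cabs_ge0 ?hL.
apply: le_trans (cabsD _ _) _; apply: le_trans (lerD h1 h2) _.
by rewrite le_eqVlt; apply/orP; left; apply/eqP; ring.
Qed.

Definition in_square (q : C) (s : R) (z : C) :=
  `|complex.Re z - complex.Re q| <= s /\ `|complex.Im z - complex.Im q| <= s.

Lemma in_square_cabs q s z : cabs (z - q) <= s -> in_square q s z.
Proof.
by move=> h; split; rewrite -?ReB -?ImB; apply: le_trans h; [exact: cabs_Re|exact: cabs_Im].
Qed.

(** An entry is a centre, a half-side and a height. The weight is the total volume of the boxes over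
    the squares, overlaps being counted repeatedly; it bounds the integral of a function dominated
    by the heights. *)
Definition cover_weight (l : seq (C * R * R)) : R := \sum_(x <- l) x.2 * (2 * x.1.2) ^+ 2.

Lemma grid_near (b x : R) (N : nat) : 0 < b -> (0 < N)%N -> `|x| <= b ->
  exists2 i, (i <= N)%N & `|x - (- b + 2 * b * i%:R / N%:R)| <= 2 * b / N%:R.
Proof.
move=> b0 N0 /ler_normlP[x1 x2].
have NR : 0 < N%:R :> R by rewrite ltr0n.
pose y := (x + b) * N%:R / (2 * b).
have y0 : 0 <= y by rewrite /y divr_ge0 ?mulr_ge0 ?ler0n //; lra.
have yN : y <= N%:R.
  rewrite /y ler_pdivrMr ?mulr_gt0 // mulrC ler_pM2l //; lra.
have /andP[t1 t2] := truncn_itv y0.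
exists (Num.trunc y); first by rewrite -(ler_nat R); exact: le_trans yN.
have xE : x = - b + 2 * b * y / N%:R by rewrite /y; field; rewrite !lt0r_neq0.
rewrite {1}xE (_ : _ - _ = 2 * b / N%:R * (y - (Num.trunc y)%:R)); last by ring.
have A0 : 0 <= 2 * b / N%:R by rewrite divr_ge0 ?mulr_ge0 // ltW.
rewrite normrM (ger0_norm A0) ler_piMr //.
by rewrite ler_norml; move: t2; rewrite -natr1; lra.
Qed.

Let weight_arith (s P : R) : 0 <= P -> 81 / 16 * P ^+ 4 * (2 * (2 * s / P)) ^+ 2 <= 81 * s ^+ 2 * P ^+ 2.
Proof.
move=> P0; have [->|Pn0] := eqVneq P 0.
  by rewrite expr0n /= mulr0 mul0r expr0n /= mulr0.
by rewrite le_eqVlt; apply/orP; left; apply/eqP; field.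
Qed.

(* Away from the critical points, P is nearly affine on the components of
   the preimage of a small square; the part where P' is small contributes at
   most eps. *)
Lemma poly_cover (P : {poly C}) (d : nat) (pre : C -> seq C) (b M eps : R) :
  (0 < d)%N -> 0 < b -> 0 <= M -> 0 < eps ->
  (forall xi, size (pre xi) = d) ->
  (forall xi z, P.[z] - xi = \prod_(w <- pre xi) (z - w)) ->
  (forall xi, cabs xi <= 2 * b -> \sum_(w <- pre xi) cabs (P^`()).[w] ^+ 2 <= M) ->
  exists l : seq (C * R * R), [/\ forall x, x \in l -> 0 <= x.1.2 /\ 0 <= x.2,
    cover_weight l <= 5184 * M * b ^+ 2 + eps &
    forall z, cabs P.[z] <= b -> exists2 x, x \in l & in_square x.1.1 x.1.2 z /\ cabs (P^`()).[z] ^+ 4 <= x.2].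
Proof.
move=> d0 b0 M0 eps0 hsize hprod hsum.
have near xi z : exists2 w, w \in pre xi & cabs (z - w) ^+ d <= cabs (P.[z] - xi).
  have [|w ws] := @seq_near _ (pre xi) z; first by rewrite -size_eq0 hsize -lt0n.
  by rewrite hsize -hprod; exists w.
have [T [T0 hT]] : exists T : R, 0 <= T /\ forall z, cabs P.[z] <= b -> cabs z <= T.
  have [B [B0 hB]] : exists B : R, 0 <= B /\ forall w, w \in pre 0 -> cabs w <= B.
    elim: (pre 0) => [|x s [B [B0 IH]]]; first by exists 0.
    exists (B + cabs x); split; first by rewrite addr_ge0 ?cabs_ge0.
    move=> w; rewrite inE => /orP[/eqP ->|/IH]; first by lra.
    by have := cabs_ge0 x; lra.
  exists (B + (1 + b)); split; first lra; move=> z hz.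
  have [w ws] := near 0 z; rewrite subr0 => hw; have := hB _ ws.
  suff : cabs (z - w) <= 1 + b by have := cabs_le_sub z w; lra.
  rewrite leNgt; apply/negP => h.
  have : cabs (z - w) <= cabs (z - w) ^+ d by apply: ler_eXnr => //; lra.
  lra.
have [K1 K10 hK1] := poly_lipschitz P^`() (T + 1).
have [K2 K20 hK2] := poly_taylor P (T + 1).
pose K := K1 + K2 + 1.
have K0 : 0 < K by rewrite /K; lra.
have hL x y : cabs x <= T + 1 -> cabs y <= T + 1 -> cabs ((P^`()).[x] - (P^`()).[y]) <= K * cabs (x - y).
  move=> hx hy; apply: le_trans (hK1 _ _ hx hy) _; rewrite ler_wpM2r ?cabs_ge0 // /K; lra.
have hTa x y : cabs x <= T + 1 -> cabs y <= T + 1 ->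
    cabs (P.[x] - P.[y] - (P^`()).[y] * (x - y)) <= K * cabs (x - y) ^+ 2.
  by move=> hx hy; apply: le_trans (hK2 _ _ hx hy) _; rewrite ler_wpM2r ?exprn_ge0 ?cabs_ge0 // /K; lra.
clearbody K.
have T2 : 0 < 64 * T ^+ 2 + 1 by have := sqr_ge0 T; lra.
(* Where |P'| is at most 2 k, one square of half-side [T] and height (2 k)^4 suffices, and its
   weight is at most [eps]. *)
have [k [k0 k1 kT]] : exists k : R, [/\ 0 < k, k <= 1 & 16 * k ^+ 4 * (2 * T) ^+ 2 <= eps].
  exists (Num.min 1 (eps / (64 * T ^+ 2 + 1))); set k := Num.min _ _.
  have kk0 : 0 < k by rewrite lt_min ltr01 divr_gt0.
  have kk1 : k <= 1 by rewrite ge_min lexx.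
  split => //.
  have kT : k * (64 * T ^+ 2 + 1) <= eps by rewrite -ler_pdivlMr // ge_min lexx orbT.
  have k4 : k ^+ 4 <= k by rewrite ler_iXnr // ltW.
  have : k ^+ 4 * (64 * T ^+ 2) <= k * (64 * T ^+ 2) by rewrite ler_wpM2r // mulr_ge0 // sqr_ge0.
  rewrite exprMn; lra.
(* Within distance [h] of a preimage w of a grid point, P' varies by at most k / 4, hence by at most
   a quarter of |P' w| when |P' w| >= k. *)
have [h [h0 h1 hK]] : exists h : R, [/\ 0 < h, h <= 1 & K * h <= k / 4].
  exists (Num.min 1 (k / (4 * K))); split; first by rewrite lt_min ltr01 divr_gt0 // mulr_gt0.
    by rewrite ge_min lexx.
  have : Num.min 1 (k / (4 * K)) <= k / (4 * K) by rewrite ge_min lexx orbT.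
  by rewrite ler_pdivlMr ?mulr_gt0 //; lra.
have hd0 : 0 < h ^+ d by exact: exprn_gt0.
pose N := (Num.trunc (4 * b / h ^+ d)).+1.
have NR : 0 < N%:R :> R by rewrite ltr0n.
pose s := 4 * b / N%:R.
have s0 : 0 < s by rewrite divr_gt0 ?mulr_gt0.
have sh : s <= h ^+ d.
  have : 4 * b / h ^+ d < N%:R by exact: truncnS_gt.
  by rewrite ltr_pdivrMr // => /ltW hN; rewrite /s ler_pdivrMr // [leRHS]mulrC.
pose gr (i : nat) : R := - b + 2 * b * i%:R / N%:R.
have gr_le i : (i <= N)%N -> `|gr i| <= b.
  move=> iN; have i0 : 0 <= i%:R / N%:R :> R by rewrite divr_ge0.
  have i1 : i%:R / N%:R <= 1 :> R by rewrite ler_pdivrMr // mul1r ler_nat.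
  rewrite ler_norml /gr -mulrA.
  have := mulr_ge0 (ltW b0) i0; have : b * (i%:R / N%:R) <= b * 1 by rewrite ler_pM2l.
  lra.
pose grid : seq C := [seq Complex (gr i) (gr j) | i <- iota 0 N.+1, j <- iota 0 N.+1].
have grid_le q : q \in grid -> cabs q <= 2 * b.
  move=> /allpairsP[[i j] [+ + ->]].
  rewrite !mem_iota !add0n !leq0n !ltnS => iN jN.
  by apply: le_trans (cabs_ReIm _) _ => /=; have := gr_le _ iN; have := gr_le _ jN; lra.
(* Half-side 2 s / |P' w| and height (3/2)^4 |P' w|^4 make the weight 81 s^2 |P' w|^2: the area of
   the square absorbs two of the four factors. If P' w = 0, division by zero gives half-side and
   weight 0, and the points near such w fall under the large square. *)
pose sq w := ((w, 2 * s / cabs (P^`()).[w]), 81 / 16 * cabs (P^`()).[w] ^+ 4) : C * R * R.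
pose l := ((0, T), 16 * k ^+ 4) :: [seq sq w | w <- flatten [seq pre q | q <- grid]].
exists l; split.
- move=> x; rewrite inE => /orP[/eqP ->|/mapP[w _ ->]] /=.
    by split => //; rewrite mulr_ge0 ?exprn_ge0 // ltW.
  by split; [rewrite divr_ge0 ?mulr_ge0 ?cabs_ge0 // ltW|rewrite mulr_ge0 ?exprn_ge0 ?cabs_ge0 //; lra].
- rewrite /cover_weight big_cons big_map big_flatten big_map addrC; apply: lerD; last exact: kT.
  apply: (@le_trans _ _ (\sum_(q <- grid) 81 * s ^+ 2 * M)).
    rewrite big_seq [leRHS]big_seq; apply: ler_sum => q qg.
    apply: (@le_trans _ _ (\sum_(w <- pre q) 81 * s ^+ 2 * cabs (P^`()).[w] ^+ 2)).
      by apply: ler_sum => w _ /=; apply: weight_arith; exact: cabs_ge0.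
    rewrite -mulr_sumr ler_wpM2l ?hsum ?grid_le // mulr_ge0 ?sqr_ge0 //.
  apply: le_trans (sum_le_size (B := 81 * s ^+ 2 * M) _) _; first by [].
  rewrite size_allpairs size_iota.
  (* The grid has at most 4 N^2 points and s = 4 b / N, so that 5184 is 4 times 81 times 16. *)
  have N4 : (N.+1 * N.+1)%:R <= 4 * N%:R ^+ 2 :> R.
    rewrite natrM -natr1; have : 1 <= N%:R :> R by rewrite ler1n.
    move=> hN; rewrite expr2; nra.
  have : 5184 * M * b ^+ 2 = 4 * N%:R ^+ 2 * (81 * s ^+ 2 * M).
    by rewrite /s; field; rewrite lt0r_neq0.
  move=> ->; rewrite ler_wpM2r // mulr_ge0 // mulr_ge0 ?sqr_ge0 //.
- move=> z hz.
  have hRe : `|complex.Re P.[z]| <= b := le_trans (cabs_Re _) hz.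
  have hIm : `|complex.Im P.[z]| <= b := le_trans (cabs_Im _) hz.
  have [i iN hi] := @grid_near b _ N b0 isT hRe; have [j jN hj] := @grid_near b _ N b0 isT hIm.
  pose q : C := Complex (gr i) (gr j).
  have qg : q \in grid by apply/allpairsP; exists (i, j); rewrite !mem_iota !add0n !leq0n !ltnS.
  have Pq : cabs (P.[z] - q) <= s.
    apply: le_trans (cabs_ReIm _) _; rewrite ReB ImB /=.
    have -> : s = 2 * b / N%:R + 2 * b / N%:R by rewrite /s; field; rewrite lt0r_neq0.
    exact: lerD.
  have [w ws hw] := near q z.
  have zw : cabs (z - w) <= h.
    rewrite leNgt; apply/negP => hh.
    have : h ^+ d < cabs (z - w) ^+ d by rewrite ltr_pXn2r ?nnegrE ?cabs_ge0 // ltW.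
    lra.
  have zT := hT _ hz.
  have zT1 : cabs z <= T + 1 by lra.
  have wT1 : cabs w <= T + 1 by have := cabs_le_sub w z; rewrite cabsBC; lra.
  have Pd := hL _ _ zT1 wT1.
  have Kzw : K * cabs (z - w) <= k / 4 by apply: le_trans hK; rewrite ler_pM2l.
  have Pzw : cabs (P^`()).[z] <= cabs (P^`()).[w] + k / 4.
    by have := cabs_le_sub (P^`()).[z] (P^`()).[w]; lra.
  have [bad|good] := ltP (cabs (P^`()).[w]) k.
    exists ((0, T), 16 * k ^+ 4); first by rewrite mem_head.
    split; first by apply: in_square_cabs; rewrite subr0.
    have -> : 16 * k ^+ 4 = (2 * k) ^+ 4 by ring.
    by apply: pow_le; [exact: cabs_ge0|lra].
  have Pw0 : 0 < cabs (P^`()).[w] by lra.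
  exists (sq w).
    rewrite inE; apply/orP; right; apply: map_f; apply/flattenP; exists (pre q) => //.
    exact: map_f.
  have Pwq : P.[w] = q.
    apply/eqP; rewrite -subr_eq0 hprod; apply/eqP.
    by rewrite (big_rem w) //= subrr mul0r.
  split.
    apply: in_square_cabs => /=.
    rewrite ler_pdivlMr //.
    have := hTa _ _ zT1 wT1; rewrite Pwq => ht.
    have := cabsB (P.[z] - q) (P.[z] - q - (P^`()).[w] * (z - w)).
    rewrite (_ : _ - (_ - _) = (P^`()).[w] * (z - w)); last by ring.
    rewrite cabsM => ht2.
    have t0 := cabs_ge0 (z - w).
    have : K * cabs (z - w) ^+ 2 <= k / 4 * cabs (z - w) by rewrite expr2 mulrA ler_wpM2r.
    have : k * cabs (z - w) <= cabs (P^`()).[w] * cabs (z - w) by rewrite ler_wpM2r.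
    lra.
  have -> : (sq w).2 = (3 / 2 * cabs (P^`()).[w]) ^+ 4 by rewrite /=; field.
  by apply: pow_le; [exact: cabs_ge0|lra].
Qed.

End SquareCover.

(** * From covers to integrals *)

Section IntegralOfCovered.
Context d (T : measurableType d) (R : realType) (mu : {measure set T -> \bar R}).
Context (E : eqType) (Q : E -> set T) (v : E -> R) (c : E -> R).
Import HBNNSimple.
Local Open Scope ereal_scope.

(** The majorant is the series of heights times indicators. Measurability is established for it and
    not for [h], so the integral of [h] is bounded through its definition as a supremum over simple
    functions. *)
Lemma integral_lt_pinfty_of_cover (D : set T) (h : T -> R) (l : nat -> seq E) (W : R) :
  (forall y, measurable (Q y)) ->
  (forall x, D x -> 0 <= h x)%R ->
  (forall n y, y \in l n -> mu (Q y) = (v y)%:E /\ (0 <= c y)%R) ->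
  (forall N, \sum_(n < N) \sum_(y <- l n) c y * v y <= W)%R ->
  (forall x, D x -> exists n, exists2 y, y \in l n & Q y x /\ (h x <= c y)%R) ->
  \int[mu]_(x in D) (h x)%:E < +oo.
Proof.
move=> mQ h0 l0 lW cov.
pose g n (x : T) : \bar R := \sum_(y <- l n) (c y * \1_(Q y) x)%:E.
have g0 n x : 0 <= g n x.
  rewrite /g big_seq; apply: sume_ge0 => y yl; rewrite lee_fin mulr_ge0 //; exact: (l0 _ _ yl).2.
have mterm y : measurable_fun setT (EFin \o (fun x : T => c y * \1_(Q y) x)%R).
  apply/measurable_EFinP; apply: measurable_funM; first exact: measurable_cst.
  exact: measurable_indic.
have mg n : measurable_fun setT (g n) by apply: emeasurable_sum => y; exact: mterm.
have ig n : \int[mu]_x g n x = (\sum_(y <- l n) c y * v y)%:E.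
  rewrite /g; elim: (l n) (@l0 n) => [|y s IH] hs.
    by under eq_integral do rewrite big_nil; rewrite big_nil integral0.
  have s0 z : z \in s -> mu (Q z) = (v z)%:E /\ (0 <= c z)%R by move=> zs; apply: hs; rewrite inE zs orbT.
  have [y1 y2] := hs y (mem_head _ _).
  under eq_integral do rewrite big_cons.
  have y0 x : 0 <= (c y * \1_(Q y) x)%:E by rewrite lee_fin mulr_ge0.
  have sum0 x : 0 <= \sum_(z <- s) (c z * \1_(Q z) x)%:E.
    rewrite big_seq; apply: sume_ge0 => z zs; rewrite lee_fin mulr_ge0 //; exact: (s0 _ zs).2.
  have msum : measurable_fun setT (fun x => \sum_(z <- s) (c z * \1_(Q z) x)%:E).
    by apply: emeasurable_sum => z; exact: mterm.
  rewrite ge0_integralD //; last exact: mterm.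
  rewrite IH // big_cons EFinD; congr (_ + _).
  under eq_integral do rewrite EFinM.
  have mi : measurable_fun setT (EFin \o (\1_(Q y) : T -> R)) by apply/measurable_EFinP; exact: measurable_indic.
  rewrite ge0_integralZl ?lee_fin //.


  by rewrite integral_indic // setIT y1 -EFinM.
have s_ge0 n : (0 <= \sum_(y <- l n) c y * v y)%R.
  rewrite big_seq sumr_ge0 // => y yl; have [yv y0] := l0 _ _ yl.
  by rewrite mulr_ge0 // -lee_fin -yv.
pose G x := \sum_(n <oo) g n x.
have G0 x : 0 <= G x by apply: nneseries_ge0 => n _ _; exact: g0.
have iG : \int[mu]_x G x <= W%:E.
  rewrite /G integral_nneseries //.
  apply: lime_le; first by apply: is_cvg_nneseries => n _ _; rewrite ig lee_fin.
  apply: nearW => n.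
  under eq_bigr do rewrite ig.
  by rewrite big_mkord sumEFin lee_fin.
have mG : measurable_fun setT G by apply: ge0_emeasurable_sum.
have hG x : D x -> (h x)%:E <= G x.
  move=> Dx; have [n [y yl [Qx hy]]] := cov _ Dx.
  apply: (@le_trans _ _ (g n x)).
    rewrite /g (big_rem y) //= indicE mem_set // mulr1 -[leLHS]adde0 leeD ?lee_fin //.
    rewrite big_seq; apply: sume_ge0 => z /mem_rem zl; rewrite lee_fin mulr_ge0 //; exact: (l0 _ _ zl).2.
  have G1 : \sum_(0 <= i < n.+1) g i x <= G x by apply: nneseries_lim_ge => i _ _; exact: g0.
  apply: le_trans G1; rewrite big_nat_recr //= -[leLHS]add0e leeD // sume_ge0 //.
apply: (@le_lt_trans _ _ (\int[mu]_x G x)); last by apply: le_lt_trans iG _; rewrite ltry.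
rewrite ge0_integralE; last by move=> x Dx; rewrite lee_fin h0.
apply/ge_ereal_sup => _ /= [k kh <-].
rewrite -integralT_nnsfun; apply: ge0_le_integral => //.
- by move=> x _; rewrite lee_fin.
- by apply/measurable_EFinP.
- move=> x _; apply: le_trans (kh x) _; rewrite /patch; case: ifPn => [|_]; last exact: G0.
  by rewrite inE => /hG.
Qed.

End IntegralOfCovered.

Section AreaIntegral.
Context {R : realType}.
Local Notation C := (Cplx R).

Lemma area_integral_lt_pinfty (D : set (R * R)) (h : R * R -> R) (l : nat -> seq (C * R * R)) (W : R) :
  (forall x, D x -> 0 <= h x) ->
  (forall n x, x \in l n -> 0 <= x.1.2 /\ 0 <= x.2) ->
  (forall N, \sum_(n < N) cover_weight (l n) <= W) ->
  (forall x, D x -> exists n, exists2 y, y \in l n &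
     in_square y.1.1 y.1.2 (Complex x.1 x.2) /\ h x <= y.2) ->
  (\int[@area_measure R]_(x in D) (h x)%:E < +oo)%E.
Proof.
move=> h0 l0 lW cov.
pose Q (x : C * R * R) : set (R * R) :=
  `[complex.Re x.1.1 - x.1.2, complex.Re x.1.1 + x.1.2]%classic `*`
  `[complex.Im x.1.1 - x.1.2, complex.Im x.1.1 + x.1.2]%classic.
apply: (@integral_lt_pinfty_of_cover _ _ R (@area_measure R) (C * R * R)%type Q (fun y => (2 * y.1.2) ^+ 2) snd D h l W) => //.
- by move=> y; apply: measurableX; exact: measurable_itv.
- move=> n y /l0[y1 y2]; split=> //.
  change (((@lebesgue_measure R) \x (@lebesgue_measure R)) (Q y) = ((2 * y.1.2) ^+ 2)%:E)%E.
  rewrite product_measure1E; [|exact: measurable_itv..].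
  have hl (a : R) : (lebesgue_measure ([set` `[(a - y.1.2)%R, (a + y.1.2)%R]] : set R) = (2 * y.1.2)%:E)%E.
    rewrite lebesgue_measure_itv /= lte_fin; case: ifPn => [_|].
      by rewrite -EFinD; congr EFin; ring.
    rewrite -leNgt => hh; have -> : y.1.2 = 0%R by lra.
    by rewrite mulr0.
  by rewrite expr2 EFinM; congr (_ * _)%E; exact: hl.
- move=> x /cov[n [y yl [[s1 s2] hy]]]; exists n; exists y => //; split=> //.
  by move: s1 s2; rewrite /Q /= !ler_norml => /andP[s1 s1'] /andP[s2 s2']; split; rewrite /= in_itv /=; lra.
Qed.

End AreaIntegral.

(** * Covers of the basin adapted to the Riemann map *)

Section Brennan.
Context {R : realType}.
Local Notation C := (Cplx R).

Lemma cover_weight_cat (l l' : seq (C * R * R)) : cover_weight (l ++ l') = cover_weight l + cover_weight l'.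
Proof. by rewrite /cover_weight big_cat. Qed.

Lemma cover_weight_scale (t : R) (l : seq (C * R * R)) :
  cover_weight [seq (y.1, t * y.2) | y <- l] = t * cover_weight l.
Proof. by rewrite /cover_weight big_map mulr_sumr; apply: eq_bigr => y _ /=; rewrite mulrA. Qed.

Lemma geo_sum_le (A q : R) N : 0 <= A -> 0 <= q < 1 -> \sum_(n < N) A * q ^+ n <= A / (1 - q).
Proof.
move=> A0 /andP[q0 q1]; rewrite -mulr_sumr ler_wpM2l // -[leRHS]mul1r ler_pdivlMr; last lra.
have -> : (\sum_(n < N) q ^+ n) * (1 - q) = 1 - q ^+ N.
  by rewrite -opprB mulrN mulrC -subrX1 opprB.
by have := exprn_ge0 N q0; lra.
Qed.

Lemma dyadic_scale (r x : R) : 0 < r -> r < x -> exists n, 2 ^+ n * r < x <= 2 ^+ n.+1 * r.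
Proof.
move=> r0 rx; have x0 : 0 < x by lra.
have ex : exists n, x <= 2 ^+ n * r.
  have [|n hn] := @geo_small R (1 / 2) (r / x) _ (divr_gt0 r0 x0); first lra.
  exists n; have P : 0 < (2 : R) ^+ n by rewrite exprn_gt0.
  move: hn; rewrite div1r exprVn ltr_pdivlMr // mulrC ltr_pdivrMr // => h; lra.
case: (ex_minnP ex) => -[|n] hn hmin; first by move: hn; rewrite expr0; lra.
exists n; rewrite hn andbT ltNge; apply/negP => /hmin; lia.
Qed.

Lemma powR_exp (x p : R) n : 0 <= x -> (x ^+ n) `^ p = (x `^ p) ^+ n.
Proof.
move=> x0; elim: n => [|n IH]; first by rewrite !expr0 powR1.
by rewrite !exprS powRM ?exprn_ge0 // IH.
Qed.

(** From one dyadic annulus at infinity to the next, areas grow by 4 and the bound on |Psi'| drops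
    by 4; this is the ratio of the outer series. *)
Lemma powR_fourth (p : R) : 1 < p -> 0 <= 4 * 4^-1 `^ p < 1.
Proof.
move=> p1; rewrite mulr_ge0 ?powR_ge0 //= -ltr_pdivlMl // mulr1.
rewrite -[ltRHS]powRr1 //.
rewrite /powR; case: ifPn => [|_]; first by rewrite invr_eq0; lra.
rewrite ltr_expR ltr_nM2r // ln_lt0 // invr_gt0 ltr0n /= invf_lt1 //; lra.
Qed.

Lemma powR_le_exp4 (x p : R) : 1 <= x -> p < 4 -> x `^ p <= x ^+ 4.
Proof.
by move=> x1 p4; rewrite -powR_mulrn; [apply: ler_powR => //; lra|lra].
Qed.

(** In its use, k = m^n, d = |Psi' z|, P = |(f^n)' z|, c = |Psi' (f^n z)| and x = |Psi z|^(m^n - 1);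
    the equation is the modulus of the derivative of Psi (f^n z) = Psi z ^ (m^n). *)
Lemma quotient_bound (k d P c x b r : R) : 0 <= k -> 0 <= d -> 0 <= P -> 0 < b -> 0 < r ->
  c * P = k * x * d -> c <= 2 / r ^+ 2 -> 1 / (2 * b) <= x -> k * d <= 4 * b / r ^+ 2 * P.
Proof.
move=> k0 d0 P0 b0 r0 E hc hx.
have kd0 : 0 <= k * d by rewrite mulr_ge0.
have h : 1 / (2 * b) * (k * d) <= 2 / r ^+ 2 * P.
  apply: (@le_trans _ _ (x * (k * d))); first by rewrite ler_wpM2r.
  by rewrite mulrCA mulrA -E ler_wpM2r.
have -> : 4 * b / r ^+ 2 * P = 2 * b * (2 / r ^+ 2 * P) by field; lra.
by rewrite -ler_pdivrMl ?mulr_gt0 // -div1r.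
Qed.

Section WithPsi.
Variables (f : {poly C}) (m : nat) (kappa : C) (Psi : C -> C) (Rad : R).
Hypotheses (fmonic : f \is monic) (fsize : size f = m.+1) (m1 : (1 < m)%N).
Hypothesis Psi_basin : forall z, basin f (Some z) -> [/\ Psi z != 0, cabs (Psi z) < 1,
  Psi f.[z] = Psi z ^+ m, cderiv Psi z (derive1 Psi z) & (f^`()).[z] != 0].
Hypothesis Rad0 : 0 < Rad.
Hypothesis Psi_outer : forall z, Rad < cabs (z - kappa) -> [/\ basin f (Some z),
  2 * cabs (z - kappa) <= cabs (f.[z] - kappa),
  cabs (derive1 Psi z) <= 2 / cabs (z - kappa) ^+ 2 & 1 / (2 * cabs (z - kappa)) <= cabs (Psi z)].

Lemma basin_iter n z : basin f (Some (iter n (horner f) z)) <-> basin f (Some z).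
Proof. by elim: n => //= n <-; exact: basin_horner. Qed.

Lemma basin_escape z : basin f (Some z) -> exists n, Rad < cabs (iter n (horner f) z - kappa).
Proof.
move=> /(_ (Rad + cabs kappa))[N /(_ N (leqnn N))] h; exists N.
by have := cabs_le_sub (iter N (horner f) z) kappa; lra.
Qed.

Lemma basin_open z : basin f (Some z) -> exists2 d : R, 0 < d & forall w, cabs (w - z) < d -> basin f (Some w).
Proof.
move=> /basin_escape[n hn].
have e0 : 0 < cabs (iter n (horner f) z - kappa) - Rad by lra.
have [d d0 hd] := cderiv_cont (cderiv_horner (iterp f n) z) e0.
exists d => // w /hd; rewrite !iterp_horner => h.
suff : Rad < cabs (iter n (horner f) w - kappa) by move=> /Psi_outer[/(basin_iter n)].
rewrite cabsBC in h; have := cabsB3 (iter n (horner f) w) (iter n (horner f) z) kappa; lra.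
Qed.

Lemma deriv_semiconj z : basin f (Some z) ->
  derive1 Psi f.[z] * (f^`()).[z] = m%:R * Psi z ^+ m.-1 * derive1 Psi z.
Proof.
move=> zb; have [_ _ _ dz _] := Psi_basin zb.
have [_ _ _ dfz _] := Psi_basin ((basin_horner f z).2 zb).
have [d d0 hd] := basin_open zb.
have [_ <-] := cderiv_derivable (cderiv_comp (cderiv_horner f z) dfz).
have dPsi : cderiv (fun w => Psi f.[w]) z (m%:R * Psi z ^+ m.-1 * derive1 Psi z).
  by apply: (cderiv_ext d0 _ (cderiv_comp dz (cderivXn (Psi z) m))) => w /hd/Psi_basin[_ _ ->].
by have [_ <-] := cderiv_derivable dPsi.
Qed.

Lemma iter_semiconj n z : basin f (Some z) -> Psi (iter n (horner f) z) = Psi z ^+ (m ^ n).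
Proof.
move=> zb; elim: n => [|n IH]; first by rewrite expn0 expr1.
by have [_ _ /= -> _ _] := Psi_basin ((basin_iter n z).2 zb); rewrite IH -exprM expnSr.
Qed.

Lemma deriv_iter_semiconj n z : basin f (Some z) ->
  derive1 Psi (iter n (horner f) z) * ((iterp f n)^`()).[z] =
  (m ^ n)%:R * Psi z ^+ (m ^ n).-1 * derive1 Psi z.
Proof.
elim: n z => [|n IH] z zb; first by rewrite /= derivX hornerC mulr1 expn0 expr0 !mul1r.
rewrite iterSr iterp_deriv mulrA IH ?basin_horner // -[LHS]mulrA deriv_semiconj //.
have [_ _ -> _ _] := Psi_basin zb.
rewrite -exprM expnS natrM.
have -> : (m * m ^ n).-1 = (m * (m ^ n).-1 + m.-1)%N.
  have : (0 < m ^ n)%N by rewrite expn_gt0; lia.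
  by case: (m ^ n)%N => // k _; rewrite mulnS /=; lia.
by rewrite exprD; ring.
Qed.

(** The derivative of the semiconjugacy carries the factor Psi z ^ (m^n - 1), which must not be
    small. As |Psi z| < 1, its modulus is at least |Psi (f^n z)|, and this is bounded below because
    f^n z is outside the radius [Rad] but within [B] of kappa. *)
Lemma deriv_bound_of_escape (B : R) n z : basin f (Some z) ->
  Rad < cabs (iter n (horner f) z - kappa) <= B ->
  (m ^ n)%:R * cabs (derive1 Psi z) <= 4 * B / Rad ^+ 2 * cabs ((iterp f n)^`()).[z].
Proof.
move=> zb /andP[h hB]; have [_ Psi1 _ _ _] := Psi_basin zb.
have := congr1 (@cabs R) (deriv_iter_semiconj n zb); rewrite !cabsM cabs_nat cabsX => E.
have [_ _ h1 h2] := Psi_outer h.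
have x0 : 0 < cabs (iter n (horner f) z - kappa) := lt_trans Rad0 h.
have B0 : 0 < B := lt_le_trans x0 hB.
have h2' : 1 / (2 * B) <= cabs (Psi z) ^+ (m ^ n).-1.
  apply: (@le_trans _ _ (cabs (Psi z) ^+ (m ^ n))); last first.
    by apply: ler_wiXn2l; rewrite ?cabs_ge0 ?ltW // leq_pred.
  rewrite -cabsX -iter_semiconj //; apply: le_trans h2.
  by rewrite !div1r lef_pV2 ?posrE ?mulr_gt0 // ler_pM2l.
have h1' : cabs (derive1 Psi (iter n (horner f) z)) <= 2 / Rad ^+ 2.
  apply: (le_trans h1); rewrite ler_pM2l // lef_pV2 ?posrE ?exprn_gt0 //.
  exact: pow_le (ltW Rad0) (ltW h).
exact: (quotient_bound (ler0n _ _) (cabs_ge0 _) (cabs_ge0 _) B0 Rad0 E h1' h2').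
Qed.

Section Inner.
Variables (g : C -> R) (q : R).
Hypotheses (g1 : forall z, 1 <= g z) (q0 : 0 < q).
Hypothesis g_bounded : forall r : R, exists2 G : R, 0 <= G & forall z, cabs z <= r -> g z <= G.
Hypothesis transfer : forall z, \sum_(w <- preims f z) cabs (f^`()).[w] ^+ 2 * g w <= q * m%:R ^+ 4 * g z.

(** A point is covered at its first escape time n > 0. One step earlier its orbit is within [Rad] of
    kappa, so |f^n z| is at most a constant [b] independent of n and the cover of that set applies.
    Rescaling heights by (K / m^n)^4 cancels m^(4n) in the n-th power of q m^4. *)
Lemma inner_cover : exists (A : R) (l : nat -> seq (C * R * R)), [/\ 0 <= A,
  forall n y, y \in l n -> 0 <= y.1.2 /\ 0 <= y.2,
  forall n, cover_weight (l n) <= A * q ^+ n &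
  forall z, basin f (Some z) -> cabs (z - kappa) <= Rad ->
    exists n, exists2 y, y \in l n & in_square y.1.1 y.1.2 z /\ cabs (derive1 Psi z) ^+ 4 <= y.2].
Proof.
have m0 : (0 < m)%N := ltnW m1.
have [b0 b00 hb0] := poly_bounded f (cabs kappa + Rad).
pose b := b0 + 1; have b_gt0 : 0 < b by rewrite /b; lra.
have hb z : cabs (z - kappa) <= Rad -> cabs f.[z] <= b.
  move=> h; have := hb0 z; have := cabsD (z - kappa) kappa; rewrite subrK /b => h1 h2.
  by have := h2 (le_trans h1 _); lra.
have [G G0 hG] := g_bounded (2 * b).
pose L := q * m%:R ^+ 4.
have mR : 0 < m%:R :> R by rewrite ltr0n.
have L0 : 0 < L by rewrite mulr_gt0 // exprn_gt0.
(* The allowance for small derivatives is taken to be L^n, of the order of the main term, so that it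
   too becomes a multiple of q^n after rescaling. *)
have cov n : exists l : seq (C * R * R), [/\ forall x, x \in l -> 0 <= x.1.2 /\ 0 <= x.2,
   cover_weight l <= 5184 * (L ^+ n * G) * b ^+ 2 + L ^+ n
   & forall z, cabs (iterp f n).[z] <= b -> exists2 x, x \in l & in_square x.1.1 x.1.2 z /\ cabs ((iterp f n)^`()).[z] ^+ 4 <= x.2].
  apply: (@poly_cover R (iterp f n) (m ^ n)%N (preimsn f n)) => //.
  - by rewrite expn_gt0 m0.
  - by rewrite mulr_ge0 // exprn_ge0 // ltW.
  - by rewrite exprn_gt0.
  - by move=> xi; exact: (size_preimsn fmonic fsize m0).
  - by move=> xi z; rewrite iterp_horner; rewrite (preimsn_prod fmonic fsize m0).
  - move=> xi hxi; apply: (@le_trans _ _ (L ^+ n * g xi)); last by rewrite ler_wpM2l ?exprn_ge0 ?(ltW L0) ?hG.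
    apply: le_trans (preimsn_sum_le fmonic fsize m0 n xi (ltW L0) transfer).
    by apply: ler_sum => w _; rewrite ler_peMr ?sqr_ge0.
have [l hl] := choice cov.
pose K := 4 * (b + cabs kappa) / Rad ^+ 2.
have K0 : 0 <= K by rewrite divr_ge0 ?sqr_ge0 // mulr_ge0 // addr_ge0 ?cabs_ge0 // ltW.
pose t n := (K / (m ^ n)%:R) ^+ 4.
have mn n : 0 < (m ^ n)%:R :> R by rewrite ltr0n expn_gt0 m0.
have t0 n : 0 <= t n by rewrite exprn_ge0 // divr_ge0 // ltW.
exists (K ^+ 4 * (5184 * G * b ^+ 2 + 1)), (fun n => [seq (y.1, t n * y.2) | y <- l n]); split.
- exact: (mulr_ge0 (exprn_ge0 4 K0) (addr_ge0 (mulr_ge0 (mulr_ge0 (ler0n _ _) G0) (sqr_ge0 b)) ler01)).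
- by move=> n _ /mapP[y yl ->] /=; have [h _ _] := hl n; have [y1 y2] := h _ yl; rewrite mulr_ge0.
- move=> n; have [_ h _] := hl n; rewrite cover_weight_scale.
  apply: (le_trans (ler_wpM2l (t0 n) h)).
  have -> : L ^+ n = q ^+ n * (m ^ n)%:R ^+ 4 by rewrite /L exprMn natrX -!exprM mulnC.
  rewrite /t expr_div_n; have P : (m ^ n)%:R ^+ 4 != 0 :> R by rewrite expf_neq0 // gt_eqF.
  rewrite le_eqVlt; apply/orP; left; apply/eqP.
  by move: P; move: (_ ^+ 4) => M P; field.
- move=> z zb zR.
  case: (ex_minnP (basin_escape zb)) => -[|n] hn hmin.
    by move: hn => /=; lra.
  have hle : cabs (iter n (horner f) z - kappa) <= Rad.
    by rewrite leNgt; apply/negP => /hmin; rewrite ltnn.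
  have hbn : cabs (iter n.+1 (horner f) z) <= b by exact: hb.
  have hBn : cabs (iter n.+1 (horner f) z - kappa) <= b + cabs kappa.
    by apply: (le_trans (cabsB _ _)); rewrite lerD2r.
  have := @deriv_bound_of_escape (b + cabs kappa) n.+1 z zb; rewrite hn hBn => /(_ isT) hd.
  have [_ _ h] := hl n.+1; have [|y yl [ys hy]] := h z; first by rewrite iterp_horner.
  exists n.+1; exists (y.1, t n.+1 * y.2); first by apply/mapP; exists y.
  split=> //=.
  apply: (@le_trans _ _ (t n.+1 * cabs ((iterp f n.+1)^`()).[z] ^+ 4)); last by rewrite ler_wpM2l.
  rewrite /t -exprMn; apply: pow_le; first exact: cabs_ge0.
  by rewrite mulrAC ler_pdivlMr // mulrC.
Qed.

End Inner.

(** Each dyadic annulus around kappa is enclosed in a square with half-side its outer radius; the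
    height is the value of (2 / |z - kappa|^2)^p at its inner radius. *)
Lemma outer_cover (p : R) : 1 < p -> exists (A q : R) (l : nat -> C * R * R), [/\ 0 <= A, 0 <= q < 1,
  forall n, 0 <= (l n).1.2 /\ 0 <= (l n).2,
  forall n, cover_weight [:: l n] <= A * q ^+ n &
  forall z, Rad < cabs (z - kappa) -> exists n, in_square (l n).1.1 (l n).1.2 z /\ cabs (derive1 Psi z) `^ p <= (l n).2].
Proof.
move=> p1.
exists ((2 / Rad ^+ 2) `^ p * (4 * Rad) ^+ 2), (4 * 4^-1 `^ p),
  (fun n => (kappa, 2 ^+ n.+1 * Rad, (2 / Rad ^+ 2 * 4^-1 ^+ n) `^ p)); split.
- by rewrite mulr_ge0 ?sqr_ge0 // powR_ge0.
- exact: powR_fourth.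
- by move=> n /=; rewrite powR_ge0 mulr_ge0 ?exprn_ge0 // ltW.
- move=> n; rewrite /cover_weight big_seq1 /= powRM ?exprn_ge0 ?invr_ge0 //; last first.
    by rewrite divr_ge0 ?sqr_ge0.
  rewrite powR_exp ?invr_ge0 // le_eqVlt; apply/orP; left; apply/eqP.
  rewrite [(4 * _) ^+ n]exprMn [(4 : R) ^+ n](_ : _ = (2 ^+ n) ^+ 2); last by rewrite -exprM mulnC exprM expr2; congr (_ ^+ n); ring.
  by rewrite [2 ^+ n.+1]exprS; ring.
- move=> z hz; have [n /andP[n1 n2]] := dyadic_scale Rad0 hz; exists n; split => /=.
    exact: in_square_cabs.
  have [_ _ h _] := Psi_outer hz.
  apply: ge0_ler_powR; rewrite ?nnegrE ?cabs_ge0 //; first by lra.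
    by rewrite mulr_ge0 ?exprn_ge0 ?invr_ge0 // divr_ge0 // sqr_ge0.
  apply: (le_trans h).
  have -> : 2 / Rad ^+ 2 * 4^-1 ^+ n = 2 / (2 ^+ n * Rad) ^+ 2.
    have -> : 4^-1 ^+ n = ((2 ^+ n) ^+ 2)^-1 :> R.
      by rewrite exprVn -exprM mulnC exprM expr2; congr ((_ ^+ n)^-1); ring.
    by rewrite exprMn [(_ * Rad ^+ 2)^-1]invfM -mulrA; congr (_ * _); exact: mulrC.
  have P : 0 < 2 ^+ n * Rad by rewrite mulr_gt0 ?exprn_gt0.
  by rewrite ler_pM2l // lef_pV2 ?posrE ?exprn_gt0 ?lerXn2r ?nnegrE ?ltW //; lra.
Qed.

End WithPsi.

End Brennan.

(** * Summing the covers *)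

Section BrennanBasin.
Context {R : realType}.
Local Notation C := (Cplx R).

(** The transfer bound is asked for only once the basin is known to contain no critical point: the
    bound on [c] behind it rests on this fact, which comes out of the uniformization. *)
Lemma brennan_of_transfer (f : {poly C}) (m : nat) (kappa : C) (g : C -> R) (q : R) :
  f \is monic -> size f = m.+1 -> (1 < m)%N -> f.[kappa] = kappa ->
  simply_connected R (basin f) ->
  (forall z, 1 <= g z) -> (forall r : R, exists2 G : R, 0 <= G & forall z, cabs z <= r -> g z <= G) ->
  0 < q < 1 ->
  ((forall z, basin f (Some z) -> (f^`()).[z] != 0) ->
   forall z, \sum_(w <- preims f z) cabs (f^`()).[w] ^+ 2 * g w <= q * m%:R ^+ 4 * g z) ->
  brennan_holds (basin f).
Proof.
move=> fmonic fsize m1 fk sc g1 gb /andP[q0 q1] transfer.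
have [Psi [Rad [bih Psi_basin Rad0 Psi_outer]]] := basin_uniformization fmonic fsize m1 fk sc.
exists (fun w => if w is Some z then Psi z else 0); split=> // p /andP[p43 p4].
have p1 : 1 < p by lra.
have [|A [l [A0 l0 lW lcov]]] := inner_cover fmonic fsize m1 Psi_basin Rad0 Psi_outer g1 q0 gb.
  by apply: transfer => z /Psi_basin[].
have [A' [q' [l' [A'0 q'01 l'0 l'W l'cov]]]] := outer_cover Rad0 Psi_outer p1.
(* The extra square of height 1, present at n = 0 only, accounts for the bounded part where |Psi'|
   <= 1: it is the term 1 in the bound 1 + |Psi'|^4. *)
pose ll n := l n ++ (l' n :: if n == 0%N then [:: (kappa, Rad, 1 : R)] else [::]).
pose last_weight n : R := if n == 0%N then (2 * Rad) ^+ 2 else 0.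
apply: (@area_integral_lt_pinfty R _ _ ll (A / (1 - q) + A' / (1 - q') + (2 * Rad) ^+ 2)).
- by move=> x _; exact: powR_ge0.
- move=> n y; rewrite /ll mem_cat inE => /orP[/l0//|/orP[/eqP ->//|]].
  by case: (n == 0%N); rewrite ?inE // => /eqP -> /=; rewrite ler01 ltW.
- move=> N.
  have h n : cover_weight (ll n) <= A * q ^+ n + A' * q' ^+ n + last_weight n.
    rewrite /ll -cat1s !cover_weight_cat addrA; apply: lerD; first by apply: lerD.
    by rewrite /last_weight; case: (n == 0%N); rewrite /cover_weight ?big_nil // big_seq1 /= mul1r.
  apply: (@le_trans _ _ (\sum_(n < N) (A * q ^+ n + A' * q' ^+ n + last_weight n))).
    by apply: ler_sum => n _; exact: h.
  rewrite !big_split /=; apply: lerD; first by apply: lerD; apply: geo_sum_le => //; rewrite ltW.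
  case: N => [|N]; first by rewrite big_ord0 sqr_ge0.
  by rewrite big_ord_recl big1 // addr0.
- move=> [x1 x2] /= xb; set z : C := Complex x1 x2.
  have [zR|zR] := ltP Rad (cabs (z - kappa)).
    have [n [h1 h2]] := l'cov z zR; exists n; exists (l' n) => //.
    by rewrite /ll mem_cat inE eqxx orbT.
  have [D1|D1] := leP (cabs (derive1 Psi z)) 1.
    exists 0%N; exists (kappa, Rad, 1 : R); first by rewrite /ll mem_cat !inE eqxx !orbT.
    split; first exact: in_square_cabs.
    apply: (@le_trans _ _ (1 `^ p)); last by rewrite powR1.
    by apply: ge0_ler_powR; rewrite ?nnegrE ?cabs_ge0 //; lra.
  have [n [y yl [h1 h2]]] := lcov z xb zR; exists n; exists y; first by rewrite /ll mem_cat yl.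
  by split=> //; apply: le_trans h2; apply: powR_le_exp4 => //; exact: ltW.
Qed.

End BrennanBasin.

Theorem mainTheorem2 (R : realType) (m : nat) :
  (3 <= m)%N ->
  exists delta : R, 0 < delta /\
    forall a : nat -> Cplx R,
      (forall k : nat, (1 <= k <= m.-1)%N -> cabs (a k) < delta) ->
      simply_connected R (basin_infinity (monic_poly_fun m a)) ->
      brennan_holds (basin_infinity (monic_poly_fun m a)).
Proof.
(* One tolerance serves all m: the numerical margins in [center_bound] and [transfer_bound] are
   uniform in m, and only delta = e / m^2 depends on it. *)
move=> m3; pose e : R := 1 / 1000.
have e0 : 0 < e by rewrite /e; lra.
have e1 : e <= 1 / 1000 := lexx _.
exists (e / m%:R ^+ 2); split; first by rewrite divr_gt0 // exprn_gt0 // ltr0n; lia.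
move=> a a_small; rewrite -monic_poly_horner -/(basin _) => sc.
have fmonic := monic_poly_monic m a; have fsize := monic_poly_size m a.
have m1 : (1 < m)%N by lia.
have [kappa fk] : exists kappa, (monic_poly m a).[kappa] = kappa by apply: fixpoint_exists; rewrite fsize.
have f_near := monic_poly_near m3 e0 a_small; have f'_near := monic_poly_deriv_near m3 e0 a_small.
apply: (@brennan_of_transfer R _ m kappa (fun w => cabs (w - a 0%N) ^+ 2 + 1) (19 / 20)) => //.
- by move=> z; have := sqr_ge0 (cabs (z - a 0%N)); lra.
- move=> r; exists ((`|r| + cabs (a 0%N)) ^+ 2 + 1); first by rewrite addr_ge0 // sqr_ge0.
  move=> z zr; rewrite lerD2r; apply: pow_le; first exact: cabs_ge0.
  by apply: (le_trans (cabsB _ _)); rewrite lerD2r; apply: le_trans zr _; exact: ler_norm.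
- by lra.
- move=> noncrit z; apply: (transfer_bound fmonic fsize m3 (ltW e0) e1 f_near f'_near).
    exact: monic_poly_sum_preims.
  exact: (center_bound fmonic fsize m3 (ltW e0) e1 f_near f'_near).
Qed.
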